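(* Let $\lambda\neq 0$ and let $\{g_n(\omega)\}_{n\ge1}$ be independent real random variables with $\mathbb{E}[g_n]=0$, $\mathbb{E}[g_n^2]=\lambda^2$, $\sum_{n\ge1}\mathbb{E}[g_n^4]n^{-2}<\infty$, and $\mathbb{P}[\lim_{n\to\infty}g_nn^{-1/4}=0]=1$. Fix $F>0$, $E\in\mathbb{R}$ and $\theta_+,\theta_-\in[0,\pi)$ with $\theta_+\ne\theta_-$. Let $\psi_\pm$ be the solutions of the generalized eigenvalue equation on $(0,\infty)$ with couplings $g_n(\omega)$ and $\psi_\pm(0)=\sin\theta_\pm$, $\psi_\pm'(0^+)=\cos\theta_\pm$, with Prüfer radii $R_\pm$. Then almost surely there is $\varrho_\infty\in(0,\infty)$ such that $$\limsup_{n\to\infty}\frac{\log\bigl|R_+(n)/R_-(n)-\varrho_\infty\bigr|}{\log n}\le-\frac{\lambda^2}{4F}.$$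
   Context: Generalized eigenvalue equation on $(0,\infty)$: $-\psi''-Fx\psi=E\psi$ on $(0,\infty)\setminus\mathbb{Z}$, $\psi$ continuous at each $n\ge1$, and $\lim_{\epsilon\to0^+}(\psi'(n+\epsilon)-\psi'(n-\epsilon))=g_n\psi(n)$ for $n\ge1$. Reference solution: $\zeta(x)=(\pi/F^{1/3})^{1/2}(i\,\mathrm{Ai}(-F^{1/3}(x+E/F))+\mathrm{Bi}(-F^{1/3}(x+E/F)))$ (Airy functions), which has no real zeros. Prüfer radius: for a real-valued solution $\psi$ and each $n\ge1$ there is a unique $\alpha(n)\in\mathbb{C}$ with $\psi(x)=\alpha(n)\zeta(x)+\overline{\alpha(n)}\,\overline{\zeta(x)}$ for $x\in(n-1,n)$; set $R(n)=2|\alpha(n)|$. *)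

(* Defs.v *)
(* over an arbitrary R : realType; complex numbers
   are mathcomp-real-closed's R[i]. *)
From HB Require Import structures.
From mathcomp Require Import all_boot all_order all_algebra.
From mathcomp Require Import all_classical all_reals all_analysis.
From mathcomp Require Import complex.
Set Implicit Arguments. Unset Strict Implicit. Unset Printing Implicit Defensive.
Import Order.TTheory GRing.Theory Num.Theory.
Import numFieldNormedType.Exports.
Local Open Scope classical_set_scope.
Local Open Scope ring_scope.

(* Airy functions, via their standard integral representations
   (DLMF 9.5.1, 9.5.4), as improper Riemann-type limits of Lebesgue
   integrals over [0,T], T -> +oo:
     Ai(x) = 1/pi * int_0^oo cos(t^3/3 + x t) dt
     Bi(x) = 1/pi * int_0^oo (exp(-t^3/3 + x t) + sin(t^3/3 + x t)) dt *)
Definition Airy_Ai {R : realType} (x : R) : R :=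
  pi^-1 * lim ((fun T : R => Rintegral lebesgue_measure `[0, T]
                   (fun t => cos (t ^+ 3 / 3 + x * t))) @ +oo).

Definition Airy_Bi {R : realType} (x : R) : R :=
  pi^-1 * lim ((fun T : R => Rintegral lebesgue_measure `[0, T]
                   (fun t => expR (- (t ^+ 3 / 3) + x * t)
                             + sin (t ^+ 3 / 3 + x * t))) @ +oo).

(* Reference solution
   zeta(x) = (pi/F^{1/3})^{1/2} (i Ai(-F^{1/3}(x+E/F)) + Bi(-F^{1/3}(x+E/F))) *)
Definition zeta_ref {R : realType} (F E : R) (x : R) : R[i] :=
  let k := F `^ (3^-1) in
  let s := - k * (x + E / F) in
  let c := Num.sqrt (pi / k) in
  ((c * Airy_Bi s) +i* (c * Airy_Ai s))%C.

(* psi solves the generalized eigenvalue equation on (0,oo) with couplings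
   (g n)_{n>=1}, with psi(0) = sin theta, psi'(0+) = cos theta. *)
Definition gen_eig_solution {R : realType} (F E : R) (g : nat -> R)
    (theta : R) (psi : R -> R) : Prop :=
  [/\ (* the differential equation on (0,oo) \ Z *)
      (forall x : R, 0 < x -> (forall n : nat, x != n%:R) ->
         [/\ derivable psi x 1, derivable (derive1 psi) x 1 &
             - derive1n 2 psi x - F * x * psi x = E * psi x]),
      (* continuity at each n >= 1 *)
      (forall n : nat, (1 <= n)%N -> {for n%:R, continuous psi}),
      (* jump conditions *)
      (forall n : nat, (1 <= n)%N ->
         (fun e : R => derive1 psi (n%:R + e) - derive1 psi (n%:R - e))
           @ (0 : R)^'+ --> g n * psi n%:R),
      (* boundary conditions at 0 *)
      psi @ (0 : R)^'+ --> psi 0 /\ psi 0 = sin theta &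
      (derive1 psi) @ (0 : R)^'+ --> cos theta].

(* Pruefer radius: R(n) = 2|alpha(n)| where
   psi(x) = alpha(n) zeta(x) + conj(alpha(n)) conj(zeta(x)) on (n-1,n).
   (alpha(n) is unique, so this relation determines R(n).) *)
Definition pruefer_radius {R : realType} (F E : R) (psi : R -> R)
    (n : nat) (r : R) : Prop :=
  exists alpha : R[i],
    (forall x : R, n%:R - 1 < x < n%:R ->
       ((psi x)%:C = alpha * zeta_ref F E x + alpha^* * (zeta_ref F E x)^*)%C)
    /\ r = 2 * ComplexField.Normc.normc alpha.

(* Mutual independence of the real random variables (X n)_{n in I}:
   product rule over every finite subfamily and all Borel sets. *)
Definition mutually_independent {d} {T : measurableType d} {R : realType}
    (P : probability T R) (I : set nat) (X : nat -> T -> R) : Prop :=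
  forall (s : seq nat), uniq s -> (forall j, j \in s -> I j) ->
  forall B : nat -> set R, (forall j, measurable (B j)) ->
    P (\big[setI/setT]_(j <- s) (X j @^-1` B j)) =
    (\prod_(j <- s) P (X j @^-1` B j))%E.

(* log with log 0 = -oo (extended-real valued) *)
Definition elog {R : realType} (x : R) : \bar R :=
  if x == 0 then -oo%E else (ln x)%:E.

(* Main.v *)
Require Import Defs.
From HB Require Import structures.
From mathcomp Require Import all_boot all_order all_algebra.
From mathcomp Require Import all_classical all_reals all_analysis.
From mathcomp Require Import measurable_realfun complex.
From mathcomp Require Import ring lra.

(* On the cell (n-1, n) write psi = C1 Re zeta + C2 Im zeta, so that R(n) = |C|; by variation of
   parameters the site n acts on C as a shear of determinant 1, and det(C+, C-) is constant.  With
   k = sqrt(F n + E) the energy k psi^2 + psi'^2 / k, which is at most a multiple of |C|^2, is an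
   adiabatic invariant between sites, while its phase turns by about k per cell.  At a site its
   logarithm changes by X sin(2 theta) + X^2 (1/4 + oscillating terms), with X = g_n / k.  The first
   term is a martingale difference.  The oscillating terms average out by van der Corput's
   inequality, and by the moment hypotheses g_n^2 may be replaced by lambda^2.  As sum 1/k^2 is
   asymptotic to (log n)/F, this gives R(n)^2 >= n^(lambda^2/(4F) - o(1)) almost surely.

   The ratio x = <C+, C-> / |C-|^2 has increments det(C+, C-) (g b1 + g^2 b2) / |C-|^2 with b1 = O(1/k)
   and b2 = O(1/k^2), so by the maximal inequality it converges at the rate n^(-lambda^2/(4F) + o(1)),
   and (R+/R-)^2 = x^2 + det(C+, C-)^2 / |C-|^4.  Exchanging the two solutions shows that the limit is
   not 0. *)

Set Implicit Arguments. Unset Strict Implicit. Unset Printing Implicit Defensive.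
Import Order.TTheory GRing.Theory Num.Theory.
Import numFieldNormedType.Exports.
Local Open Scope classical_set_scope.
Local Open Scope ring_scope.

(** The reference solution is given only by its Airy integrals. From these the proof extracts that
    [zeta] is continuously differentiable; its differential equation and its constant nonzero
    Wronskian are inherited from the two given solutions, which are combinations of [zeta] on every
    cell. The same matching expresses their coefficients by an explicit recursion in
    [g 1, ..., g n], and this makes them random variables although [psi] is given pointwise in the
    sample. Probability enters as the almost sure boundedness of a few random sums, obtained by
    stopping; the rest is pathwise Abel summation. Time is measured by the clock [L n], the sum of
    [1 / k^2]: the energy grows at least like [exp ((lambda^2 / 4 - o(1)) L)], errors are [o(L)],
    and comparing [L] with [log n / F] gives the exponent. Growth of [|C-|] is known only almost
    surely, so the coefficients of the martingale behind the ratio are truncated before the maximal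
    inequality is applied. Rates [tau < lambda^2 / 4] are taken along a sequence, which keeps the
    exceptional sets countable in number. *)

(** * Calculus of one real variable *)

Section RealDerivatives.
Context {R : realType}.
Implicit Types (f g : R -> R) (x a b : R).

(* Not a class, unlike [is_derive]: [apply:] must not discharge premises by instance search. *)
Definition isd f x a : Prop := is_derive x 1 f a.

Lemma isd_eq f x a b : a = b -> isd f x a -> isd f x b.
Proof. by move=> <-. Qed.

Lemma isd_cst c x : isd (fun=> c) x (0 : R).
Proof. exact: is_derive_cst. Qed.

Lemma isd_id x : isd (fun t => t) x (1 : R).
Proof. exact: is_derive_id. Qed.

Lemma isdD f g x a b : isd f x a -> isd g x b ->
  isd (fun t => f t + g t) x (a + b).
Proof. by move=> fa gb; exact: is_deriveD. Qed.

Lemma isdN f x a : isd f x a -> isd (fun t => - f t) x (- a).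
Proof. by move=> fa; exact: is_deriveN. Qed.

Lemma isdM f g x a b : isd f x a -> isd g x b ->
  isd (fun t => f t * g t) x (a * g x + f x * b).
Proof.
move=> fa gb; have h : is_derive x 1 (f * g) (f x *: b + g x *: a).
  exact: is_deriveM.
rewrite (_ : (fun t => f t * g t) = f * g)//.
by apply: isd_eq h; rewrite /GRing.scale/= addrC [g x * a]mulrC.
Qed.

Lemma isdX n f x a : isd f x a ->
  isd (fun t => f t ^+ n) x (n%:R * f x ^+ n.-1 * a).
Proof.
move=> fa; have h : is_derive x 1 (f ^+ n) ((n%:R * f x ^+ n.-1) *: a).
  exact: is_deriveX.
by rewrite (_ : (fun t => f t ^+ n) = f ^+ n)//; apply/funext => t; rewrite exprfctE.
Qed.

Lemma isdV f x a : isd f x a -> f x != 0 ->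
  isd (fun t => (f t)^-1) x (- a / f x ^+ 2).
Proof.
move=> [fa fE] fx0; apply: DeriveDef; first exact: derivableV.
by rewrite deriveV// fE /GRing.scale/= mulNr -exprVn mulNr mulrC.
Qed.

Lemma isd_comp f g x a b : isd f (g x) a -> isd g x b ->
  isd (fun t => f (g t)) x (a * b).
Proof. by move=> fa gb; exact: (@is_derive1_comp R f g). Qed.

Lemma isd_cos g x b : isd g x b ->
  isd (fun t => cos (g t)) x (- sin (g x) * b).
Proof. by move=> gb; apply: (isd_comp _ gb); exact: is_derive_cos. Qed.

Lemma isd_sin g x b : isd g x b ->
  isd (fun t => sin (g t)) x (cos (g x) * b).
Proof. by move=> gb; apply: (isd_comp _ gb); exact: is_derive_sin. Qed.

Lemma isd_exp g x b : isd g x b ->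
  isd (fun t => expR (g t)) x (expR (g x) * b).
Proof. by move=> gb; apply: (isd_comp _ gb); exact: is_derive_expR. Qed.

Lemma isd_sqrt g x b : isd g x b -> 0 < g x ->
  isd (fun t => Num.sqrt (g t)) x ((2 * Num.sqrt (g x))^-1 * b).
Proof. by move=> gb gx0; apply: (isd_comp _ gb); exact: is_derive1_sqrt. Qed.

Lemma isd_ln g x b : isd g x b -> 0 < g x ->
  isd (fun t => ln (g t)) x ((g x)^-1 * b).
Proof. by move=> gb gx0; apply: (isd_comp _ gb); exact: is_derive1_ln. Qed.

Lemma isd_cont f x a : isd f x a -> {for x, continuous f}.
Proof. by move=> [fa _]; exact/differentiable_continuous/derivable1_diffP. Qed.

Lemma isd_contW f (df : R -> R) a b :
  (forall x, a <= x <= b -> isd f x (df x)) ->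
  {within `[a, b], continuous f}.
Proof.
move=> h; apply: continuous_in_subspaceT => x; rewrite inE/= in_itv/= => xab.
exact: isd_cont (h _ xab).
Qed.

Lemma isd_le f (df : R -> R) a b : a <= b -> {within `[a, b], continuous f} ->
  (forall x, a < x < b -> isd f x (df x)) ->
  (forall x, a < x < b -> df x <= 0) -> f b <= f a.
Proof.
rewrite le_eqVlt => /predU1P[-> //|ab] cf fd df0.
have fd' c : c \in `]a, b[ -> isd f c (df c).
  by rewrite in_itv/=; exact: fd.
have [c] := MVT ab fd' cf; rewrite in_itv/= => cab E.
by rewrite -subr_le0 E mulr_le0_ge0 ?df0// subr_ge0 ltW.
Qed.

Lemma isd_lip f (df : R -> R) a b M : a <= b ->
  {within `[a, b], continuous f} ->
  (forall x, a < x < b -> isd f x (df x)) ->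
  (forall x, a < x < b -> `|df x| <= M) -> `|f b - f a| <= M * (b - a).
Proof.
rewrite le_eqVlt => /predU1P[-> _ _ _|ab cf fd dfM].
  by rewrite !subrr normr0 mulr0.
have fd' c : c \in `]a, b[ -> isd f c (df c).
  by rewrite in_itv/=; exact: fd.
have [c] := MVT ab fd' cf; rewrite in_itv/= => cab ->.
have ba : 0 <= b - a by rewrite subr_ge0 ltW.
by rewrite normrM [`|b - a|]ger0_norm// ler_wpM2r// dfM.
Qed.

Lemma isd_cst_eq f a b : a <= b -> {within `[a, b], continuous f} ->
  (forall x, a < x < b -> isd f x 0) -> f b = f a.
Proof.
move=> ab cf fd; apply/eqP; rewrite -subr_eq0 -normr_le0.
rewrite -(mul0r (b - a)).
by apply: (isd_lip (df := fun=> 0) ab cf fd) => x _; rewrite normr0.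
Qed.

End RealDerivatives.

Ltac deriv := repeat first
  [ apply: isd_cst | apply: isd_id | eassumption | apply: isdD | apply: isdN
  | apply: isdX | apply: isdM | apply: isd_cos | apply: isd_sin
  | apply: isd_exp | apply: isdV | apply: isd_sqrt ].

(** * Differentiation of improper integrals in a parameter *)

Section ParametricImproperIntegrals.
Context {R : realType}.
Implicit Types (x y t c : R).

Lemma isd_eps (f : R -> R) (x d : R) :
  (forall e, 0 < e -> exists2 r, 0 < r & forall y, `|y - x| < r ->
     `|f y - f x - (y - x) * d| <= e * `|y - x|) ->
  isd f x d.
Proof.
move=> H.
have cv : h^-1 *: (f (h *: 1 + x) - f x) @[h --> 0^'] --> d.
  apply/cvgrPdist_le => e e0; have [r r0 Hr] := H _ e0.
  near=> h.
  have h0 : h != 0 by near: h; exact: nbhs_dnbhs_neq.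
  have hr : `|h| < r.
    near: h; apply: dnbhs0_lt => //.
  have := Hr (h + x); rewrite addrK => /(_ hr) B.
  rewrite {1}/GRing.scale/= [h *: 1]mulr1 distrC.
  rewrite (_ : _ - d = h^-1 * (f (h + x) - f x - h * d)); last by field.
  by rewrite normrM normfV mulrC ler_pdivrMr ?normr_gt0.
rewrite /isd; apply: DeriveDef; first by apply/cvg_ex; exists d.
exact/cvg_lim.
Unshelve. all: by end_near. Qed.

Lemma between_ball x y c A : Num.min x y <= c <= Num.max x y ->
  `|x| <= A -> `|y| <= A -> `|c| <= A.
Proof. by rewrite !ler_norml; have [xy|yx] := leP x y; lra. Qed.

Lemma between_dist x y c : Num.min x y <= c <= Num.max x y ->
  `|c - x| <= `|y - x|.
Proof.
have [xy|yx] := leP x y => cxy; rewrite ler_norml.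
  by rewrite [`|y - x|]ger0_norm ?subr_ge0//; lra.
by rewrite [`|y - x|]ltr0_norm ?subr_lt0//; lra.
Qed.

Lemma isd_lip_between (f df : R -> R) x y M :
  (forall c, Num.min x y <= c <= Num.max x y -> isd f c (df c)) ->
  (forall c, Num.min x y <= c <= Num.max x y -> `|df c| <= M) ->
  `|f y - f x| <= M * `|y - x|.
Proof.
have key u v : u <= v -> (forall c, u <= c <= v -> isd f c (df c)) ->
    (forall c, u <= c <= v -> `|df c| <= M) -> `|f v - f u| <= M * `|v - u|.
  move=> uv fd fM; rewrite [`|v - u|]ger0_norm ?subr_ge0//.
  apply: (isd_lip (df := df)) => //; first exact: (isd_contW fd).
  - by move=> c cxy; apply: fd; move: cxy; lra.
  - by move=> c cxy; apply: fM; move: cxy; lra.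
have [xy|/ltW yx] := leP x y; first exact: key.
by rewrite distrC [`|y - x|]distrC; exact: key.
Qed.

Lemma isd_lip_ball (f df : R -> R) (A M : R) :
  (forall x, `|x| <= A -> isd f x (df x)) ->
  (forall x, `|x| <= A -> `|df x| <= M) ->
  forall x y, `|x| <= A -> `|y| <= A -> `|f y - f x| <= M * `|y - x|.
Proof.
move=> fd fM x y xA yA; apply: (isd_lip_between (df := df)) => c cxy.
  by apply: fd; exact: between_ball cxy xA yA.
by apply: fM; exact: between_ball cxy xA yA.
Qed.

Lemma isd_quad_ball (f f1 f2 : R -> R) (A M : R) :
  (forall x, `|x| <= A -> isd f x (f1 x)) ->
  (forall x, `|x| <= A -> isd f1 x (f2 x)) ->
  (forall x, `|x| <= A -> `|f2 x| <= M) ->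
  forall x y, `|x| <= A -> `|y| <= A ->
    `|f y - f x - (y - x) * f1 x| <= M * `|y - x| ^+ 2.
Proof.
move=> fd f1d f2M x y xA yA.
have M0 : 0 <= M by rewrite (le_trans _ (f2M x xA)).
rewrite (_ : _ - _ - _ = f y - y * f1 x - (f x - x * f1 x)); last by ring.
rewrite expr2 mulrA.
apply: (isd_lip_between (f := fun u => f u - u * f1 x)
    (df := fun c => f1 c - f1 x)) => c cxy; have cA := between_ball cxy xA yA.
  apply: isd_eq; last by deriv; exact: fd.
  by rewrite /=; ring.
rewrite (le_trans (isd_lip_ball f1d f2M xA cA))// ler_wpM2l//.
exact: between_dist cxy.
Qed.

(* The primitive [I] of [f] differs from the vanishing function [H] by a function whose derivative is [O(1/t^2)]. *)
Lemma primitive_tail (I f H h : R -> R) (K S0 : R) : 0 < S0 -> 0 <= K ->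
  (forall t, S0 <= t -> isd I t (f t)) ->
  (forall t, S0 <= t -> isd H t (h t)) ->
  (forall t, S0 <= t -> `|f t - h t| <= K / t ^+ 2) ->
  (forall t, S0 <= t -> `|H t| <= K / t) ->
  forall S T, S0 <= S -> S <= T -> `|I T - I S| <= 3 * K / S.
Proof.
move=> S00 K0 Id Hd fh HK S T S0S ST.
have S_gt0 : 0 < S by exact: lt_le_trans S0S.
have T_gt0 : 0 < T by exact: lt_le_trans ST.
(* For [s = 1] and [s = -1] this function has derivative at most [K / t^2 - K / t^2 = 0]. The two
   monotonicities bound the variation of [I - H] from both sides. *)
have Gd (s : R) t : S <= t -> isd (fun t => s * (I t - H t) + K / t) t (s * (f t - h t) - K / t ^+ 2).
  move=> St; have t0 : t != 0 by rewrite gt_eqF// (lt_le_trans S_gt0).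
  apply: isd_eq; last first.
    deriv; [exact/Id/(le_trans S0S)|exact/Hd/(le_trans S0S)].
  by rewrite /=; field.
have mono (s : R) : `|s| = 1 ->
    s * (I T - H T) + K / T <= s * (I S - H S) + K / S.
  move=> s1; apply: (isd_le (f := fun t => s * (I t - H t) + K / t) ST).
  - by apply: isd_contW => t /andP[St _]; exact: Gd.
  - by move=> t /andP[/ltW St _]; exact: Gd.
  - move=> t /andP[/ltW St _]; rewrite subr_le0.
    by rewrite (le_trans (ler_norm _))// normrM s1 mul1r fh// (le_trans _ St).
have := mono 1 (normr1 _); have := mono (-1) (normrN1 _).
have := HK _ S0S; have := HK _ (le_trans S0S ST); rewrite !ler_norml.
have : K / T <= K / S by rewrite ler_wpM2l// lef_pV2.
have : 0 <= K / T by rewrite divr_ge0// ltW.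
rewrite -!mulrA; set kt := K * T^-1; set ks := K * S^-1; lra.
Qed.

Lemma tail_cvg (I : R -> R) (K S0 : R) : 0 < S0 -> 0 <= K ->
  (forall S T, S0 <= S -> S <= T -> `|I T - I S| <= K / S) ->
  I @ +oo --> lim (I @ +oo) /\
  (forall S, S0 <= S -> `|lim (I @ +oo) - I S| <= K / S).
Proof.
move=> S00 K0 IK.
have cv : cvg (I @ +oo).
  apply/cauchy_cvgP/cauchy_exP => e e0.
  pose S := Num.max S0 (2 * K / e).
  have S_gt0 : 0 < S by rewrite lt_max S00.
  exists (I S); exists S; split; first exact: num_real.
  move=> T /ltW ST /=; rewrite /ball/= distrC (le_lt_trans (IK _ _ _ ST))//.
    by rewrite le_max lexx.
  rewrite ltr_pdivrMr//.
  have : 2 * K / e <= S by rewrite le_max lexx orbT.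
  rewrite ler_pdivrMr//; move: (mulr_gt0 e0 S_gt0); rewrite (mulrC S e); lra.
split=> // S S0S.
have cvd : (fun T => `|I T - I S|) @ +oo --> `|lim (I @ +oo) - I S|.
  by apply: cvg_norm; apply: cvgB => //; exact: cvg_cst.
apply: (cvgr_to_le cvd).
exists S; split; first exact: num_real.
by move=> T /ltW ST /=; exact: IK.
Qed.

Definition prim (f : R -> R) (T : R) : R :=
  Rintegral lebesgue_measure `[0, T] f.

Lemma prim_integrable (f : R -> R) T : continuous f ->
  lebesgue_measure.-integrable `[0, T] (EFin \o f).
Proof.
move=> cf; apply: continuous_compact_integrable; first exact: segment_compact.
exact: continuous_subspaceT.
Qed.

Lemma isd_prim (f : R -> R) T : continuous f -> 0 < T -> isd (prim f) T (f T).
Proof.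
move=> cf T0; have T1 : T < T + 1 by rewrite ltrDl.
have [d dE] := continuous_FTC1_closed T1 (prim_integrable (T + 1) cf) T0 (cf T).
by rewrite /isd; apply: DeriveDef => //; rewrite -derive1E.
Qed.

Lemma prim_cont (f : R -> R) T : continuous f -> 0 <= T ->
  {within `[0, T], continuous (prim f)}.
Proof. by move=> cf T0; apply: parameterized_integral_continuous => //; exact: prim_integrable. Qed.

Lemma prim0 (f : R -> R) : prim f 0 = 0.
Proof. by rewrite /prim set_itv1 Rintegral_set1. Qed.

Lemma prim_lip (f : R -> R) T M : continuous f -> 0 <= T ->
  (forall t, 0 <= t <= T -> `|f t| <= M) -> `|prim f T| <= M * T.
Proof.
move=> cf T0 fM; have := @isd_lip _ (prim f) f 0 T M T0 (prim_cont cf T0).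
rewrite prim0 !subr0; apply=> t; first by case/andP => t0 _; exact: isd_prim.
by case/andP => t0 tT; apply: fM; rewrite !ltW.
Qed.

Lemma primB (f g : R -> R) T : continuous f -> continuous g ->
  prim (fun t => f t - g t) T = prim f T - prim g T.
Proof. by move=> cf cg; rewrite /prim RintegralB//; exact: prim_integrable. Qed.

Lemma primZ a (f : R -> R) T : continuous f ->
  prim (fun t => a * f t) T = a * prim f T.
Proof. by move=> cf; rewrite /prim RintegralZl//; exact: prim_integrable. Qed.

(** Convergence of the improper integral, locally uniform in the parameter and with rate [1 / S].
    The uniformity is what allows limit and derivative to be exchanged. *)
Definition tails_vanish (f : R -> R -> R) := forall A, exists K S0,
  [/\ 0 <= K, 0 < S0 & forall x, `|x| <= A -> forall S T, S0 <= S -> S <= T ->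
   `|prim (f x) T - prim (f x) S| <= K / S].

Definition improper (f : R -> R -> R) (x : R) : R := lim (prim (f x) @ +oo).

Lemma improper_tail (f : R -> R -> R) : tails_vanish f -> forall A, exists K S0,
  [/\ 0 <= K, 0 < S0 & forall x, `|x| <= A -> forall S, S0 <= S ->
   `|improper f x - prim (f x) S| <= K / S].
Proof.
move=> ft A; have [K [S0 [K0 S00 H]]] := ft A; exists K, S0; split => // x xA.
exact: (tail_cvg S00 K0 (H _ xA)).2.
Qed.

Lemma improper_cvg (f : R -> R -> R) x : tails_vanish f ->
  prim (f x) @ +oo --> improper f x.
Proof.
move=> ft; have [K [S0 [K0 S00 H]]] := ft `|x|.
exact: (tail_cvg S00 K0 (H _ (lexx _))).1.
Qed.

Variables f f1 f2 : R -> R -> R.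
Hypothesis fc : forall x, continuous (f x).
Hypothesis f1c : forall x, continuous (f1 x).
Hypothesis fd : forall x t, isd (f^~ t) x (f1 x t).
Hypothesis f1d : forall x t, isd (f1^~ t) x (f2 x t).
Hypothesis f2M : forall A T, exists M, forall x t, `|x| <= A -> 0 <= t <= T ->
  `|f2 x t| <= M.
Hypothesis ft : tails_vanish f.
Hypothesis f1t : tails_vanish f1.

Lemma prim_param_lip A T : 0 <= T -> exists2 M, 0 <= M & forall x y,
  `|x| <= A -> `|y| <= A ->
  `|prim (f1 y) T - prim (f1 x) T| <= M * `|y - x| /\
  `|prim (f y) T - prim (f x) T - (y - x) * prim (f1 x) T| <= M * `|y - x| ^+ 2.
Proof.
move=> T0; have [M HM] := f2M A T.
exists (`|M| * T); first by rewrite mulr_ge0.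
have M' x t : `|x| <= A -> 0 <= t <= T -> `|f2 x t| <= `|M|.
  by move=> xA tT; rewrite (le_trans (HM _ _ xA tT)) ?ler_norm.
move=> x y xA yA; split.
  rewrite -primB// mulrAC; apply: prim_lip => //.
    by move=> t; apply: continuousB; exact: f1c.
  move=> t tT; apply: (isd_lip_ball (f := f1^~ t) (df := f2^~ t) (A := A)) => // z zA.
  exact: M'.
have c1 : continuous (fun t => f y t - f x t).
  by move=> t; apply: continuousB; exact: fc.
have c2 : continuous (fun t => (y - x) * f1 x t).
  by move=> t; apply: cvgM; [exact: cvg_cst|exact: f1c].
rewrite -[(y - x) * _]primZ// -[prim (f y) T - _]primB// -primB//.
rewrite mulrAC; apply: prim_lip => //.
  by move=> t; apply: cvgB; [exact: c1|exact: c2].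
move=> t tT; apply: (isd_quad_ball (f := f^~ t) (f1 := f1^~ t) (f2 := f2^~ t) (A := A)) => // z zA.
exact: M'.
Qed.

Lemma isd_prim_param x T : 0 <= T -> isd (fun x => prim (f x) T) x (prim (f1 x) T).
Proof.
move=> T0; have [M M0 HM] := prim_param_lip (`|x| + 1) T0.
apply: isd_eps => e e0; exists (Num.min 1 (e / (M + 1))).
  by rewrite lt_min ltr01 divr_gt0// ltr_wpDl.
move=> y; rewrite lt_min => /andP[yx1 yxe].
have xA : `|x| <= `|x| + 1 by rewrite lerDl.
have yA : `|y| <= `|x| + 1.
  rewrite -(subrK x y) (le_trans (ler_normD _ _))//.
  by rewrite addrC lerD2l ltW.
have [_ H] := HM _ _ xA yA; rewrite (le_trans H)// expr2 mulrA ler_wpM2r//.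
move: yxe; rewrite ltr_pdivlMr ?ltr_wpDl// => /ltW; apply: le_trans.
by rewrite mulrC ler_wpM2l// lerDl.
Qed.

(** The second derivative [f2] is controlled only for [t] in bounded intervals, so the remainder
    cannot be purely quadratic. The integral is cut at some [S] depending on [e]: up to [S] Taylor's
    formula applies with a constant [M] depending on [S]; beyond [S] the mean value theorem in the
    parameter brings in the tail of [f1], which is uniformly small. *)
Lemma improper_expand A e : 0 < e -> exists2 M, 0 <= M & forall x y,
  `|x| <= A -> `|y| <= A ->
  `|improper f1 y - improper f1 x| <= e + M * `|y - x| /\
  `|improper f y - improper f x - (y - x) * improper f1 x| <=
    (e + M * `|y - x|) * `|y - x|.
Proof.
move=> e0; have [K [S0 [K0 S00 HK]]] := improper_tail ft A.
have [K1 [S1 [K10 S10 HK1]]] := improper_tail f1t A.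
have [K2 [S2 [K20 S20 HK2]]] := f1t A.
(* The last summand makes [(2 * K1 + K2) / S] at most [e]; the others put [S] in the range of the
   tail bounds. *)
pose S := S0 + S1 + S2 + (2 * K1 + K2) / e.
have KS0 : 0 <= (2 * K1 + K2) / e by rewrite divr_ge0 ?(ltW e0)//; lra.
have [S_gt0 SS1 SS2] : [/\ 0 < S, S1 <= S & S2 <= S].
  by rewrite /S; move: ((2 * K1 + K2) / e) KS0 => q q0; split; lra.
have [M M0 HM] := prim_param_lip A (ltW S_gt0).
have eS : (2 * K1 + K2) / S <= e.
  rewrite ler_pdivrMr// -ler_pdivrMl// [e^-1 * _]mulrC.
  by rewrite /S; move: ((2 * K1 + K2) / e) KS0 => q q0; lra.
have K1S : 0 <= K1 / S by rewrite divr_ge0// ltW.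
have K2S : 0 <= K2 / S by rewrite divr_ge0// ltW.
have {}eS : 2 * (K1 / S) + K2 / S <= e by rewrite mulrA -mulrDl.
exists M => // x y xA yA; have [L1 L2] := HM _ _ xA yA; split.
  have := HK1 _ xA _ SS1; have := HK1 _ yA _ SS1; move: L1.
  by rewrite !ler_norml; lra.
have step T : S <= T ->
    `|prim (f y) T - prim (f x) T - (y - x) * prim (f1 x) S| <=
      (K2 / S + M * `|y - x|) * `|y - x|.
  move=> ST; rewrite (_ : _ - _ - _ = prim (f y) T - y * prim (f1 x) S
    - (prim (f x) T - x * prim (f1 x) S)); last by ring.
  have T0 : 0 <= T by rewrite (le_trans (ltW S_gt0)).
  apply: (isd_lip_between (f := fun u => prim (f u) T - u * prim (f1 x) S)
    (df := fun u => prim (f1 u) T - prim (f1 x) S)) => c cxy.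
    apply: isd_eq; last by deriv; exact: isd_prim_param.
    by rewrite /=; ring.
  have cA := between_ball cxy xA yA.
  have [L3 _] := HM _ _ xA cA; have := HK2 _ cA _ _ SS2 ST => L4.
  have : M * `|c - x| <= M * `|y - x|.
    by rewrite ler_wpM2l//; exact: between_dist cxy.
  rewrite -(subrK (prim (f1 c) S) (prim (f1 c) T)) -addrA => L5.
  by rewrite (le_trans (ler_normD _ _))// lerD// (le_trans L3).
have cv : (fun T => `|prim (f y) T - prim (f x) T - (y - x) * prim (f1 x) S|) @ +oo
    --> `|improper f y - improper f x - (y - x) * prim (f1 x) S|.
  apply: cvg_norm; apply: cvgB; last exact: cvg_cst.
  by apply: cvgB; exact: improper_cvg.
have {}step : `|improper f y - improper f x - (y - x) * prim (f1 x) S| <=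
    (K2 / S + M * `|y - x|) * `|y - x|.
  apply: (cvgr_to_le cv); exists S; split; first exact: num_real.
  by move=> T /ltW ST; exact: step.
have -> : improper f y - improper f x - (y - x) * improper f1 x =
  improper f y - improper f x - (y - x) * prim (f1 x) S
   - (y - x) * (improper f1 x - prim (f1 x) S) by ring.
rewrite (le_trans (ler_normB _ _))// normrM.
have := HK1 _ xA _ SS1 => h1.
have : `|y - x| * `|improper f1 x - prim (f1 x) S| <= `|y - x| * (K1 / S).
  by rewrite ler_wpM2l.
move: step; set u := `|y - x|; have u0 : 0 <= u by exact: normr_ge0.
have : u * (2 * (K1 / S) + K2 / S) <= u * e by rewrite ler_wpM2l.
have : 0 <= u * (K1 / S) by rewrite mulr_ge0.
by rewrite !mulrDr !mulrDl; lra.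
Qed.

Lemma improper_isd x : isd (improper f) x (improper f1 x).
Proof.
apply: isd_eps => e e0; have e20 : 0 < e / 2 by lra.
have [M M0 HM] := improper_expand (`|x| + 1) e20.
exists (Num.min 1 (e / 2 / (M + 1))).
  by rewrite lt_min ltr01 divr_gt0// ltr_wpDl.
move=> y; rewrite lt_min => /andP[yx1 yxe].
have xA : `|x| <= `|x| + 1 by rewrite lerDl.
have yA : `|y| <= `|x| + 1.
  rewrite -(subrK x y) (le_trans (ler_normD _ _))//.
  by rewrite addrC lerD2l ltW.
have [_ H] := HM _ _ xA yA; rewrite (le_trans H)// ler_wpM2r//.
move: yxe; rewrite ltr_pdivlMr ?ltr_wpDl// mulrDr mulr1 mulrC.
by have := normr_ge0 (y - x); lra.
Qed.

Lemma improper_cont : continuous (improper f1).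
Proof.
move=> x; apply/cvgrPdist_le => e e0; have e20 : 0 < e / 2 by lra.
have [M M0 HM] := improper_expand (`|x| + 1) e20.
have xA : `|x| <= `|x| + 1 by rewrite lerDl.
near=> y.
have yx : `|y - x| < Num.min 1 (e / 2 / (M + 1)).
  rewrite distrC; near: y; apply: cvgr_dist_lt => //.
  by rewrite lt_min ltr01 divr_gt0// ltr_wpDl.
move: yx; rewrite lt_min => /andP[yx1 yxe].
have yA : `|y| <= `|x| + 1.
  rewrite -(subrK x y) (le_trans (ler_normD _ _))//.
  by rewrite addrC lerD2l ltW.
have [H _] := HM _ _ xA yA; rewrite distrC (le_trans H)//.
move: yxe; rewrite ltr_pdivlMr ?ltr_wpDl// mulrDr mulr1 mulrC.
by have := normr_ge0 (y - x); lra.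
Unshelve. all: by end_near. Qed.

End ParametricImproperIntegrals.

(** * The Airy integrals are continuously differentiable *)

Section AiryFunctions.
Context {R : realType}.
Implicit Types (a x y t c : R).

(** The shift [a = 0] gives the integrand of [Ai], and [a = - pi / 2] turns the cosine into the sine
    of [Bi]; [dec] is the exponential part of [Bi]. The suffixes [1] and [2] are derivatives in the
    parameter [x]. *)
Definition osc a x t : R := cos (t ^+ 3 / 3 + x * t + a).
Definition osc1 a x t : R := - t * sin (t ^+ 3 / 3 + x * t + a).
Definition osc2 a x t : R := - t ^+ 2 * cos (t ^+ 3 / 3 + x * t + a).
Definition dec x t : R := expR (- (t ^+ 3 / 3) + x * t).
Definition dec1 x t : R := t * dec x t.
Definition dec2 x t : R := t ^+ 2 * dec x t.

Lemma isd_osc a x t : isd (osc a ^~ t) x (osc1 a x t).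
Proof. by apply: isd_eq; last deriv; rewrite /osc1/=; ring. Qed.

Lemma isd_osc1 a x t : isd (osc1 a ^~ t) x (osc2 a x t).
Proof. by apply: isd_eq; last deriv; rewrite /osc2/=; ring. Qed.

Lemma isd_dec x t : isd (dec ^~ t) x (dec1 x t).
Proof. by apply: isd_eq; last deriv; rewrite /dec1/dec/=; ring. Qed.

Lemma isd_dec1 x t : isd (dec1 ^~ t) x (dec2 x t).
Proof.
by apply: isd_eq; last (apply: isdM; [exact: isd_cst|exact: isd_dec]);
  rewrite /dec2/dec1/=; ring.
Qed.

Lemma osc_cont a x : continuous (osc a x).
Proof. by move=> t; apply: isd_cont; deriv. Qed.

Lemma osc1_cont a x : continuous (osc1 a x).
Proof. by move=> t; apply: isd_cont; deriv. Qed.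

Lemma dec_cont x : continuous (dec x).
Proof. by move=> t; apply: isd_cont; deriv. Qed.

Lemma dec1_cont x : continuous (dec1 x).
Proof. by move=> t; apply: isd_cont; deriv. Qed.

Lemma osc2_bound a A T : exists M, forall x t, `|x| <= A -> 0 <= t <= T ->
  `|osc2 a x t| <= M.
Proof.
exists (T ^+ 2) => x t _ /andP[t0 tT].
rewrite /osc2 normrM normrN (ger0_norm (sqr_ge0 t)) -[leRHS]mulr1.
rewrite ler_pM ?sqr_ge0 ?normr_ge0 ?ler_sqr ?nnegrE ?(le_trans t0)//.
by rewrite ler_norml cos_geN1 cos_le1.
Qed.

Lemma dec2_bound A T : exists M, forall x t, `|x| <= A -> 0 <= t <= T ->
  `|dec2 x t| <= M.
Proof.
exists (T ^+ 2 * expR (A * T)) => x t xA /andP[t0 tT].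
rewrite /dec2/dec normrM (ger0_norm (sqr_ge0 t)) (ger0_norm (expR_ge0 _)).
rewrite ler_pM ?sqr_ge0 ?expR_ge0 ?ler_sqr ?nnegrE ?(le_trans t0)//.
rewrite ler_expR.
have : x * t <= A * T.
  have A0 : 0 <= A by exact: le_trans (normr_ge0 x) xA.
  rewrite (le_trans (ler_norm _))// normrM (ger0_norm t0).
  by rewrite ler_pM.
have : 0 <= t ^+ 3 by rewrite exprn_ge0.
lra.
Qed.

Lemma denom_bound A x t : `|x| <= A -> 1 + 2 * A <= t ->
  [/\ 1 <= t, t ^+ 2 / 2 <= t ^+ 2 + x, 0 < t ^+ 2 + x & `|x| <= t ^+ 2 / 2].
Proof.
move=> xA At; have A0 : 0 <= A by exact: le_trans (normr_ge0 x) xA.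
have t1 : 1 <= t by lra.
have : t <= t ^+ 2 by rewrite expr2 ler_peMl//; lra.
by move: xA; rewrite !ler_norml => /andP[? ?] ?; split => //; lra.
Qed.

(** One integration by parts: the phase has derivative [t ^+ 2 + x], so its cosine is the derivative
    of [sin / (t ^+ 2 + x)] up to [O(1 / t^3)]. Starting at [1 + 2 |A|] keeps the denominator above
    [t ^+ 2 / 2]. *)
Lemma osc_tail a : tails_vanish (osc a).
Proof.
move=> A; exists 24, (1 + 2 * `|A|); split=> // x xA.
have {}xA : `|x| <= `|A| by rewrite (le_trans xA) ?ler_norm.
have S0 : 0 < 1 + 2 * `|A| by have := normr_ge0 A; lra.
pose ph t := t ^+ 3 / 3 + x * t + a.
have -> : (24 : R) = 3 * 8 by ring.
apply: (primitive_tail (f := osc a x) (H := fun t => sin (ph t) / (t ^+ 2 + x))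
  (h := fun t => cos (ph t) - 2 * t * sin (ph t) / (t ^+ 2 + x) ^+ 2)) => //.
- by move=> t tA; apply: isd_prim; [exact: osc_cont|exact: lt_le_trans tA].
- move=> t /(denom_bound xA)[t1 _ d0 _].
  apply: isd_eq; last by rewrite /ph; deriv; rewrite /= gt_eqF.
  by rewrite /ph /=; field; rewrite gt_eqF.
- move=> t /(denom_bound xA)[t1 d1 d0 _].
  have t20 : 0 < t ^+ 2 by rewrite exprn_gt0//; lra.
  have -> : osc a x t - (cos (ph t) - 2 * t * sin (ph t) / (t ^+ 2 + x) ^+ 2) =
    2 * t * sin (ph t) / (t ^+ 2 + x) ^+ 2 by rewrite /osc -/(ph t); ring.
  rewrite normrM normfV (ger0_norm (sqr_ge0 _)) ler_pdivrMr ?exprn_gt0//.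
  rewrite [leRHS]mulrAC ler_pdivlMr//.
  have s1 : `|sin (ph t)| <= 1 by rewrite ler_norml sin_geN1 sin_le1.
  rewrite normrM (ger0_norm (_ : 0 <= 2 * t)); last lra.
  have : 2 * t * `|sin (ph t)| <= 2 * t by rewrite ler_piMr//; lra.
  move=> st; have : (t ^+ 2 / 2) ^+ 2 <= (t ^+ 2 + x) ^+ 2.
    by rewrite ler_sqr ?nnegrE//; lra.
  have : t * t ^+ 2 <= (t ^+ 2) ^+ 2.
    by rewrite [leRHS]expr2 ler_wpM2r//; [lra|rewrite expr2 ler_peMl//; lra].
  have : 2 * t * `|sin (ph t)| * t ^+ 2 <= 2 * t * t ^+ 2 by rewrite ler_wpM2r//; lra.
  by rewrite !expr_div_n; lra.
- move=> t /(denom_bound xA)[t1 d1 d0 _].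
  rewrite normrM normfV (gtr0_norm d0) ler_pdivrMr//.
  have s1 : `|sin (ph t)| <= 1 by rewrite ler_norml sin_geN1 sin_le1.
  rewrite [leRHS]mulrAC ler_pdivlMr; last lra.
  have : `|sin (ph t)| * t <= t by rewrite ler_piMl//; lra.
  have : t <= t ^+ 2 by rewrite expr2 ler_peMl//; lra.
  lra.
Qed.

(** The amplitude grows like [t], but in the same integration by parts the boundary term
    [t cos / (t ^+ 2 + x)] is [O(1 / t)] and the error [O(1 / t^2)]: the integral still converges
    conditionally. *)
Lemma osc1_tail a : tails_vanish (osc1 a).
Proof.
move=> A; exists 24, (1 + 2 * `|A|); split=> // x xA.
have {}xA : `|x| <= `|A| by rewrite (le_trans xA) ?ler_norm.
have S0 : 0 < 1 + 2 * `|A| by have := normr_ge0 A; lra.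
pose ph t := t ^+ 3 / 3 + x * t + a.
have -> : (24 : R) = 3 * 8 by ring.
apply: (primitive_tail (f := osc1 a x) (H := fun t => t * cos (ph t) / (t ^+ 2 + x))
  (h := fun t => - t * sin (ph t) + (x - t ^+ 2) * cos (ph t) / (t ^+ 2 + x) ^+ 2)) => //.
- by move=> t tA; apply: isd_prim; [exact: osc1_cont|exact: lt_le_trans tA].
- move=> t /(denom_bound xA)[t1 _ d0 _].
  apply: isd_eq; last by rewrite /ph; deriv; rewrite /= gt_eqF.
  by rewrite /ph /=; field; rewrite gt_eqF.
- move=> t /(denom_bound xA)[t1 d1 d0 xt].
  have t20 : 0 < t ^+ 2 by rewrite exprn_gt0//; lra.
  rewrite (_ : _ - _ = - ((x - t ^+ 2) * cos (ph t) / (t ^+ 2 + x) ^+ 2)); last first.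
    by rewrite /osc1 -/(ph t); ring.
  rewrite normrN normrM normfV (ger0_norm (sqr_ge0 _)) ler_pdivrMr ?exprn_gt0//.
  rewrite [leRHS]mulrAC ler_pdivlMr//.
  have s1 : `|cos (ph t)| <= 1 by rewrite ler_norml cos_geN1 cos_le1.
  have st : `|(x - t ^+ 2) * cos (ph t)| <= 2 * t ^+ 2.
    rewrite normrM -[leRHS]mulr1 ler_pM//.
    by rewrite (le_trans (ler_normB _ _))// (ger0_norm (sqr_ge0 t)); lra.
  have : (t ^+ 2 / 2) ^+ 2 <= (t ^+ 2 + x) ^+ 2.
    by rewrite ler_sqr ?nnegrE//; lra.
  have : `|(x - t ^+ 2) * cos (ph t)| * t ^+ 2 <= 2 * t ^+ 2 * t ^+ 2.
    by rewrite ler_wpM2r//; lra.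
  by rewrite !expr_div_n; lra.
- move=> t /(denom_bound xA)[t1 d1 d0 _].
  rewrite normrM normfV (gtr0_norm d0) ler_pdivrMr//.
  have s1 : `|cos (ph t)| <= 1 by rewrite ler_norml cos_geN1 cos_le1.
  rewrite [leRHS]mulrAC ler_pdivlMr; last lra.
  rewrite normrM (ger0_norm (_ : 0 <= t)); last lra.
  have : t * `|cos (ph t)| * t <= t * t.
    by rewrite ler_wpM2r ?ler_piMr//; lra.
  have := sqr_ge0 t; rewrite -expr2; lra.
Qed.

(** Past [3 * (A + 1)] the cubic dominates and [dec x t <= exp (- t)]; the [27] comes from cubing
    [t / 3 <= exp (t / 3)]. *)
Lemma dec_bound A x t : `|x| <= A -> 3 * (A + 1) <= t ->
  0 <= dec x t /\ dec x t * t ^+ 3 <= 27.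
Proof.
move=> xA At; have A0 : 0 <= A by exact: le_trans (normr_ge0 x) xA.
have t0 : 0 < t by lra.
split; first exact: expR_ge0.
have : dec x t <= expR (- t).
  rewrite ler_expR -subr_ge0.
  rewrite (_ : _ - _ = t * (t ^+ 2 / 3 - x - 1)); last by rewrite /=; field.
  apply: mulr_ge0; first lra.
  have : 3 * (A + 1) <= t ^+ 2.
    by rewrite (le_trans At)// expr2 ler_peMl//; lra.
  by move: xA; rewrite ler_norml; lra.
move=> /(ler_wpM2r (exprn_ge0 3 (ltW t0))) => /le_trans; apply.
rewrite expRN ler_pdivrMl ?expR_gt0//.
have : t / 3 <= expR (t / 3).
  by have := expR_ge1Dx (t / 3); lra.
have t30 : 0 <= t / 3 by lra.
move=> /(lerXn2r 3); rewrite !nnegrE => /(_ t30 (expR_ge0 _)).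
rewrite -expRM_natl (_ : 3%:R * (t / 3) = t); last by field.
rewrite expr_div_n; lra.
Qed.

Lemma dec_tail : tails_vanish dec.
Proof.
move=> A; exists 81, (3 * (`|A| + 1)); split=> // x xA.
have {}xA : `|x| <= `|A| by rewrite (le_trans xA) ?ler_norm.
have S0 : 3 <= 3 * (`|A| + 1) by have := normr_ge0 A; lra.
have -> : (81 : R) = 3 * 27 by ring.
apply: (primitive_tail (f := dec x) (H := fun=> 0) (h := fun=> 0)) => //.
- move=> t tA; apply: isd_prim; [exact: dec_cont|lra].
- by move=> t _; exact: isd_cst.
- move=> t tA; have [d0 d1] := dec_bound xA tA.
  have t0 : 1 <= t by lra.
  rewrite subr0 ger0_norm// ler_pdivlMr ?exprn_gt0 ?(lt_le_trans ltr01)//.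
  rewrite (le_trans _ d1)// ler_wpM2l// [leRHS]exprS ler_peMl//.
  by rewrite sqr_ge0.
- by move=> t tA; rewrite normr0 divr_ge0//; lra.
Qed.

Lemma dec1_tail : tails_vanish dec1.
Proof.
move=> A; exists 81, (3 * (`|A| + 1)); split=> // x xA.
have {}xA : `|x| <= `|A| by rewrite (le_trans xA) ?ler_norm.
have S0 : 3 <= 3 * (`|A| + 1) by have := normr_ge0 A; lra.
have -> : (81 : R) = 3 * 27 by ring.
apply: (primitive_tail (f := dec1 x) (H := fun=> 0) (h := fun=> 0)) => //.
- move=> t tA; apply: isd_prim; [exact: dec1_cont|lra].
- by move=> t _; exact: isd_cst.
- move=> t tA; have [d0 d1] := dec_bound xA tA.
  have t0 : 1 <= t by lra.
  rewrite subr0 ger0_norm; last by rewrite mulr_ge0//; lra.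
  rewrite ler_pdivlMr ?exprn_gt0 ?(lt_le_trans ltr01)//.
  by rewrite mulrAC [t * _]mulrC -mulrA mulrC -mulrA mulrC; move: d1; rewrite exprS; lra.
- by move=> t tA; rewrite normr0 divr_ge0//; lra.
Qed.

Definition C1 (f : R -> R) := exists2 f', (forall x, isd f x (f' x)) & continuous f'.

Lemma Airy_Ai_C1 : C1 Airy_Ai.
Proof.
exists (fun x => pi^-1 * improper (osc1 0) x).
  move=> x; rewrite (_ : Airy_Ai = fun x => pi^-1 * improper (osc 0) x); last first.
    apply/funext => y; rewrite /Airy_Ai /improper /prim /osc.
    by under [in RHS]eq_fun do under eq_Rintegral do rewrite addr0.
  apply: isd_eq; last first.
    apply: isdM; first exact: isd_cst.
    apply: (improper_isd (f := osc 0) (f1 := osc1 0) (f2 := osc2 0)).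
    - exact: osc_cont.
    - exact: osc1_cont.
    - exact: isd_osc.
    - exact: isd_osc1.
    - exact: osc2_bound.
    - exact: osc_tail.
    - exact: osc1_tail.
  by rewrite /=; ring.
move=> x; apply: cvgM; first exact: cvg_cst.
apply: (improper_cont (f := osc 0) (f1 := osc1 0) (f2 := osc2 0)).
- exact: osc_cont.
- exact: osc1_cont.
- exact: isd_osc.
- exact: isd_osc1.
- exact: osc2_bound.
- exact: osc_tail.
- exact: osc1_tail.
Qed.

Lemma tails_vanishD (f g : R -> R -> R) :
  (forall x, continuous (f x)) -> (forall x, continuous (g x)) ->
  tails_vanish f -> tails_vanish g -> tails_vanish (fun x t => f x t + g x t).
Proof.
move=> fc gc ft gt A; have [K [S [K0 S0 H]]] := ft A.
have [K' [S' [K'0 S'0 H']]] := gt A.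
exists (K + K'), (S + S'); split; [lra|lra|].
have primD x T : prim (fun t => f x t + g x t) T = prim (f x) T + prim (g x) T.
  by rewrite /prim RintegralD//; exact: prim_integrable.
move=> x xA s T sS sT; rewrite !primD opprD addrACA mulrDl.
by rewrite (le_trans (ler_normD _ _))// lerD ?H ?H'//; lra.
Qed.

Lemma Airy_Bi_C1 : C1 Airy_Bi.
Proof.
pose a : R := - (pi / 2).
pose f x t := dec x t + osc a x t; pose f1 x t := dec1 x t + osc1 a x t.
pose f2 x t := dec2 x t + osc2 a x t.
have fc x : continuous (f x).
  by move=> t; apply: cvgD; [exact: dec_cont|exact: osc_cont].
have f1c x : continuous (f1 x).
  by move=> t; apply: cvgD; [exact: dec1_cont|exact: osc1_cont].
have fd x t : isd (f^~ t) x (f1 x t).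
  by apply: isdD; [exact: isd_dec|exact: isd_osc].
have f1d x t : isd (f1^~ t) x (f2 x t).
  by apply: isdD; [exact: isd_dec1|exact: isd_osc1].
have f2M A T : exists M, forall x t, `|x| <= A -> 0 <= t <= T -> `|f2 x t| <= M.
  have [M HM] := dec2_bound A T; have [M' HM'] := osc2_bound a A T.
  exists (M + M') => x t xA tT.
  by rewrite (le_trans (ler_normD _ _))// lerD ?HM ?HM'.
have ft : tails_vanish f.
  by apply: tails_vanishD; [exact: dec_cont|exact: osc_cont|exact: dec_tail|exact: osc_tail].
have f1t : tails_vanish f1.
  by apply: tails_vanishD; [exact: dec1_cont|exact: osc1_cont|exact: dec1_tail|exact: osc1_tail].
exists (fun x => pi^-1 * improper f1 x).
  move=> x; rewrite (_ : Airy_Bi = fun x => pi^-1 * improper f x); last first.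
    apply/funext => y; rewrite /Airy_Bi /improper /prim /f /osc /dec /a.
    by under [in RHS]eq_fun do under eq_Rintegral do rewrite cosBpihalf.
  apply: isd_eq; last first.
    apply: isdM; first exact: isd_cst.
    exact: (improper_isd (f := f) (f1 := f1) (f2 := f2)).
  by rewrite /=; ring.
move=> x; apply: cvgM; first exact: cvg_cst.
exact: (improper_cont (f := f) (f1 := f1) (f2 := f2)).
Qed.

End AiryFunctions.

(** * Solutions on cells, their matching at the sites, and the Wronskian *)

Section Matching.
Context {R : realType}.
Implicit Types (x y c : R) (C : R * R).

Lemma near_itv (a b x : R) : a < x < b -> \forall y \near x, a < y < b.
Proof.
move=> /andP[ax xb]; near=> y; apply/andP; split; near: y.
  exact: lt_nbhsr.
exact: lt_nbhsl.
Unshelve. all: by end_near. Qed.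

Lemma isd_near (f g : R -> R) x d : (\forall y \near x, f y = g y) ->
  isd g x d -> isd f x d.
Proof.
move=> fg; apply: near_eq_is_derive.
by apply: filterS fg => y ->.
Qed.

Lemma isd_derive1 (f : R -> R) x d : isd f x d -> derive1 f x = d.
Proof. by move=> [_ <-]; rewrite derive1E. Qed.

Lemma isd_derivable (f : R -> R) x : derivable f x 1 -> isd f x (derive1 f x).
Proof. by move=> fx; rewrite /isd derive1E; apply: DeriveDef. Qed.

Lemma cvg_right_unique (f h : R -> R) a b l : a < b ->
  (forall x, a < x < b -> f x = h x) -> {for a, continuous h} ->
  f @ a^'+ --> l -> l = h a.
Proof.
move=> ab fh ch fl; apply/esym.
have hl : h @ a^'+ --> h a by apply: cvg_at_right_filter; exact: ch.
have hf : h @ a^'+ --> l.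
  apply: cvg_trans fl; apply: near_eq_cvg; near=> x; apply: fh.
  apply/andP; split; near: x; first exact: nbhs_right_gt.
  exact: nbhs_right_lt.
exact: (cvg_unique _ hl hf).
Unshelve. all: by end_near. Qed.

Lemma cvg_left_unique (f h : R -> R) a b l : b < a ->
  (forall x, b < x < a -> f x = h x) -> {for a, continuous h} ->
  f @ a^'- --> l -> l = h a.
Proof.
move=> ab fh ch fl; apply/esym.
have hl : h @ a^'- --> h a by apply: cvg_at_left_filter; exact: ch.
have hf : h @ a^'- --> l.
  apply: cvg_trans fl; apply: near_eq_cvg; near=> x; apply: fh.
  apply/andP; split; near: x; last exact: nbhs_left_lt.
  exact: nbhs_left_gt.
exact: (cvg_unique _ hl hf).
Unshelve. all: by end_near. Qed.

Lemma cont_affine (h : R -> R) (a s : R) : continuous h ->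
  continuous (fun e : R => h (a + s * e)).
Proof.
move=> hc e; apply: (@continuous_comp R R R (fun e => a + s * e) h); last exact: hc.
by apply: isd_cont; deriv.
Qed.

(** Cells are counted from [0]: this is the interval [(n - 1, n)] of the Prüfer radius for
    [n = m + 1]. *)
Definition in_cell (m : nat) x := m%:R < x < m.+1%:R.

Lemma in_cell_pos m x : in_cell m x -> 0 < x.
Proof. by move=> /andP[mx _]; exact: le_lt_trans mx. Qed.

Lemma in_cell_nat m x : in_cell m x -> forall n : nat, x != n%:R.
Proof.
move=> /andP[mx xm] n; apply/eqP => xn; move: mx xm; rewrite xn !ltr_nat ltnS.
by move=> mn nm; move: (leq_trans mn nm); rewrite ltnn.
Qed.

Definition solves_in (m : nat) (Q u du : R -> R) := forall x, in_cell m x ->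
  isd u x (du x) /\ isd du x (- Q x * u x).

Definition wronsk (u du v dv : R -> R) x := u x * dv x - du x * v x.

Lemma wronsk_cst m Q u du v dv : solves_in m Q u du -> solves_in m Q v dv ->
  forall x y, in_cell m x -> in_cell m y -> wronsk u du v dv x = wronsk u du v dv y.
Proof.
move=> su sv; have key x y : in_cell m x -> in_cell m y -> x <= y ->
    wronsk u du v dv y = wronsk u du v dv x.
  move=> xm ym xy.
  have Wd c : x <= c <= y -> isd (wronsk u du v dv) c 0.
    move=> cxy; have cm : in_cell m c.
      by move: xm ym cxy; rewrite /in_cell; lra.
    have [u1 u2] := su _ cm; have [v1 v2] := sv _ cm.
    by apply: isd_eq; last (rewrite /wronsk; deriv); rewrite /=; ring.
  apply: isd_cst_eq => //; first exact: (isd_contW Wd).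
  by move=> c cxy; apply: Wd; move: cxy; lra.
move=> x y xm ym; have [xy|/ltW yx] := leP x y; last exact: key.
by apply/esym; exact: key.
Qed.

Variables z1 z2 dz1 dz2 : R -> R.
Hypothesis z1d : forall x, isd z1 x (dz1 x).
Hypothesis z2d : forall x, isd z2 x (dz2 x).
Hypothesis dz1c : continuous dz1.
Hypothesis dz2c : continuous dz2.

Definition comb C x := C.1 * z1 x + C.2 * z2 x.
Definition dcomb C x := C.1 * dz1 x + C.2 * dz2 x.
Definition cross C C' : R := C.1 * C'.2 - C.2 * C'.1.
Definition wz x := wronsk z1 dz1 z2 dz2 x.

Lemma comb_isd C x : isd (comb C) x (dcomb C x).
Proof.
apply: isd_eq; last (rewrite /comb; deriv; [exact: z1d|exact: z2d]).
by rewrite /dcomb/=; ring.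
Qed.

Lemma comb_cont C : continuous (comb C).
Proof. by move=> x; exact: isd_cont (comb_isd C x). Qed.

Lemma dcomb_cont C : continuous (dcomb C).
Proof.
by move=> x; apply: cvgD; apply: cvgM; [exact: cvg_cst|exact: dz1c|exact: cvg_cst|exact: dz2c].
Qed.

Lemma wz_cont : continuous wz.
Proof.
move=> x; apply: cvgB; apply: cvgM; [|exact: dz2c|exact: dz1c|].
  exact: isd_cont (z1d x).
exact: isd_cont (z2d x).
Qed.

Variables (F E : R).
Let Q x := F * x + E.

Definition coeff_on (psi : R -> R) m C := forall x, in_cell m x -> psi x = comb C x.

Lemma coeff_isd psi m C x : coeff_on psi m C -> in_cell m x ->
  isd psi x (dcomb C x).
Proof.
move=> pC xm; apply: isd_near (comb_isd C x).
by near do apply: pC; exact: near_itv.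
Unshelve. all: by end_near. Qed.

Lemma coeff_derive1 psi m C x : coeff_on psi m C -> in_cell m x ->
  derive1 psi x = dcomb C x.
Proof. by move=> pC xm; apply: isd_derive1; exact: coeff_isd pC xm. Qed.

Lemma sol_solves psi g theta m : gen_eig_solution F E g theta psi ->
  solves_in m Q psi (derive1 psi).
Proof.
move=> [ode _ _ _ _] x xm.
have [d1 d2 E2] := ode _ (in_cell_pos xm) (in_cell_nat xm).
split; first exact: isd_derivable.
apply: isd_eq (isd_derivable d2).
have {}E2 : - derive1 (derive1 psi) x - F * x * psi x = E * psi x by exact: E2.
by rewrite /Q; lra.
Qed.

Lemma sol_start psi g theta C : gen_eig_solution F E g theta psi ->
  coeff_on psi 0 C -> comb C 0 = sin theta /\ dcomb C 0 = cos theta.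
Proof.
move=> [_ _ _ [p0 p0E] dp0] pC; split; apply/esym.
  rewrite -p0E; apply: (cvg_right_unique _ _ _ p0); first exact: ltr01.
    by move=> x x01; apply: pC.
  exact: comb_cont.
apply: (cvg_right_unique _ _ _ dp0); first exact: ltr01.
  by move=> x x01; apply: (coeff_derive1 (m := 0)).
exact: dcomb_cont.
Qed.

Lemma sol_match psi g theta m C C' : gen_eig_solution F E g theta psi ->
  coeff_on psi m C -> coeff_on psi m.+1 C' ->
  [/\ psi m.+1%:R = comb C m.+1%:R, comb C' m.+1%:R = comb C m.+1%:R &
   dcomb C' m.+1%:R = dcomb C m.+1%:R + g m.+1 * comb C m.+1%:R].
Proof.
move=> [_ pc jump _ _] pC pC'.
have mm : m.+1%:R < m.+2%:R :> R by rewrite ltr_nat.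
have m1 : m%:R < m.+1%:R :> R by rewrite ltr_nat.
have e1 : psi m.+1%:R = comb C m.+1%:R.
  apply: (cvg_left_unique m1 pC); first exact: comb_cont.
  by apply: cvg_at_left_filter; exact: pc.
have e2 : psi m.+1%:R = comb C' m.+1%:R.
  apply: (cvg_right_unique mm pC'); first exact: comb_cont.
  by apply: cvg_at_right_filter; exact: pc.
split=> //; first by rewrite -e2.
(* For [0 < e < 1] both derivatives are those of the combinations continued across the site, so the
   limit in the jump condition is the value of a continuous function at [e = 0]. *)
have := @cvg_right_unique (fun e => derive1 psi (m.+1%:R + e) - derive1 psi (m.+1%:R - e))
  (fun e => dcomb C' (m.+1%:R + e) - dcomb C (m.+1%:R - e)) 0 1 _ ltr01 _ _ (jump _ (ltn0Sn m)).
rewrite addr0 subr0 e1 => -> //; first by rewrite addrC subrK.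
- move=> e /andP[e0 e1']; congr (_ - _).
    apply: (coeff_derive1 pC'); apply/andP; split; first by rewrite ltrDl.
    by rewrite -[m.+2%:R]natr1 ltrD2l.
  apply: (coeff_derive1 pC); apply/andP; split; last by rewrite gtrBl.
  by rewrite -natr1; move: e1'; lra.
- have c1 := @cont_affine (dcomb C') (m.+1%:R) 1 (@dcomb_cont C').
  have c2 := @cont_affine (dcomb C) (m.+1%:R) (-1) (@dcomb_cont C).
  rewrite (_ : (fun e => _) = (fun e => dcomb C' (m.+1%:R + 1 * e)
    - dcomb C (m.+1%:R + -1 * e))); last first.
    by apply/funext => e; rewrite mul1r mulN1r.
  by apply: continuousB; [exact: c1|exact: c2].
Qed.

Lemma wronsk_comb C C' x :
  wronsk (comb C) (dcomb C) (comb C') (dcomb C') x = cross C C' * wz x.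
Proof. by rewrite /wronsk /wz /comb /dcomb /cross /wronsk; ring. Qed.

(** On the open cell this product is the Wronskian of [psi] and [psi'], which is constant because
    both solve the equation; continuity of [wz] extends it to the endpoints. At this stage the
    equation is known for the solutions and not yet for [z1] and [z2]. *)
Lemma sol_wronsk psi psi' g theta theta' m C C' c :
  gen_eig_solution F E g theta psi -> gen_eig_solution F E g theta' psi' ->
  coeff_on psi m C -> coeff_on psi' m C' ->
  (exists2 x, x = m%:R \/ x = m.+1%:R & cross C C' * wz x = c) ->
  forall x, m%:R <= x <= m.+1%:R -> cross C C' * wz x = c.
Proof.
move=> s s' pC pC' [x0 x0m Wx0].
pose h x := cross C C' * wz x.
have hc : continuous h by move=> x; apply: cvgM; [exact: cvg_cst|exact: wz_cont].
have hcst x y : in_cell m x -> in_cell m y -> h x = h y.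
  move=> xm ym.
  have eqW t : in_cell m t -> h t = wronsk psi (derive1 psi) psi' (derive1 psi') t.
    move=> tm; rewrite /h -wronsk_comb /wronsk (pC t tm) (pC' t tm).
    by rewrite (coeff_derive1 pC tm) (coeff_derive1 pC' tm).
  rewrite !eqW//; exact: (wronsk_cst (sol_solves s) (sol_solves s') xm ym).
have mm : (m%:R : R) < m.+1%:R by rewrite ltr_nat.
pose mid : R := m%:R + 2^-1.
have midm : in_cell m mid by rewrite /in_cell /mid -[m.+1%:R]natr1; lra.
have hm : h mid = h m%:R.
  apply: (cvg_right_unique (f := fun=> h mid) mm); [|exact: hc|exact: cvg_cst].
  by move=> x xm; exact: hcst.
have hm1 : h mid = h m.+1%:R.
  apply: (cvg_left_unique (f := fun=> h mid) mm); [|exact: hc|exact: cvg_cst].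
  by move=> x xm; exact: hcst.
have h0 : h mid = c.
  by case: x0m => x0E; rewrite -Wx0 x0E; [exact: hm|exact: hm1].
move=> x /andP[]; rewrite le_eqVlt => /predU1P[<- _|mx]; first by rewrite -h0 hm.
rewrite le_eqVlt => /predU1P[->|xm]; first by rewrite -h0 hm1.
by rewrite -h0; apply: hcst => //; apply/andP.
Qed.

Lemma solve2 C x a b : wz x != 0 -> comb C x = a -> dcomb C x = b ->
  C = ((a * dz2 x - b * z2 x) / wz x, (z1 x * b - dz1 x * a) / wz x).
Proof.
move=> w0 <- <-; case: C => c1 c2; move: w0; rewrite /comb /dcomb /wz /wronsk /=.
by move=> w0; congr pair; field.
Qed.

(* Variation of parameters for the jump [gm * psi m] of [psi'] at the site [m]. *)
Definition kick (w : R) (m : nat) (gm : R) C : R * R :=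
  (C.1 - gm * comb C m%:R / w * z2 m%:R, C.2 + gm * comb C m%:R / w * z1 m%:R).

Lemma cross_kick w m g C C' : cross (kick w m g C) (kick w m g C') = cross C C'.
Proof. by rewrite /cross /kick /comb /=; ring. Qed.

Lemma kick_match w m g C C' : wz m.+1%:R = w -> w != 0 ->
  comb C' m.+1%:R = comb C m.+1%:R ->
  dcomb C' m.+1%:R = dcomb C m.+1%:R + g * comb C m.+1%:R ->
  C' = kick w m.+1 g C.
Proof.
move=> <- w0 e1 e2; rewrite (solve2 w0 e1 e2) /kick; case: C e1 e2 => c1 c2 _ _.
move: w0; rewrite /comb/dcomb/wz/wronsk /= => w0.
by congr pair; field.
Qed.

(* Coefficients on [z1], [z2] in the cell [m, m+1] of the solution with angle [theta]; [w] is the Wronskian of [z1] and [z2]. *)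
Fixpoint prop (w : R) (g : nat -> R) (theta : R) (m : nat) : R * R :=
  if m is m'.+1 then kick w m (g m) (prop w g theta m') else
  ((sin theta * dz2 0 - cos theta * z2 0) / w,
   (z1 0 * cos theta - dz1 0 * sin theta) / w).

Lemma cross_prop w g theta theta' m :
  cross (prop w g theta m) (prop w g theta' m) =
  cross (prop w g theta 0%N) (prop w g theta' 0%N).
Proof. by elim: m => //= m IH; rewrite cross_kick. Qed.

Section TwoSolutions.
Variables (g : nat -> R) (thp thm : R) (psip psim : R -> R) (Cp Cm : nat -> R * R).
Hypothesis sp : gen_eig_solution F E g thp psip.
Hypothesis sm : gen_eig_solution F E g thm psim.
Hypothesis pCp : forall m, coeff_on psip m (Cp m).
Hypothesis pCm : forall m, coeff_on psim m (Cm m).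
Hypothesis indep : sin thp * cos thm - cos thp * sin thm != 0.

Let S := sin thp * cos thm - cos thp * sin thm.

(** The Wronskian of the two solutions is carried from site to site: it is constant on a cell, and a
    jump of the derivative proportional to the value preserves it. As [S] is not zero, each cell
    yields [wz != 0] at its right end, which is what solving for the next coefficients requires. *)
Lemma wz_cross m :
  (forall x, m%:R <= x <= m.+1%:R -> cross (Cp m) (Cm m) * wz x = S) /\
  cross (Cp m) (Cm m) = cross (Cp 0%N) (Cm 0%N).
Proof.
elim: m => [|m [IH1 IH2]].
  split=> //; apply: (sol_wronsk sp sm) => //.
  exists 0%:R; first by left.
  have [e1 e2] := sol_start sp (@pCp 0%N); have [e3 e4] := sol_start sm (@pCm 0%N).
  by rewrite -wronsk_comb /wronsk e1 e2 e3 e4.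
have Wm : cross (Cp m) (Cm m) * wz m.+1%:R = S.
  by apply: IH1; rewrite lexx ler_nat leqnSn.
have w0 : wz m.+1%:R != 0.
  by apply/eqP => w0; move: Wm; rewrite w0 mulr0 => S0; move: indep; rewrite -/S -S0 eqxx.
have cE : cross (Cp m.+1) (Cm m.+1) = cross (Cp m) (Cm m).
  have [_ a1 a2] := sol_match sp (@pCp m) (@pCp m.+1).
  have [_ b1 b2] := sol_match sm (@pCm m) (@pCm m.+1).
  by rewrite (kick_match erefl w0 a1 a2) (kick_match erefl w0 b1 b2) cross_kick.
split; last by rewrite cE.
apply: (sol_wronsk sp sm) => //; exists m.+1%:R; first by left.
by rewrite cE.
Qed.

Lemma wz0_neq0 : wz 0 != 0.
Proof.
apply/eqP => w0; have [/(_ 0) + _] := wz_cross 0%N.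
rewrite w0 mulr0 lexx ler0n => /(_ isT) S0.
by move: indep; rewrite -/S -S0 eqxx.
Qed.

Lemma wz_const m x : m%:R <= x <= m.+1%:R -> wz x = wz 0.
Proof.
have [/(_ 0) + _] := wz_cross 0; rewrite lexx ler0n => /(_ isT) S0.
move=> xm; have [/(_ x xm) + cE] := wz_cross m; rewrite cE -S0.
apply: mulfI; apply/eqP => c0; move: S0; rewrite c0 mul0r => S0.
by move: indep; rewrite -/S -S0 eqxx.
Qed.

(** Cramer's rule writes [z1] and [z2] on the cell as combinations of the two solutions, from which
    they inherit the equation. No differential equation has to be read off the Airy integrals. *)
Lemma z_solves m : solves_in m Q z1 dz1 /\ solves_in m Q z2 dz2.
Proof.
have c0 : cross (Cp m) (Cm m) != 0.
  apply/eqP => c0; have [/(_ m%:R) + _] := wz_cross m.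
  rewrite lexx ler_nat leqnSn c0 mul0r => /(_ isT) S0.
  by move: indep; rewrite -/S -S0 eqxx.
have zE (x : R) (a b : R) : in_cell m x ->
    isd (fun y => (a * derive1 psip y + b * derive1 psim y) / cross (Cp m) (Cm m)) x
      (- Q x * ((a * psip x + b * psim x) / cross (Cp m) (Cm m))).
  move=> xm; have [_ p2] := sol_solves sp xm; have [_ q2] := sol_solves sm xm.
  by apply: isd_eq; last deriv; rewrite /=; ring.
have near_m x : in_cell m x -> \forall y \near x, in_cell m y by exact: near_itv.
split=> x xm; split; [exact: z1d| |exact: z2d|].
  have := zE x (Cm m).2 (- (Cp m).2) xm.
  have -> : ((Cm m).2 * psip x + - (Cp m).2 * psim x) / cross (Cp m) (Cm m) = z1 x.
    by rewrite (pCp xm) (pCm xm) /comb; move: c0; rewrite /cross => c0; field.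
  apply: isd_near; near=> y; have ym : in_cell m y by near: y; exact: near_m.
  rewrite (coeff_derive1 (@pCp m) ym) (coeff_derive1 (@pCm m) ym) /dcomb.
  by move: c0; rewrite /cross => c0; field.
have := zE x (- (Cm m).1) ((Cp m).1) xm.
have -> : (- (Cm m).1 * psip x + (Cp m).1 * psim x) / cross (Cp m) (Cm m) = z2 x.
  by rewrite (pCp xm) (pCm xm) /comb; move: c0; rewrite /cross => c0; field.
apply: isd_near; near=> y; have ym : in_cell m y by near: y; exact: near_m.
rewrite (coeff_derive1 (@pCp m) ym) (coeff_derive1 (@pCm m) ym) /dcomb.
by move: c0; rewrite /cross => c0; field.
Unshelve. all: by end_near. Qed.

End TwoSolutions.

(** Makes the coefficients in cell [m] an explicit function of [g 1, ..., g m], which is the source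
    of their measurability and adaptedness. *)
Lemma coeff_prop g theta psi (C : nat -> R * R) : wz 0 != 0 ->
  (forall m x, m%:R <= x <= m.+1%:R -> wz x = wz 0) ->
  gen_eig_solution F E g theta psi -> (forall m, coeff_on psi m (C m)) ->
  forall m, C m = prop (wz 0) g theta m.
Proof.
move=> w0 wE s pC; elim=> [|m IH] /=.
  by have [e1 e2] := sol_start s (pC 0%N); exact: solve2.
have [_ e1 e2] := sol_match s (pC m) (pC m.+1).
rewrite -IH; apply: kick_match => //.
by apply: (wE m); rewrite lexx ler_nat leqnSn.
Qed.

End Matching.

(** * Integrals of products of independent variables *)

Section Independence.
Context d (T : measurableType d) (R : realType) (P : probability T R).

(** The joint law is the product of the marginals, so Fubini integrates [v (Y w)] first. The space
    of [X] is arbitrary because [X] will stand for the whole past. *)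
Lemma indep_integral_mul0 d1 d2 (T1 : measurableType d1) (T2 : measurableType d2)
    (X : {mfun T >-> T1}) (Y : {mfun T >-> T2}) (u : T1 -> R) (v : T2 -> R) :
  (forall A B, measurable A -> measurable B ->
     P (X @^-1` A `&` Y @^-1` B) = (P (X @^-1` A) * P (Y @^-1` B))%E) ->
  measurable_fun setT u -> measurable_fun setT v ->
  P.-integrable setT (fun w => (u (X w) * v (Y w))%:E) ->
  P.-integrable setT (fun w => (v (Y w))%:E) ->
  (\int[P]_w (v (Y w))%:E = 0)%E ->
  (\int[P]_w (u (X w) * v (Y w))%:E = 0)%E.
Proof.
move=> ind mu mv iuv iv v0.
pose XY w := (X w, Y w).
have mXY : measurable_fun setT XY by apply: measurable_fun_pair.
pose XYm : {mfun T >-> (T1 * T2)%type} := MeasurableFun.Pack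
  (MeasurableFun.Class (isMeasurableFun.Build _ _ _ _ XY mXY)).
pose J := distribution P XYm.
pose PX := distribution P X; pose PY := distribution P Y.
have prodE A : measurable A -> (PX \x PY)%E A = J A.
  apply: product_measure_unique => {}A B mA mB.
  by rewrite /J /PX /PY /distribution /pushforward -ind.
pose h := EFin \o (fun z : T1 * T2 => u z.1 * v z.2).
have mh : measurable_fun [set: T1 * T2] h.
  apply/measurable_EFinP; apply: measurable_funM.
    exact: measurableT_comp mu measurable_fst.
  exact: measurableT_comp mv measurable_snd.
have ih : J.-integrable setT h.
  by apply: (@integrable_pushforward _ _ _ _ _ XYm).
have ih' : (PX \x PY)%E.-integrable setT h.
  apply/integrableP; split=> //; have /integrableP[_ iJ] := ih.
  rewrite (@eq_measure_integral _ _ _ _ J)//.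
  by move=> A mA _; exact: prodE.
transitivity (\int[J]_z h z)%E.
  by rewrite /J /distribution (@integral_pushforward _ _ _ _ _ XYm).
rewrite (@eq_measure_integral _ _ _ _ (PX \x PY)%E); last first.
  by move=> A mA _; exact/esym/prodE.
apply: etrans; first exact: (esym (integral12_prod_meas1 ih')).
rewrite /fubini_F /h /=.
have ivY : PY.-integrable setT (EFin \o v).
  by apply: (@integrable_pushforward _ _ _ _ _ Y) => //; exact/measurable_EFinP.
have vY0 : (\int[PY]_y (v y)%:E = 0)%E.
  rewrite -v0 /PY /distribution (@integral_pushforward _ _ _ _ _ Y)//.
  exact/measurable_EFinP.
under eq_integral => x _.
  under eq_integral => y _ do rewrite EFinM.
  rewrite integralZl// vY0 mule0.
  over.
by rewrite integral0.
Qed.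

End Independence.

(** * The filtration of the couplings *)

Section Past.
Context d (T : measurableType d) (R : realType) (P : probability T R).
Variable g : nat -> T -> R.
Hypothesis mg : forall n, (1 <= n)%N -> measurable_fun setT (g n).
Hypothesis ind : mutually_independent P [set n | (1 <= n)%N] g.

(** Cylinders over [g 1, ..., g (n - 1)]: a pi-system generating the past of [n]. Being [adapted n]
    thus means being known before [g n]. *)
Definition cyl n : set (set T) := [set A | exists2 B : nat -> set R,
  (forall j, measurable (B j)) &
  A = \big[setI/setT]_(j <- iota 1 n.-1) (g j @^-1` B j)].

Definition past n := g_sigma_algebraType (cyl n).

Definition adapted n (Y : T -> R) := measurable_fun [set: past n] (Y : past n -> R).

Lemma cylT n : cyl n setT.
Proof. by exists (fun=> setT) => //; rewrite big1. Qed.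

Lemma cyl_setI n : setI_closed (cyl n).
Proof.
move=> _ _ [B mB ->] [C mC ->]; exists (fun j => B j `&` C j).
  by move=> j; exact: measurableI.
by rewrite -big_split.
Qed.

Lemma cyl_measurable n A : cyl n A -> measurable A.
Proof.
move=> [B mB ->]; rewrite big_seq; elim/big_ind : _ => //.
  exact: measurableI.
move=> j; rewrite mem_iota => /andP[j1 _].
by rewrite -[X in measurable X]setTI; exact: mg.
Qed.

Lemma sub_cyl m n : (m <= n)%N -> cyl m `<=` cyl n.
Proof.
move=> mn _ [B mB ->]; exists (fun j => if (j < m)%N then B j else setT).
  by move=> j; case: ifP.
have mn1 : (m.-1 <= n.-1)%N by move: mn; case: (m) => // k; case: (n).
have -> : n.-1 = (m.-1 + (n.-1 - m.-1))%N by rewrite subnKC.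
rewrite iotaD big_cat/=.
rewrite [X in _ = _ `&` X]big1_seq => [|j /=].
  rewrite setIT; apply: eq_big_seq => j; rewrite mem_iota => /andP[j1 jm].
  by move: jm; case: (m) => [|k] /=; rewrite ?addn0 ?add1n => jm; [move: (leq_trans jm j1); rewrite ltnn|rewrite jm].
rewrite mem_iota => /andP[j1 _]; rewrite ifN ?preimage_setT// -leqNgt.
by move: j1; case: (m) => //= k; rewrite add1n.
Qed.

Lemma past_measurable n (A : set T) : (<<s cyl n>>) A -> measurable A.
Proof.
move: A; apply: smallest_sub; first exact: sigma_algebra_measurable.
by move=> A /cyl_measurable.
Qed.

Lemma adapted_le m n Y : (m <= n)%N -> adapted m Y -> adapted n Y.
Proof.
move=> mn aY mD B mB; have := aY measurableT _ mB.
exact: (@sub_sigma_algebra2 _ setT _ _ (@sub_cyl _ _ mn)).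
Qed.

Lemma adapted_measurable n Y : adapted n Y -> measurable_fun setT Y.
Proof. by move=> aY mD B mB; exact: past_measurable (aY measurableT _ mB). Qed.

Lemma adapted_g n j : (1 <= j < n)%N -> adapted n (g j).
Proof.
move=> /andP[j1 jn] mD B mB; rewrite setTI; apply: sub_sigma_algebra.
exists (fun i => if i == j then B else setT); first by move=> i; case: ifP.
have jin : j \in iota 1 n.-1.
  by rewrite mem_iota j1 /=; case: n jn {mD} => // n; rewrite add1n.
rewrite (bigD1_seq j jin (iota_uniq _ _))/= eqxx.
by rewrite big1 ?setIT// => i /negbTE ->; rewrite preimage_setT.
Qed.

(** As functions of [A], both sides are finite measures. They agree on cylinders by mutual
    independence, hence on the generated sigma-algebra. *)
Lemma past_indep n A B : (1 <= n)%N -> (<<s cyl n>>) A -> measurable B ->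
  P (A `&` g n @^-1` B) = (P A * P (g n @^-1` B))%E.
Proof.
move=> n1 sA mB.
have mgB : measurable (g n @^-1` B) by rewrite -[X in measurable X]setTI; exact: mg.
have c0 : 0 <= fine (P (g n @^-1` B)) by exact: fine_ge0.
pose c : {nonneg R} := NngNum c0.
have cE : (c%:num)%:E = P (g n @^-1` B) by rewrite /= fineK// fin_num_measure.
have := @g_sigma_algebra_measure_unique _ R T (cyl n) _ (fun=> setT) _ _
  (mrestr P mgB) (mscale c P) _ _ _ A sA.
rewrite /mrestr /mscale -cE muleC; apply.
- by move=> X /cyl_measurable.
- by move=> _; exact: cylT.
- by rewrite bigcup_const//; exists 0%N.
- exact: cyl_setI.
- move=> {sA A} _ [C mC ->].
  set X := \big[setI/setT]_(j <- _) _.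
  change (P (X `&` g n @^-1` B) = (c%:num)%:E * P X)%E; rewrite cE.
  have nin : n \notin iota 1 n.-1.
    by rewrite mem_iota add1n prednK ?ltnn ?andbF.
  have u : uniq (n :: iota 1 n.-1) by rewrite /= nin iota_uniq.
  have i1 : forall j, j \in iota 1 n.-1 -> (1 <= j)%N.
    by move=> j; rewrite mem_iota => /andP[].
  pose D j := if j == n then B else C j.
  have mD j : measurable (D j) by rewrite /D; case: ifP.
  have Dn : D n = B by rewrite /D eqxx.
  have DC j : j \in iota 1 n.-1 -> D j = C j.
    by move=> jn; rewrite /D; case: eqP => // jnE; move: nin; rewrite -{1}jnE jn.
  have := ind u _ mD; rewrite !big_cons Dn => H.
  have XE : X = \big[setI/setT]_(j <- iota 1 n.-1) (g j @^-1` D j).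
    by apply: eq_big_seq => j /DC ->.
  rewrite setIC XE H; last by move=> j; rewrite inE => /predU1P[->|/i1].
  by rewrite (ind (iota_uniq _ _) i1 mD).
- by move=> _; rewrite /mrestr (le_lt_trans (probability_le1 _ _)) ?ltry// setTI.
Qed.

(** The identity seen as a random variable with values in the coarser measurable space; it turns
    independence from the past into independence of two random variables. *)
Definition past_id n : T -> past n := id.

Lemma measurable_past_id n : measurable_fun setT (past_id n).
Proof. by move=> mD B mB; rewrite setTI; exact: past_measurable mB. Qed.

Lemma integrable_bounded_mul (Y X : T -> R) M : measurable_fun setT Y ->
  (forall w, `|Y w| <= M) -> P.-integrable setT (fun w => (X w)%:E) ->
  P.-integrable setT (fun w => (Y w * X w)%:E).
Proof.
move=> mY YM iX; have mX : measurable_fun setT X.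
  by apply/measurable_EFinP; case/integrableP : iX.
have iMX : P.-integrable setT (fun w => (M%:E * (X w)%:E)%E).
  exact: integrableZl.
apply: (le_integrable measurableT _ _ iMX).
  by apply/measurable_EFinP; exact: measurable_funM.
move=> w _; rewrite -EFinM lee_fin !normrM ler_wpM2r//.
by rewrite (le_trans (YM w)) ?ler_norm.
Qed.

Lemma adapted_mul_mean0 n (Y : T -> R) (f : R -> R) M : (1 <= n)%N ->
  adapted n Y -> (forall w, `|Y w| <= M) -> measurable_fun setT f ->
  P.-integrable setT (fun w => (f (g n w))%:E) ->
  (\int[P]_w (f (g n w))%:E = 0)%E ->
  P.-integrable setT (fun w => (Y w * f (g n w))%:E) /\
  (\int[P]_w (Y w * f (g n w))%:E = 0)%E.
Proof.
move=> n1 aY YM mf ifg f0.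
have iYf : P.-integrable setT (fun w => (Y w * f (g n w))%:E).
  apply: integrable_bounded_mul YM _ => //.
  exact: adapted_measurable aY.
split => //.
pose X : {mfun T >-> past n} := MeasurableFun.Pack
  (MeasurableFun.Class (isMeasurableFun.Build _ _ _ _ _ (@measurable_past_id n))).
pose G : {mfun T >-> R} := MeasurableFun.Pack
  (MeasurableFun.Class (isMeasurableFun.Build _ _ _ _ _ (mg n1))).
apply: (@indep_integral_mul0 _ _ _ P _ _ _ _ X G Y f) => //.
move=> A B mA mB; exact: past_indep.
Qed.

(** * A maximal inequality for martingale transforms *)

Section MaximalInequality.
Variables (Z : nat -> T -> R) (f : nat -> R -> R) (z v : nat -> R).
Hypothesis aZ : forall i, adapted i.+1 (Z i).
Hypothesis Zz : forall i w, `|Z i w| <= z i.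
Hypothesis mf : forall i, measurable_fun setT (f i).
Hypothesis ifg : forall i, P.-integrable setT (fun w => (f i (g i.+1 w))%:E).
Hypothesis f0 : forall i, (\int[P]_w (f i (g i.+1 w))%:E = 0)%E.
Hypothesis fv : forall i, (\int[P]_w ((f i (g i.+1 w)) ^+ 2)%:E <= (v i)%:E)%E.

Definition msum N w := \sum_(i < N) Z i w * f i (g i.+1 w).

(** No exit from [[-M, M]] up to time [N]. This event depends on [g 1, ..., g N] only, so cutting
    the coefficient [Z N] with it keeps that coefficient adapted. *)
Definition unstopped M N w := [forall j : 'I_N.+1, `|msum j w| <= M].

Definition stopped M i w := Z i w * (unstopped M i w)%:R.

Definition smsum M N w := \sum_(i < N) stopped M i w * f i (g i.+1 w).

Lemma unstoppedS M N w :
  unstopped M N.+1 w = unstopped M N w && (`|msum N.+1 w| <= M).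
Proof.
apply/forallP/andP => [H|[/forallP H HN] j].
  split; last exact: (H ord_max).
  by apply/forallP => j; exact: (H (widen_ord (leqnSn _) j)).
have [jN|] := ltnP j N.+1; first exact: (H (Ordinal jN)).
move=> Nj; have -> : nat_of_ord j = N.+1 by apply/eqP; rewrite eqn_leq Nj -ltnS ltn_ord.
exact: HN.
Qed.

(** After the first exit the stopped sum is frozen at a value beyond [M], so its size at the final
    time detects whether the running maximum has exceeded [M]. *)
Lemma smsumP M N w : 0 <= M ->
  if unstopped M N w then smsum M N w = msum N w else M < `|smsum M N w|.
Proof.
move=> M0; elim: N => [|N IH].
  rewrite /smsum /msum !big_ord0; case: ifPn => // /negP[]; apply/forallP => j.
  by rewrite /msum (ord1 j) big_ord0 normr0.
have mS : msum N.+1 w = msum N w + Z N w * f N (g N.+1 w) by rewrite /msum big_ord_recr.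
have sS : smsum M N.+1 w = smsum M N w + stopped M N w * f N (g N.+1 w).
  by rewrite /smsum big_ord_recr.
rewrite unstoppedS sS /stopped; case: (unstopped M N w) IH => /= IH.
  by rewrite IH mulr1 -mS; case: ifPn => //; rewrite ltNge.
by rewrite mulr0 mul0r addr0.
Qed.

Lemma unstopped_le M N w : unstopped M N w -> `|msum N w| <= M.
Proof. by move=> /forallP/(_ ord_max). Qed.

Lemma adapted_msum n N : (N < n)%N -> adapted n (msum N).
Proof.
move=> Nn; rewrite /adapted /msum; apply: measurable_sum => i.
have aZn : adapted n (Z i) := adapted_le (leq_trans (ltn_ord i) (ltnW Nn)) (@aZ i).
apply: measurable_funM; first exact: aZn.
apply: measurableT_comp => //; apply: adapted_g; rewrite /=.
exact: leq_ltn_trans (ltn_ord i) Nn.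
Qed.

Lemma adapted_stopped M N n : (N < n)%N -> adapted n (stopped M N).
Proof.
move=> Nn; have aZn : adapted n (Z N) := adapted_le Nn (@aZ N).
apply: measurable_funM; first exact: aZn.
elim: N Nn {aZn} => [|N IH] Nn.
  rewrite (_ : (fun _ => _) = fun=> ((0 <= M)%R : bool)%:R).
    exact: measurable_cst.
  apply/funext => w; congr ((_ : bool)%:R); apply/forallP/idP => [/(_ ord0)|M0 j].
    by rewrite /msum big_ord0 normr0.
  by rewrite (ord1 j) /msum big_ord0 normr0.
rewrite (_ : (fun w => _) = fun w => (unstopped M N w)%:R *
    \1_(msum N.+1 @^-1` [set x | `|x| <= M]) w).
  apply: measurable_funM; first by apply: IH; exact: ltnW.
  apply: measurable_indic; rewrite -[X in measurable X]setTI.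
  apply: adapted_msum Nn measurableT _ _.
  rewrite (_ : [set x | _] = `[-M, M]%classic); first exact: measurable_itv.
  by apply/seteqP; split => x /=; rewrite in_itv/= ler_norml.
apply/funext => w; rewrite unstoppedS indicE; case: (unstopped M N w) => /=.
  rewrite mul1r; congr ((nat_of_bool _)%:R); apply/idP/idP; first by move=> h; rewrite mem_set.
  by rewrite inE.
by rewrite mul0r.
Qed.

Lemma adapted_smsum M n N : (N < n)%N -> adapted n (smsum M N).
Proof.
move=> Nn; rewrite /adapted /smsum; apply: measurable_sum => i.
apply: measurable_funM; first by apply: adapted_stopped; exact: ltn_trans (ltn_ord i) Nn.
apply: measurableT_comp => //; apply: adapted_g; rewrite /=.
exact: leq_ltn_trans (ltn_ord i) Nn.
Qed.

(** The increments are orthogonal: [smsum * stopped] is adapted, and stopping bounds it by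
    [M * z N], so its product with the centred [f] is integrable with mean zero. *)
Lemma smsum_sqr M N : 0 <= M ->
  P.-integrable setT (fun w => (smsum M N w ^+ 2)%:E) /\
  (\int[P]_w (smsum M N w ^+ 2)%:E <= (\sum_(i < N) z i ^+ 2 * v i)%:E)%E.
Proof.
move=> M0; elim: N => [|N [IHi IHl]].
  have s0 : smsum M 0 = fun=> 0 by apply/funext => w; rewrite /smsum big_ord0.
  rewrite s0 /= expr0n /= big_ord0; split; first exact: integrable0.
  by rewrite integral0.
have z0 : 0 <= z N by rewrite (le_trans _ (Zz N point)).
pose xi w := f N (g N.+1 w); pose Zt := stopped M N.
have Zt_le w : `|Zt w| <= z N.
  rewrite /Zt /stopped normrM; case: (unstopped _ _ _); rewrite ?normr1 ?normr0 ?mulr1 ?mulr0//.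
pose Y w := smsum M N w * Zt w.
have YM w : `|Y w| <= M * z N.
  rewrite /Y normrM; have := smsumP N w M0; case: ifPn => [uw ->|uw _].
    by rewrite ler_pM// unstopped_le.
  by rewrite /Zt /stopped (negbTE uw) mulr0 normr0 mulr0 mulr_ge0.
have aY : adapted N.+1 Y.
  by apply: measurable_funM; [exact: adapted_smsum|exact: adapted_stopped].
have [iYx Yx0] := adapted_mul_mean0 (ltn0Sn N) aY YM (mf N) (ifg N) (f0 N).
have ix2 : P.-integrable setT (fun w => (xi w ^+ 2)%:E).
  apply/integrableP; split.
    apply/measurable_EFinP; apply: measurable_funX.
    by apply/measurable_EFinP; case/integrableP : (ifg N).
  under eq_integral do rewrite gee0_abs ?lee_fin ?sqr_ge0//.
  by rewrite (le_lt_trans (fv N)) ?ltry.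
have mZt : measurable_fun setT Zt by apply: (@adapted_measurable N.+1); exact: adapted_stopped.
have iZ2 : P.-integrable setT (fun w => (Zt w ^+ 2 * xi w ^+ 2)%:E).
  apply: (@integrable_bounded_mul _ _ (z N ^+ 2)) => //.
    exact: measurable_funX.
  by move=> w; rewrite normrX lerXn2r// nnegrE.
have E w : (smsum M N.+1 w ^+ 2)%:E =
    ((smsum M N w ^+ 2)%:E + (2%:E * (Y w * xi w)%:E + (Zt w ^+ 2 * xi w ^+ 2)%:E))%E.
  rewrite -EFinM -!EFinD; congr (_%:E).
  by rewrite {1}/smsum big_ord_recr/= -/(smsum M N w) -/(Zt w) -/(xi w) /Y; ring.
have i2Y : P.-integrable setT (fun w => (2%:E * (Y w * xi w)%:E)%E) by exact: integrableZl.
split.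
  by under eq_fun do rewrite E; apply: integrableD => //; apply: integrableD.
under eq_integral do rewrite E.
rewrite integralD//; last exact: integrableD.
rewrite integralD// integralZl// Yx0 mule0 add0e big_ord_recr/= EFinD leeD//.
have -> : ((z N ^+ 2 * v N)%:E = (z N ^+ 2)%:E * (v N)%:E)%E by rewrite EFinM.
apply: (@le_trans _ _ (\int[P]_w ((z N ^+ 2)%:E * (xi w ^+ 2)%:E))%E).
  apply: ge0_le_integral => //.
  - by move=> w _; rewrite lee_fin mulr_ge0 ?sqr_ge0.
  - by case/integrableP : iZ2.
  - by case/integrableP: (integrableZl measurableT (z N ^+ 2) ix2).
  - move=> w _; rewrite -EFinM lee_fin ler_wpM2r ?sqr_ge0//.
    by rewrite -[leLHS]real_normK ?num_real// lerXn2r// nnegrE.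
rewrite integralZl//; apply: lee_wpmul2l; first by rewrite lee_fin sqr_ge0.
exact: fv.
Qed.

Definition exceed M N := [set w | M < `|smsum M N w|].

Lemma exceedE M N w : 0 <= M -> exceed M N w <-> ~~ unstopped M N w.
Proof.
move=> M0; rewrite /exceed/=; have := smsumP N w M0; case: ifPn => // u ->.
by split=> //; rewrite ltNge unstopped_le.
Qed.

Lemma exceed_measurable M N : measurable (exceed M N).
Proof.
have mS : measurable_fun setT (smsum M N).
  by apply: (@adapted_measurable N.+1); exact: adapted_smsum.
have mN : measurable_fun setT (fun w => `|smsum M N w|).
  by apply: measurableT_comp => //; exact: measurable_normr.
rewrite (_ : exceed M N = setT `&` (fun w => `|smsum M N w|) @^-1` `]M, +oo[%classic).
  exact: mN.
by rewrite setTI; apply/seteqP; split => w /=; rewrite in_itv/= andbT.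
Qed.

Lemma exceed_prob M N V : 0 < M -> (forall N, \sum_(i < N) z i ^+ 2 * v i <= V) ->
  (P (exceed M N) <= (V / M ^+ 2)%:E)%E.
Proof.
move=> M0 VN; have [iS lS] := smsum_sqr N (ltW M0).
have M20 : 0 < M ^+ 2 by rewrite exprn_gt0.
have : ((M ^+ 2)%:E * P (exceed M N) <= V%:E)%E.
  rewrite -integral_cst; last exact: exceed_measurable.
  apply: (@le_trans _ _ (\int[P]_w (smsum M N w ^+ 2)%:E)%E); last first.
    by rewrite (le_trans lS)// lee_fin.
  have mS : measurable_fun setT (fun w => (smsum M N w ^+ 2)%:E).
    by case/integrableP : iS.
  apply: (@le_trans _ _ (\int[P]_(w in exceed M N) (smsum M N w ^+ 2)%:E)%E).
    apply: ge0_le_integral.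
    - exact: exceed_measurable.
    - by move=> w _; rewrite lee_fin ltW.
    - exact: measurable_cst.
    - exact: measurable_funTS.
    - move=> w /ltW Mw; rewrite lee_fin -[leRHS]real_normK ?num_real//.
      by rewrite lerXn2r// nnegrE ltW.
  apply: ge0_subset_integral => //; first exact: exceed_measurable.
  by move=> w _; rewrite lee_fin sqr_ge0.
have Pfin : P (exceed M N) \is a fin_num by apply: fin_num_measure; exact: exceed_measurable.
rewrite -(fineK Pfin) -EFinM !lee_fin ler_pdivlMr// => H.
by rewrite mulrC.
Qed.

(** The Chebyshev bound [V / M^2] is uniform in [N] and passes to the increasing union over [N].
    Unbounded paths lie in the intersection over [M], which is therefore null. Boundedness is the
    form in which Abel summation uses the random sums. *)
Lemma msum_bounded V : (forall N, \sum_(i < N) z i ^+ 2 * v i <= V) ->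
  {ae P, forall w, exists B, forall N, `|msum N w| <= B}.
Proof.
move=> VN; pose U M := \bigcup_N exceed M N.
have V0 : 0 <= V by rewrite (le_trans _ (VN 0%N))// big_ord0.
have mU M : measurable (U M).
  by apply: bigcupT_measurable => N; exact: exceed_measurable.
have PU M : 0 < M -> (P (U M) <= (V / M ^+ 2)%:E)%E.
  move=> M0; have nd : nondecreasing_seq (exceed M).
    apply/nondecreasing_seqP => N; apply/subsetPset => w.
    rewrite !exceedE ?ltW// unstoppedS negb_and => ->//.
  have cv := @nondecreasing_cvg_mu _ _ _ P _ (exceed_measurable M) (mU M) nd.
  apply: (cvge_to_le cv).
  by apply: nearW => N; exact: exceed_prob.
exists (\bigcap_(M : nat) U M.+1%:R); split.
- by apply: bigcapT_measurable => M.
- have mI : measurable (\bigcap_(M : nat) U M.+1%:R) by apply: bigcapT_measurable => M.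
  have PI M : (P (\bigcap_(M : nat) U M.+1%:R) <= (V / M.+1%:R ^+ 2)%:E)%E.
    apply: (le_trans _ (PU M.+1%:R _)); last by rewrite ltr0n.
    by apply: le_measure; rewrite ?inE//; exact: bigcap_inf.
  have [p pE] : exists p : R, P (\bigcap_(M : nat) U M.+1%:R) = p%:E.
    by exists (fine (P (\bigcap_(M : nat) U M.+1%:R))); rewrite fineK// fin_num_measure.
  have Hp M : p <= V / M.+1%:R ^+ 2 by have := PI M; rewrite pE lee_fin.
  have : 0 <= p by rewrite -lee_fin -pE measure_ge0.
  rewrite pE le_eqVlt => /predU1P[<- //|p0].
  exfalso; have := archi_boundP (divr_ge0 V0 (ltW p0)).
  set m := Num.bound _ => Vm; have := Hp m.
  rewrite ler_pdivlMr ?exprn_gt0 ?ltr0n// leNgt => /negP; apply.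
  move: Vm; rewrite ltr_pdivrMr// => /lt_le_trans; apply.
  rewrite mulrC ler_wpM2l ?(ltW p0)// -natrX ler_nat.
  by rewrite (leq_trans (leqnSn m))// expnS leq_pmulr.
- move=> w /= nB M _; apply: contrapT => nU; apply: nB; exists M.+1%:R => N.
  apply: unstopped_le; apply: contrapT => /negP nN; apply: nU; exists N => //.
  exact/exceedE.
Qed.

End MaximalInequality.

End Past.

(** * Vanishing sequences, little-o, and summation by parts *)

Section SmallSequences.
Context {R : realType}.
Implicit Types (u s : nat -> R) (e : R).

Definition to0 u := forall e, 0 < e -> exists N, forall i, (N <= i)%N -> `|u i| <= e.

Lemma to0_le u (v : nat -> R) (K : R) N0 : to0 v ->
  (forall i, (N0 <= i)%N -> `|u i| <= K * `|v i|) -> to0 u.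
Proof.
move=> v0 uv e e0; have K0 : 0 < `|K| + 1 by rewrite ltr_wpDl.
have [N HN] := v0 _ (divr_gt0 e0 K0).
exists (maxn N0 N) => i; rewrite geq_max => /andP[i0 iN].
rewrite (le_trans (uv _ i0))//; have := HN _ iN; rewrite ler_pdivlMr// => H.
rewrite (le_trans _ H)// mulrC ler_wpM2l//.
by rewrite (le_trans (ler_norm K))// lerDl.
Qed.

Lemma to0D u (v : nat -> R) : to0 u -> to0 v -> to0 (fun i => `|u i| + `|v i|).
Proof.
move=> u0 v0 e e0; have e20 : 0 < e / 2 by lra.
have [N HN] := u0 _ e20; have [M HM] := v0 _ e20.
exists (maxn N M) => i; rewrite geq_max => /andP[iN iM].
rewrite ger0_norm ?addr_ge0//; have := HN _ iN; have := HM _ iM; lra.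
Qed.

Lemma to0_shift u j : to0 u -> to0 (fun i => u (i + j)%N).
Proof.
move=> u0 e /u0[N HN]; exists N => i iN; apply: HN.
by rewrite (leq_trans iN)// leq_addr.
Qed.

Definition small L s := forall e, 0 < e ->
  exists N, forall n, (N <= n)%N -> `|s n| <= e * (L n : R).

Definition unbounded (L : nat -> R) := forall A, exists N, forall n, (N <= n)%N -> A <= L n.

Lemma small_le L s (s' : nat -> R) N0 : small L s' ->
  (forall i, (N0 <= i)%N -> `|s i| <= `|s' i|) -> small L s.
Proof.
move=> H ss e /H[N HN]; exists (maxn N0 N) => i; rewrite geq_max => /andP[i0 iN].
by rewrite (le_trans (ss _ i0))// HN.
Qed.

Lemma smallD L s (s' : nat -> R) : small L s -> small L s' ->
  small L (fun n => s n + s' n).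
Proof.
move=> h h' e e0; have e20 : 0 < e / 2 by lra.
have [N HN] := h _ e20; have [M HM] := h' _ e20.
exists (maxn N M) => i; rewrite geq_max => /andP[iN iM].
rewrite (le_trans (ler_normD _ _))//; have := HN _ iN; have := HM _ iM; lra.
Qed.

Lemma smallZ L s (a : R) : small L s -> small L (fun n => a * s n).
Proof.
move=> h e e0; have K0 : 0 < `|a| + 1 by rewrite ltr_wpDl.
have [N HN] := h _ (divr_gt0 e0 K0); exists N => i iN.
have := HN _ iN; rewrite mulrAC ler_pdivlMr// normrM => H.
by rewrite (le_trans _ H)// mulrC ler_wpM2l// lerDl.
Qed.

Lemma small_bounded L s B : unbounded L -> (forall n, `|s n| <= B) -> small L s.
Proof.
move=> uL sB e e0; have [N HN] := uL (B / e); exists N => i iN.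
rewrite (le_trans (sB i))//; have := HN _ iN.
by rewrite ler_pdivrMr// mulrC.
Qed.

Lemma small_sum L H (s : nat -> nat -> R) : unbounded L ->
  (forall j, small L (s j)) -> small L (fun n => \sum_(j < H) s j n).
Proof.
move=> uL h; elim: H => [|H IH].
  by apply: (small_bounded (B := 0)) => // n; rewrite big_ord0 normr0.
apply: (small_le (N0 := 0%N) (smallD IH (h H))) => i _.
by rewrite big_ord_recr.
Qed.

(** Weighted Cesàro means: from some index on, a term costs at most [e / 2] of its weight, and the
    fixed initial sum is absorbed because [L] is unbounded. *)
Lemma small_cesaro (om t x : nat -> R) (L : nat -> R) i0 :
  L = (fun n => \sum_(i < n) om i) -> (forall i, 0 <= om i) -> unbounded L ->
  to0 t -> (forall i, (i0 <= i)%N -> `|x i| <= om i * `|t i|) ->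
  small L (fun n => \sum_(i < n) x i).
Proof.
move=> LE om0 uL t0 xt e e0; have e20 : 0 < e / 2 by lra.
have [N1 HN1] := t0 _ e20; pose N := maxn i0 N1.
pose A := \sum_(i < N) `|x i|.
have key k : `|\sum_(i < N + k) x i| <= A + e / 2 * L (N + k)%N.
  elim: k => [|k IH].
    rewrite addn0 (le_trans (ler_norm_sum _ _ _))// lerDl mulr_ge0 ?(ltW e20)//.
    by rewrite LE sumr_ge0.
  rewrite addnS big_ord_recr/= (le_trans (ler_normD _ _))//.
  have -> : L (N + k).+1 = L (N + k)%N + om (N + k)%N by rewrite LE big_ord_recr.
  have Nk : (i0 <= N + k)%N by rewrite (leq_trans (leq_maxl i0 N1))// leq_addr.
  have Nk1 : (N1 <= N + k)%N by rewrite (leq_trans (leq_maxr i0 N1))// leq_addr.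
  have : om (N + k)%N * `|t (N + k)%N| <= om (N + k)%N * (e / 2).
    by rewrite ler_wpM2l ?om0 ?HN1.
  by move: (xt _ Nk) IH; rewrite mulrDr; lra.
have [M HM] := uL (A / (e / 2)); exists (maxn N M) => n; rewrite geq_max => /andP[Nn Mn].
have := key (n - N)%N; rewrite subnKC//; have := HM _ Mn.
rewrite ler_pdivrMr//; lra.
Qed.

(** The step of Kronecker's lemma that removes a damping factor: the variation [p N - p 0] and the
    two boundary terms add up to [2 * p N]. *)
Lemma abel_ndecr (p T : nat -> R) B N : (forall i, `|T i| <= B) ->
  (forall i, 0 <= p i) -> (forall i, p i <= p i.+1) ->
  `|\sum_(i < N) p i * (T i.+1 - T i)| <= 2 * B * p N.
Proof.
move=> TB p0 pm.
have key : `|\sum_(i < N) p i * (T i.+1 - T i) - p N * T N + p 0%N * T 0%N| <= B * (p N - p 0%N).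
  elim: N => [|N IH]; first by rewrite big_ord0 sub0r addNr subrr mulr0 normr0.
  rewrite big_ord_recr/=.
  rewrite (_ : _ + _ = (\sum_(i < N) p i * (T i.+1 - T i) - p N * T N + p 0%N * T 0%N)
    - T N.+1 * (p N.+1 - p N)); last by ring.
  rewrite (le_trans (ler_normB _ _))// (_ : B * _ = B * (p N - p 0%N) + B * (p N.+1 - p N)); last by ring.
  by rewrite lerD// normrM (ger0_norm (_ : 0 <= p N.+1 - p N)) ?subr_ge0// ler_wpM2r ?subr_ge0.
have : `|p N * T N| <= p N * B by rewrite normrM (ger0_norm (p0 N)) ler_wpM2l.
have : `|p 0%N * T 0%N| <= p 0%N * B by rewrite normrM (ger0_norm (p0 _)) ler_wpM2l.
by move: key; rewrite !ler_norml; lra.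
Qed.

(** With decreasing weights, boundedness of [T] alone already yields a Cauchy estimate whose rate is
    the weight itself. *)
Lemma abel_decr (p T x : nat -> R) B n0 : (forall i, `|T i| <= B) ->
  (forall i, 0 <= p i) -> (forall i, p i.+1 <= p i) ->
  (forall i, (n0 <= i)%N -> x i.+1 - x i = p i * (T i.+1 - T i)) ->
  forall n N, (n0 <= n)%N -> (n <= N)%N -> `|x N - x n| <= 2 * B * p n.
Proof.
move=> TB p0 pm xE n N n0n nN.
have key k : `|x (n + k)%N - x n - p (n + k)%N * T (n + k)%N + p n * T n|
    <= B * (p n - p (n + k)%N).
  elim: k => [|k IH]; first by rewrite addn0 !subrr sub0r addNr mulr0 normr0.
  have nk : (n0 <= n + k)%N by rewrite (leq_trans n0n)// leq_addr.
  rewrite addnS (_ : _ + _ = (x (n + k)%N - x n - p (n + k)%N * T (n + k)%N + p n * T n)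
    + T (n + k).+1 * (p (n + k)%N - p (n + k).+1)); last by move: (xE _ nk); lra.
  rewrite (le_trans (ler_normD _ _))//.
  rewrite (_ : B * (p n - _) = B * (p n - p (n + k)%N) + B * (p (n + k)%N - p (n + k).+1)); last by ring.
  by rewrite lerD// normrM (ger0_norm (_ : 0 <= p (n + k)%N - p (n + k).+1)) ?subr_ge0// ler_wpM2r ?subr_ge0.
have := key (N - n)%N; rewrite subnKC//.
have : `|p N * T N| <= p N * B by rewrite normrM (ger0_norm (p0 N)) ler_wpM2l.
have : `|p n * T n| <= p n * B by rewrite normrM (ger0_norm (p0 n)) ler_wpM2l.
by rewrite !ler_norml; lra.
Qed.

(** For [u < 0] the cubic term enters: the difference of the two sides, as a function of [t], has
    derivative [t^2 ((1 + t)^-1 - 3)], which is not positive on [[- 1 / 2, 0]]. *)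
Lemma ln1D_ge (u : R) : `|u| <= 2^-1 -> u - u ^+ 2 / 2 - `|u| ^+ 3 <= ln (1 + u).
Proof.
move=> u2.
have lnd t : 0 < 1 + t -> isd (fun t => ln (1 + t)) t (1 + t)^-1.
  by move=> t1; apply: isd_eq; last (by apply: isd_ln; [deriv|]); rewrite /=; ring.
have [u0|u0] := leP 0 u.
  have fd t : 0 <= t <= u -> isd (fun t => t - t ^+ 2 / 2 - ln (1 + t)) t
      (1 - t - (1 + t)^-1).
    move=> /andP[t0 _]; apply: isd_eq; last by deriv; apply: lnd; lra.
    by rewrite /=; lra.
  have := isd_le (df := fun t => 1 - t - (1 + t)^-1) u0 (isd_contW fd).
  rewrite expr0n/= addr0 ln1 mul0r !subr0 => H.
  have : u - u ^+ 2 / 2 - ln (1 + u) <= 0.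
    apply: H => t /andP[/ltW t0 /ltW tu]; first by apply: fd; rewrite t0.
    rewrite subr_le0 -[leRHS]mul1r ler_pdivlMr; last lra.
    by have := sqr_ge0 t; rewrite expr2; lra.
  have : 0 <= `|u| ^+ 3 by rewrite exprn_ge0.
  lra.
have {}u2 : - 2^-1 <= u by move: u2; rewrite ler_norml => /andP[].
rewrite ltr0_norm//.
have fd t : u <= t <= 0 -> isd (fun t => ln (1 + t) - t + t ^+ 2 / 2 - t ^+ 3) t
    ((1 + t)^-1 - 1 + t - 3 * t ^+ 2).
  move=> /andP[ut _]; apply: isd_eq; last by deriv; apply: lnd; lra.
  by rewrite /=; lra.
have := isd_le (df := fun t => (1 + t)^-1 - 1 + t - 3 * t ^+ 2) (ltW u0) (isd_contW fd).
rewrite !expr0n/= addr0 ln1 mul0r !subr0 addr0 => H.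
have : 0 <= ln (1 + u) - u + u ^+ 2 / 2 - u ^+ 3.
  apply: H => t /andP[/ltW t0 /ltW tu]; first by apply: fd; rewrite t0.
  have t1 : 0 < 1 + t by lra.
  have -> : (1 + t)^-1 - 1 + t - 3 * t ^+ 2 = t ^+ 2 * ((1 + t)^-1 - 3).
    by field; rewrite gt_eqF.
  rewrite mulr_ge0_le0 ?sqr_ge0// subr_le0.
  by rewrite -[leLHS]mul1r ler_pdivrMr//; lra.
have -> : (- u) ^+ 3 = - u ^+ 3 by ring.
lra.
Qed.

End SmallSequences.

(** * Lipschitz and quadratic bounds for sine and cosine *)

Section Trigonometry.
Context {R : realType}.
Implicit Types x y : R.

Lemma norm_cos_le1 x : `|cos x| <= 1.
Proof. by rewrite ler_norml cos_geN1 cos_le1. Qed.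

Lemma norm_sin_le1 x : `|sin x| <= 1.
Proof. by rewrite ler_norml sin_geN1 sin_le1. Qed.

Lemma cos_lip x y : `|cos y - cos x| <= `|y - x|.
Proof.
rewrite -[leRHS]mul1r; apply: (isd_lip_between (df := fun c => - sin c)) => c _.
  by apply: isd_eq; last deriv; rewrite /=; ring.
by rewrite normrN norm_sin_le1.
Qed.

Lemma sin_lip x y : `|sin y - sin x| <= `|y - x|.
Proof.
rewrite -[leRHS]mul1r; apply: (isd_lip_between (df := @cos R)) => c _.
  by apply: isd_eq; last deriv; rewrite /=; ring.
by rewrite norm_cos_le1.
Qed.

Lemma sin_quad x y : `|sin y - sin x - (y - x) * cos x| <= `|y - x| ^+ 2.
Proof.
rewrite -[leRHS]mul1r; apply: (isd_quad_ball (f1 := @cos R) (f2 := fun c => - sin c)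
  (A := `|x| + `|y|)) => [c _|c _|c _||].
- by apply: isd_eq; last deriv; rewrite /=; ring.
- by apply: isd_eq; last deriv; rewrite /=; ring.
- by rewrite normrN norm_sin_le1.
- by rewrite lerDl.
- by rewrite lerDr.
Qed.

End Trigonometry.

(** * Local frequencies, their weights, and the logarithmic clock *)

Section Frequencies.
Context {R : realType}.
Variables (F E : R) (i0 : nat).
Hypothesis F0 : 0 < F.

(* Sequences indexed by [i] refer to the site [i.+1].  The index [i0] cuts off the sites where [freq2] is small or negative. *)
Definition freq2 (i : nat) : R := F * i.+1%:R + E.
Definition freq i : R := Num.sqrt (freq2 i).
Definition wgt i : R := if (i < i0)%N then 0 else (freq2 i)^-1.
Definition clock n : R := \sum_(i < n) wgt i.

Hypothesis hi0 : forall i, (i0 <= i)%N -> 1 + F <= freq2 i.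

Lemma freq2S i : freq2 i.+1 = freq2 i + F.
Proof. by rewrite /freq2 -[i.+2%:R]natr1; ring. Qed.

Lemma freq2_gt0 i : (i0 <= i)%N -> 0 < freq2 i.
Proof. by move=> /hi0; have := F0; lra. Qed.

Lemma freq_sqr i : (i0 <= i)%N -> freq i ^+ 2 = freq2 i.
Proof. by move=> /freq2_gt0/ltW; exact: sqr_sqrtr. Qed.

Lemma freq_ge1 i : (i0 <= i)%N -> 1 <= freq i.
Proof.
move=> ii; rewrite -[leLHS]sqrtr1 (ler_sqrt _ (ltW (freq2_gt0 ii))).
by move: (hi0 ii) F0; lra.
Qed.

Lemma freq_gt0 i : (i0 <= i)%N -> 0 < freq i.
Proof. by move=> /freq_ge1; lra. Qed.

Lemma freqS i : (i0 <= i)%N ->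
  [/\ freq i <= freq i.+1, (freq i.+1 - freq i) * (freq i.+1 + freq i) = F &
   freq i.+1 - freq i <= F / (2 * freq i)].
Proof.
move=> ii; have iS : (i0 <= i.+1)%N by rewrite (leq_trans ii).
have le : freq i <= freq i.+1.
  by rewrite (ler_sqrt _ (ltW (freq2_gt0 iS))) freq2S; move: F0; lra.
have E2 : (freq i.+1 - freq i) * (freq i.+1 + freq i) = F.
  by rewrite -subr_sqr !freq_sqr// freq2S; ring.
have f1 := freq_gt0 ii.
split=> //; rewrite ler_pdivlMr; last lra.
by rewrite -[leRHS]E2 ler_wpM2l ?subr_ge0//; lra.
Qed.

Lemma wgtE i : (i0 <= i)%N -> wgt i = (freq i ^+ 2)^-1.
Proof. by move=> ii; rewrite freq_sqr// /wgt ltnNge ii. Qed.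

Lemma wgt_ge0 i : 0 <= wgt i.
Proof.
rewrite /wgt; case: ifPn => //; rewrite -leqNgt => ii.
by rewrite invr_ge0 ltW// freq2_gt0.
Qed.

Lemma wgt_le1 i : wgt i <= 1.
Proof.
rewrite /wgt; case: ifPn => // ; rewrite -leqNgt => ii.
by rewrite invf_le1 ?freq2_gt0//; have := hi0 ii; have := F0; lra.
Qed.

Lemma clockS n : clock n.+1 = clock n + wgt n.
Proof. by rewrite /clock big_ord_recr. Qed.

Lemma clock_ge0 n : 0 <= clock n.
Proof. by apply: sumr_ge0 => i _; exact: wgt_ge0. Qed.

Lemma clock_le m n : (m <= n)%N -> clock m <= clock n.
Proof.
move=> mn; rewrite -(subnKC mn); elim: (n - m)%N => [|k IH]; first by rewrite addn0.
by rewrite addnS clockS (le_trans IH)// lerDl wgt_ge0.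
Qed.

Lemma ln1D_le (u : R) : 0 <= u -> ln (1 + u) <= u.
Proof. by move=> u0; rewrite -ler_expR lnK ?posrE ?ltr_wpDr// expR_ge1Dx. Qed.

(** Telescoping of [ln (q + F) - ln q <= F / q], where [1 / q] is the weight. *)
Lemma ln_freq2_clock n : (i0 <= n)%N -> ln (freq2 n) - ln (freq2 i0) <= F * clock n.
Proof.
move=> ni; rewrite -(subnKC ni); elim: (n - i0)%N => [|k IH].
  by rewrite addn0 subrr mulr_ge0 ?clock_ge0// ltW.
have ik : (i0 <= i0 + k)%N by rewrite leq_addr.
have q0 := freq2_gt0 ik.
rewrite addnS clockS mulrDr freq2S.
have -> : freq2 (i0 + k)%N + F = freq2 (i0 + k)%N * (1 + F / freq2 (i0 + k)%N).
  by field; rewrite gt_eqF.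
have r0 : 0 < F / freq2 (i0 + k)%N by rewrite divr_gt0.
rewrite lnM ?posrE//; last lra.
rewrite /wgt ltnNge ik /=; move: IH (ln1D_le (ltW r0)); lra.
Qed.

(** A lower bound on the clock turns decay in [clock n] into decay in powers of [n]. The constant
    comes from [F / 2 * n <= freq2 n]. *)
Lemma ln_clock : exists K, exists N, forall n, (N <= n)%N -> ln n%:R <= F * clock n + K.
Proof.
exists (ln (freq2 i0) - ln (F / 2)).
have [N HN] : exists N : nat, 2 * `|E| / F <= N%:R.
  exists (Num.bound (2 * `|E| / F)); apply/ltW/archi_boundP.
  by rewrite divr_ge0 ?mulr_ge0// ltW.
exists (maxn (maxn i0 N) 1) => n; rewrite !geq_max => /andP[/andP[ni nN] n1].
have n0 : 0 < n%:R :> R by rewrite ltr0n.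
have F20 : 0 < F / 2 by have := F0; lra.
have : F / 2 * n%:R <= freq2 n.
  have : 2 * `|E| / F <= n%:R by rewrite (le_trans HN)// ler_nat.
  rewrite ler_pdivrMr// => H.
  rewrite /freq2 -[n.+1%:R]natr1 mulrDr; have : - E <= `|E| by rewrite -normrN ler_norm.
  by have := F0; lra.
rewrite -ler_ln ?posrE ?mulr_gt0 ?freq2_gt0// lnM ?posrE//.
by have := ln_freq2_clock ni; lra.
Qed.

Lemma ln_unbounded (A : R) : exists N, forall n : nat, (N <= n)%N -> A <= ln n%:R.
Proof.
exists (Num.bound (expR A)).+1 => n Nn.
rewrite -ler_expR lnK ?posrE ?ltr0n; last exact: leq_trans Nn.
apply: (le_trans (ltW (archi_boundP (expR_ge0 A)))).
by rewrite ler_nat (leq_trans _ Nn).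
Qed.

Lemma clock_unbounded : unbounded clock.
Proof.
move=> A; have [K [N HN]] := ln_clock; have [M HM] := ln_unbounded (F * A + K).
exists (maxn N M) => n; rewrite geq_max => /andP[/HN h /HM h'].
by rewrite -(ler_pM2l F0); lra.
Qed.

Lemma freqV_to0 : to0 (fun i => (freq i)^-1).
Proof.
move=> e e0; have e20 : 0 < e ^+ 2 by rewrite exprn_gt0.
have [N HN] : exists N : nat, ((e ^+ 2)^-1 + `|E|) / F <= N%:R.
  exists (Num.bound (((e ^+ 2)^-1 + `|E|) / F)); apply/ltW/archi_boundP.
  by rewrite divr_ge0 ?addr_ge0 ?invr_ge0// ltW.
exists (maxn i0 N) => i; rewrite geq_max => /andP[ii iN].
have k0 := freq_gt0 ii.
rewrite ger0_norm ?invr_ge0 ?(ltW k0)//.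
have : ((e ^+ 2)^-1 + `|E|) / F <= i%:R by rewrite (le_trans HN)// ler_nat.
rewrite ler_pdivrMr// => H.
have : (e ^+ 2)^-1 <= freq i ^+ 2.
  rewrite freq_sqr// /freq2 -[i.+1%:R]natr1 mulrDr.
  have : - E <= `|E| by rewrite -normrN ler_norm.
  by have := F0; lra.
rewrite -exprVn ler_sqr ?nnegrE ?invr_ge0 ?(ltW k0) ?(ltW e0)// => H2.
by rewrite -[leRHS]invrK lef_pV2 ?posrE ?invr_gt0.
Qed.

Lemma small_wgt (t x : nat -> R) j0 : to0 t ->
  (forall i, (j0 <= i)%N -> `|x i| <= wgt i * `|t i|) ->
  small clock (fun n => \sum_(i < n) x i).
Proof.
move=> t0 xt; apply: (small_cesaro (om := wgt) _ _ _ t0 xt) => //.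
  exact: wgt_ge0.
exact: clock_unbounded.
Qed.

Lemma small_bnd s B : (forall n, `|s n| <= B) -> small clock s.
Proof. by move=> sB; apply: small_bounded sB; exact: clock_unbounded. Qed.

(** The weight is [0] before [i0], jumps to a value at most [1], and decreases from there. *)
Lemma wgt_variation n : \sum_(i < n) `|wgt i.+1 - wgt i| <= 2.
Proof.
have key n' : \sum_(i < n') `|wgt i.+1 - wgt i| <=
    if (n' < i0)%N then 0 else 2 - wgt n'.
  elim: n' => [|m IH].
    rewrite big_ord0; case: ifPn => // _; have := wgt_le1 0; lra.
  rewrite big_ord_recr/=; move: IH; have [mi|im] := ltnP m i0.
    move=> IH; have wm : wgt m = 0 by rewrite /wgt mi.
    rewrite wm subr0 (ger0_norm (wgt_ge0 _)); case: ifPn => [mi'|_].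
      by rewrite (_ : wgt m.+1 = 0) ?addr0// /wgt mi'.
    by have := wgt_le1 m.+1; lra.
  rewrite ltnNge (leq_trans im (leqnSn m))/= => IH.
  have : wgt m.+1 <= wgt m.
    rewrite /wgt !ltnNge im (leq_trans im (leqnSn m))/= lef_pV2 ?posrE ?freq2_gt0//; last exact: leqW.
    by rewrite freq2S; have := F0; lra.
  by move=> h; rewrite ler0_norm ?subr_le0//; lra.
by apply: (le_trans (key n)); case: ifPn => // _; have := wgt_ge0 n; lra.
Qed.

(** By Abel summation a shift of the index costs the variation of the weights and two boundary
    terms, together at most [4]. *)
Lemma clock_shift1 (c : nat -> R) : (forall i, `|c i| <= 1) ->
  small clock (fun n => \sum_(i < n) wgt i * c i.+1 - \sum_(i < n) wgt i * c i).
Proof.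
move=> c1; apply: (small_bnd (B := 4)) => n.
have E1 : \sum_(i < n) wgt i * c i.+1 - \sum_(i < n) wgt i * c i =
    wgt n * c n - wgt 0%N * c 0%N - \sum_(i < n) (wgt i.+1 - wgt i) * c i.+1.
  elim: n => [|n IH]; first by rewrite !big_ord0; ring.
  rewrite !big_ord_recr/=.
  rewrite (_ : _ - _ = (\sum_(i < n) wgt i * c i.+1 - \sum_(i < n) wgt i * c i)
    + (wgt n * c n.+1 - wgt n * c n)); last by ring.
  by rewrite IH; ring.
rewrite E1.
have h i : `|wgt i * c i| <= 1.
  by rewrite normrM (ger0_norm (wgt_ge0 i)) -[leRHS]mulr1 ler_pM ?wgt_ge0 ?wgt_le1.
have : `|\sum_(i < n) (wgt i.+1 - wgt i) * c i.+1| <= 2.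
  apply: le_trans (wgt_variation n); rewrite (le_trans (ler_norm_sum _ _ _))//.
  by apply: ler_sum => i _; rewrite normrM ler_piMr.
by move: (h n) (h 0%N); rewrite !ler_norml; lra.
Qed.

Lemma clock_shift (c : nat -> R) j : (forall i, `|c i| <= 1) ->
  small clock (fun n => \sum_(i < n) wgt i * c (i + j)%N - \sum_(i < n) wgt i * c i).
Proof.
move=> c1; elim: j => [|j IH].
  apply: (small_bnd (B := 0)) => n.
  by under eq_bigr do rewrite addn0; rewrite subrr normr0.
have := clock_shift1 (c := fun i => c (i + j)%N) (fun i => c1 (i + j)%N).
move=> H1; apply: (small_le (N0 := 0%N) (smallD H1 IH)) => n _ /=.
under eq_bigr do rewrite addnS -addSn.
by rewrite addrA subrK.
Qed.

(* [wgt i * cos (t * freq i)] is, up to a relative error [1 / freq i], an increment of [sin (t * freq i) / freq i]. *)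
Lemma small_cos_freq (t : R) : t != 0 ->
  small clock (fun n => \sum_(i < n) wgt i * cos (t * freq i)).
Proof.
move=> t0; pose v i := sin (t * freq i) / freq i.
(* Since [freq i.+1 - freq i] is about [F / (2 * freq i)], the increment of [v] is about
   [a * wgt i * cos (t * freq i)]. *)
pose a := F * t / 2.
have a0 : a != 0 by rewrite /a !mulf_neq0// gt_eqF.
have S1 : small clock (fun n => \sum_(i < n) (wgt i * cos (t * freq i) - a^-1 * (if (i < i0)%N then 0 else v i.+1 - v i))).
  pose K := `|a^-1| * (t ^+ 2 * F ^+ 2 + `|t| * F ^+ 2 + F).
  apply: (@small_wgt (fun i => K * (freq i)^-1) (fun i => wgt i * cos (t * freq i) -
    a^-1 * (if (i < i0)%N then 0 else v i.+1 - v i)) i0).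
    apply: (to0_le (N0 := 0%N) (K := `|K|) freqV_to0) => i _.
    by rewrite normrM.
  move=> i ii; rewrite ltnNge ii /= wgtE//.
  have k1 := freq_ge1 ii; have k0 : 0 < freq i by lra.
  have [kk kE kD] := freqS ii; set k := freq i in k1 k0 kk kE kD *.
  set k' := freq i.+1 in kk kE kD *; pose D := k' - k.
  have k'0 : 0 < k' by lra.
  have D0 : 0 <= D by rewrite subr_ge0.
  have DF : D * k <= F.
    have Dk : 0 <= D * k by rewrite mulr_ge0// ltW.
    by move: kD; rewrite -/D ler_pdivlMr ?mulr_gt0//; lra.
  (* The three errors are the Taylor remainder of the sine, the replacement of [D] by [F / (2 * k)]
     through [F = D * (2 * k + D)], and the change of the amplitude [1 / k]. Each is
     [O(1 / k^3)]. *)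
  have dec : (k ^+ 2)^-1 * cos (t * k) - a^-1 * (v i.+1 - v i) =
    - a^-1 * ((sin (t * k') - sin (t * k) - (t * k' - t * k) * cos (t * k)) / k
       + t * cos (t * k) * (- D ^+ 2 / (2 * k ^+ 2))
       - sin (t * k') * (D / (k * k'))).
    rewrite /v -/k -/k' /a -kE /D; field.
    have kd : k' - k != 0.
      by apply/eqP => kd0; move: kE F0; rewrite kd0 mul0r => <-; rewrite ltxx.
    by rewrite kd t0 !gt_eqF ?addr_gt0.
  have b1 : `|(sin (t * k') - sin (t * k) - (t * k' - t * k) * cos (t * k)) / k| <=
      t ^+ 2 * F ^+ 2 * (k ^+ 3)^-1.
    rewrite normrM normfV (gtr0_norm k0) ler_pdivrMr// (le_trans (sin_quad _ _))//.
    rewrite -mulrBr normrM exprMn !real_normK ?num_real// -/D.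
    have -> : t ^+ 2 * F ^+ 2 * (k ^+ 3)^-1 * k = t ^+ 2 * (F / k) ^+ 2.
      by field; rewrite gt_eqF.
    have h1 : D <= F / k by rewrite ler_pdivlMr.
    have h2 : 0 <= F / k by rewrite divr_ge0// ltW.
    by rewrite ler_wpM2l ?sqr_ge0// ler_sqr ?nnegrE.
  have b2 : `|t * cos (t * k) * (- D ^+ 2 / (2 * k ^+ 2))| <=
      `|t| * F ^+ 2 * (k ^+ 3)^-1.
    have kk3 : 0 < k ^+ 3 by rewrite exprn_gt0.
    have pos : 0 <= D ^+ 2 / (2 * k ^+ 2) by apply: divr_ge0; [exact: sqr_ge0|apply: mulr_ge0 => //; exact: sqr_ge0].
    have mainb : D ^+ 2 / (2 * k ^+ 2) <= F ^+ 2 * (k ^+ 3)^-1.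
      rewrite ler_pdivrMr ?mulr_gt0 ?exprn_gt0// mulrAC ler_pdivlMr//.
      have h1 : (D * k) ^+ 2 <= F ^+ 2 by rewrite ler_sqr ?nnegrE ?mulr_ge0// ltW.
      have h2 : D ^+ 2 * k ^+ 3 = (D * k) ^+ 2 * k by ring.
      rewrite h2; have : (D * k) ^+ 2 * k <= F ^+ 2 * k by rewrite ler_wpM2r// ltW.
      have : F ^+ 2 * k <= F ^+ 2 * (2 * k ^+ 2).
        rewrite ler_wpM2l ?sqr_ge0//; have : k <= k ^+ 2 by rewrite expr2 ler_peMl// ltW.
        by lra.
      by lra.
    rewrite 2!normrM -mulrA -[leRHS]mulrA ler_wpM2l// mulNr normrN (ger0_norm pos).
    by rewrite -[leRHS]mul1r ler_pM ?norm_cos_le1.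
  have b3 : `|sin (t * k') * (D / (k * k'))| <= F * (k ^+ 3)^-1.
    rewrite normrM -[leRHS]mul1r ler_pM ?norm_sin_le1//.
    rewrite ger0_norm; last by rewrite divr_ge0// mulr_ge0// ltW.
    rewrite ler_pdivrMr ?mulr_gt0// mulrAC ler_pdivlMr ?exprn_gt0//.
    have -> : D * k ^+ 3 = (D * k) * (k * k) by ring.
    have Dk : 0 <= D * k by rewrite mulr_ge0// ltW.
    have kk0 : 0 <= k * k by rewrite mulr_ge0 ?ltW.
    by rewrite ler_pM// ler_pM2l.
  rewrite dec normrM normrN.
  have K0 : 0 <= K.
    have p1 : 0 <= t ^+ 2 * F ^+ 2 by apply: mulr_ge0; exact: sqr_ge0.
    have p2 : 0 <= `|t| * F ^+ 2 by apply: mulr_ge0 => //; exact: sqr_ge0.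
    by apply: mulr_ge0 => //; move: F0; lra.
  have -> : (k ^+ 2)^-1 * `|K * k^-1| = `|a^-1| *
      (t ^+ 2 * F ^+ 2 * (k ^+ 3)^-1 + `|t| * F ^+ 2 * (k ^+ 3)^-1 + F * (k ^+ 3)^-1).
    have KK : 0 <= K * k^-1 by rewrite mulr_ge0// invr_ge0 ltW.
    rewrite (ger0_norm KK) /K.
    by field; rewrite gt_eqF.
  rewrite ler_wpM2l// (le_trans (ler_normB _ _))// lerD//.
  by rewrite (le_trans (ler_normD _ _))// lerD.
have S2 : small clock (fun n => \sum_(i < n) (if (i < i0)%N then 0 else v i.+1 - v i)).
  have v1 i : (i0 <= i)%N -> `|v i| <= 1.
    move=> /freq_ge1 k1; rewrite /v normrM normfV (ger0_norm (_ : 0 <= freq i)); last lra.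
    by rewrite ler_pdivrMr ?mul1r; [rewrite (le_trans (norm_sin_le1 _))|lra].
  apply: (small_bnd (B := 2)) => n.
  have -> : \sum_(i < n) (if (i < i0)%N then 0 else v i.+1 - v i) =
      if (n < i0)%N then 0 else v n - v i0.
    elim: n => [|n IH].
      by rewrite big_ord0; case: ifPn => //; rewrite -leqNgt leqn0 => /eqP ->; rewrite subrr.
    rewrite big_ord_recr/= IH; have [ni|ni] := ltnP n i0.
      rewrite addr0; case: ifPn => //; rewrite -leqNgt => ni'.
      have -> : n.+1 = i0 by apply/eqP; rewrite eqn_leq ni.
      by rewrite subrr.
    by rewrite ltnNge (leq_trans ni (leqnSn n))/=; ring.
  case: ifPn => [_|]; first by rewrite normr0.
  rewrite -leqNgt => ni; rewrite (le_trans (ler_normB _ _))//.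
  by have := v1 _ ni; have := v1 _ (leqnn i0); lra.
apply: (small_le (N0 := 0%N) (smallD S1 (smallZ a^-1 S2))) => n _ /=.
rewrite mulr_sumr -big_split/=.
by under [in leRHS]eq_bigr do rewrite subrK.
Qed.

End Frequencies.

(** * Averaging of oscillating phases *)

Section Oscillation.
Context {R : realType}.
Implicit Types (u v b : nat -> R).

Lemma to0_ext u v N0 : to0 v -> (forall i, (N0 <= i)%N -> u i = v i) -> to0 u.
Proof. by move=> v0 uv; apply: (to0_le (N0 := N0) (K := 1) v0) => i /uv ->; rewrite mul1r. Qed.

Lemma to0_add u v : to0 u -> to0 v -> to0 (fun i => u i + v i).
Proof.
move=> u0 v0; apply: (to0_le (N0 := 0%N) (K := 1) (to0D u0 v0)) => i _.
by rewrite mul1r [leRHS]ger0_norm ?addr_ge0// ler_normD.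
Qed.

Lemma to0_mul u b K N0 : to0 u -> (forall i, (N0 <= i)%N -> `|b i| <= K) ->
  to0 (fun i => b i * u i).
Proof.
move=> u0 bK; apply: (to0_le (N0 := N0) (K := K) u0) => i /bK h.
by rewrite normrM ler_wpM2r.
Qed.

Lemma to0_opp u : to0 u -> to0 (fun i => - u i).
Proof. by move=> u0; apply: (to0_le (N0 := 0%N) (K := 1) u0) => i _; rewrite normrN mul1r. Qed.

Variables (F E : R) (i0 : nat).
Hypothesis F0 : 0 < F.
Hypothesis hi0 : forall i, (i0 <= i)%N -> 1 + F <= freq2 F E i.

Local Notation kap := (freq F E).
Local Notation om := (wgt F E i0).
Local Notation L := (clock F E i0).

(* [c] and [s] are the cosine and sine of a phase that decreases by [t * kap i + o(1)]. *)
Definition follows (t : R) (c s : nat -> R) := [/\ forall i, c i ^+ 2 + s i ^+ 2 = 1,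
  to0 (fun i => c i.+1 - (c i * cos (t * kap i) + s i * sin (t * kap i))) &
  to0 (fun i => s i.+1 - (s i * cos (t * kap i) - c i * sin (t * kap i)))].

Lemma unit_le1 (c s : R) : c ^+ 2 + s ^+ 2 = 1 -> `|c| <= 1 /\ `|s| <= 1.
Proof.
move=> cs; rewrite -!(@ler_sqr _ _ 1) ?nnegrE// !real_normK ?num_real// expr1n.
by have := sqr_ge0 c; have := sqr_ge0 s; lra.
Qed.

(** The new pair is the complex square [(c + i s)^2], so its phase moves twice as fast. *)
Lemma follows_double t c s : follows t c s ->
  follows (2 * t) (fun i => c i ^+ 2 - s i ^+ 2) (fun i => 2 * c i * s i).
Proof.
move=> [cs cE sE]; have c1 i := (unit_le1 (cs i)).1; have s1 i := (unit_le1 (cs i)).2.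
have cos2 i : cos (2 * t * kap i) = cos (t * kap i) ^+ 2 - sin (t * kap i) ^+ 2.
  by rewrite -mulrA mulrC mulr_natr mulr2n cosD !expr2.
have sin2 i : sin (2 * t * kap i) = 2 * sin (t * kap i) * cos (t * kap i).
  by rewrite -mulrA mulrC mulr_natr mulr2n sinD; ring.
pose A i := c i * cos (t * kap i) + s i * sin (t * kap i).
pose B i := s i * cos (t * kap i) - c i * sin (t * kap i).
have A2 i : `|A i| <= 2.
  rewrite (le_trans (ler_normD _ _))// !normrM.
  have : `|c i| * `|cos (t * kap i)| <= 1 by rewrite -[leRHS]mulr1 ler_pM ?norm_cos_le1.
  have : `|s i| * `|sin (t * kap i)| <= 1 by rewrite -[leRHS]mulr1 ler_pM ?norm_sin_le1.
  lra.
have B2 i : `|B i| <= 2.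
  rewrite (le_trans (ler_normB _ _))// !normrM.
  have : `|s i| * `|cos (t * kap i)| <= 1 by rewrite -[leRHS]mulr1 ler_pM ?norm_cos_le1.
  have : `|c i| * `|sin (t * kap i)| <= 1 by rewrite -[leRHS]mulr1 ler_pM ?norm_sin_le1.
  lra.
have cA3 i : `|c i.+1 + A i| <= 3 by rewrite (le_trans (ler_normD _ _))//; have := c1 i.+1; have := A2 i; lra.
have sB3 i : `|s i.+1 + B i| <= 3 by rewrite (le_trans (ler_normD _ _))//; have := s1 i.+1; have := B2 i; lra.
split.
- move=> i; rewrite (_ : _ + _ = (c i ^+ 2 + s i ^+ 2) ^+ 2); last by ring.
  by rewrite cs expr1n.
- apply: (to0_ext (N0 := 0%N) (to0_add (to0_mul (N0 := 0%N) cE (fun i _ => cA3 i))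
    (to0_opp (to0_mul (N0 := 0%N) sE (fun i _ => sB3 i))))) => i _ /=.
  by rewrite cos2 sin2 /A /B; ring.
- have s2 i : `|2 * c i.+1| <= 2 by rewrite normrM ger0_norm// ler_piMr.
  have A4 i : `|2 * B i| <= 4 by rewrite normrM ger0_norm//; have := B2 i; lra.
  apply: (to0_ext (N0 := 0%N) (to0_add (to0_mul (N0 := 0%N) sE (fun i _ => s2 i))
    (to0_mul (N0 := 0%N) cE (fun i _ => A4 i)))) => i _ /=.
  by rewrite cos2 sin2 /A /B; ring.
Qed.

Lemma freq_shift_to0 j : to0 (fun i => kap (i + j)%N - kap i).
Proof.
have D1 : to0 (fun i => kap i.+1 - kap i).
  apply: (to0_le (N0 := i0) (K := F / 2) (freqV_to0 F0 hi0)) => i ii.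
  have [le _ D] := freqS F0 hi0 ii; have k0 := freq_gt0 F0 hi0 ii.
  rewrite ger0_norm ?subr_ge0// (le_trans D)// ger0_norm ?invr_ge0 ?(ltW k0)//.
  by rewrite invfM mulrA.
elim: j => [|j IH].
  by apply: (to0_le (N0 := 0%N) (K := 0) D1) => i _; rewrite addn0 subrr normr0 mul0r.
apply: (to0_ext (N0 := 0%N) (to0_add (to0_shift j D1) IH)) => i _.
by rewrite addnS; ring.
Qed.

(** Over a fixed number [j] of steps the frequency changes by [o(1)], so the phase advances by [j]
    times the first step, up to [o(1)]. *)
Lemma follows_iter t c s j : follows t c s ->
  to0 (fun i => c (i + j)%N - (c i * cos (j%:R * (t * kap i)) + s i * sin (j%:R * (t * kap i)))) /\
  to0 (fun i => s (i + j)%N - (s i * cos (j%:R * (t * kap i)) - c i * sin (j%:R * (t * kap i)))).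
Proof.
move=> [cs cE sE]; have c1 i := (unit_le1 (cs i)).1; have s1 i := (unit_le1 (cs i)).2.
elim: j => [|j [IHc IHs]].
  by split; apply: (to0_le (N0 := 0%N) (K := 0) cE) => i _;
    rewrite addn0 mul0r cos0 sin0 ?mulr1 ?mulr0 ?addr0 ?subr0 subrr normr0 mul0r.
have dk := freq_shift_to0 j.
have dcos : to0 (fun i => cos (t * kap (i + j)%N) - cos (t * kap i)).
  apply: (to0_le (N0 := 0%N) (K := `|t|) dk) => i _.
  by rewrite (le_trans (cos_lip _ _))// -mulrBr normrM.
have dsin : to0 (fun i => sin (t * kap (i + j)%N) - sin (t * kap i)).
  apply: (to0_le (N0 := 0%N) (K := `|t|) dk) => i _.
  by rewrite (le_trans (sin_lip _ _))// -mulrBr normrM.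
have jE i : j.+1%:R * (t * kap i) = j%:R * (t * kap i) + t * kap i.
  by rewrite -natr1 mulrDl mul1r.
have ct i : `|cos (t * kap i)| <= 1 by exact: norm_cos_le1.
have st i : `|sin (t * kap i)| <= 1 by exact: norm_sin_le1.
split.
  apply: (to0_ext (N0 := 0%N) (to0_add (to0_shift j cE)
    (to0_add (to0_add (to0_mul (N0 := 0%N) dcos (fun i _ => c1 (i + j)%N))
                      (to0_mul (N0 := 0%N) dsin (fun i _ => s1 (i + j)%N)))
             (to0_add (to0_mul (N0 := 0%N) IHc (fun i _ => ct i))
                      (to0_mul (N0 := 0%N) IHs (fun i _ => st i)))))) => i _ /=.
  by rewrite jE cosD sinD addnS; ring.
apply: (to0_ext (N0 := 0%N) (to0_add (to0_shift j sE)
    (to0_add (to0_add (to0_mul (N0 := 0%N) dcos (fun i _ => s1 (i + j)%N))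
                      (to0_opp (to0_mul (N0 := 0%N) dsin (fun i _ => c1 (i + j)%N))))
             (to0_add (to0_mul (N0 := 0%N) IHs (fun i _ => ct i))
                      (to0_opp (to0_mul (N0 := 0%N) IHc (fun i _ => st i))))))) => i _ /=.
by rewrite jE cosD sinD addnS; ring.
Qed.

(* Van der Corput: a block of [m ^ 2] consecutive phases is an arithmetic progression up to [o(1)]. *)
Lemma small_follows t c s : t != 0 -> follows t c s ->
  small L (fun n => \sum_(i < n) om i * c i).
Proof.
move=> t0 fo; have [cs _ _] := fo; have c1 i := (unit_le1 (cs i)).1.
have uL := clock_unbounded F0 hi0.
have om0 := wgt_ge0 F0 hi0.
pose A n := \sum_(i < n) om i * c i.
move=> e e0.
have [m m0 me] : exists2 m : nat, (0 < m)%N & m%:R^-1 <= e / 2.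
  have e2 : 0 <= 2 / e by rewrite divr_ge0// ltW.
  exists (Num.bound (2 / e)).+1 => //.
  rewrite -[leRHS]invrK lef_pV2 ?posrE ?invr_gt0 ?divr_gt0 ?ltr0n// invf_div.
  by rewrite (le_trans (ltW (archi_boundP e2)))// ler_nat.
(* Averaging over [H = m ^ 2] shifts and applying Young's inequality with weight [m] leaves a main
   term [L n / m], hence the requirement that [1 / m] be at most [e / 2]. *)
pose H := (m ^ 2)%N.
pose P i := \sum_(j < H) cos (j%:R * (t * kap i)).
pose Q i := \sum_(j < H) sin (j%:R * (t * kap i)).
have S1 : small L (fun n => \sum_(j < H) (A n - \sum_(i < n) om i *
    (c i * cos (j%:R * (t * kap i)) + s i * sin (j%:R * (t * kap i))))).
  apply: (@small_sum R L H (fun j n => A n - \sum_(i < n) om i *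
    (c i * cos (j%:R * (t * kap i)) + s i * sin (j%:R * (t * kap i))))) => // j.
  have h1 := smallZ (-1) (clock_shift F0 hi0 (c := c) j c1).
  have h2 : small L (fun n => \sum_(i < n) om i * (c (i + j)%N -
     (c i * cos (j%:R * (t * kap i)) + s i * sin (j%:R * (t * kap i))))).
    apply: (@small_wgt R F E i0 F0 hi0 _ (fun i => om i * (c (i + j)%N -
     (c i * cos (j%:R * (t * kap i)) + s i * sin (j%:R * (t * kap i))))) 0%N (follows_iter j fo).1) => i _.
    by rewrite normrM (ger0_norm (om0 i)).
  apply: (small_le (N0 := 0%N) (smallD h1 h2)) => n _ /=.
  under [X in _ <= `|_ + X|]eq_bigr do rewrite mulrBr.
  by rewrite sumrB mulN1r opprB addrA subrK.
(* The squared block sum [P^2 + Q^2] is a double sum of cosines of [(j - l) * t * kap i]. The terms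
   off the diagonal average out, and the diagonal contributes [H * L n]. *)
have S2 : small L (fun n => \sum_(j < H) \sum_(l < H)
    (\sum_(i < n) om i * cos ((j%:R - l%:R) * t * kap i) - (j == l :> nat)%:R * L n)).
  apply: (@small_sum R L H (fun j n => \sum_(l < H)
    (\sum_(i < n) om i * cos ((j%:R - l%:R) * t * kap i) - (j == l :> nat)%:R * L n))) => // j.
  apply: (@small_sum R L H (fun l n =>
    \sum_(i < n) om i * cos ((j%:R - l%:R) * t * kap i) - (j == l :> nat)%:R * L n)) => // l.
  case: eqVneq => [->|jl].
    apply: (small_bounded (B := 0)) => // n.
    by rewrite subrr; under eq_bigr do rewrite !mul0r cos0 mulr1; rewrite mul1r subrr normr0.
  have jl0 : (j%:R - l%:R) * t != 0.
    by rewrite mulf_neq0// subr_eq0 eqr_nat.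
  apply: (small_le (N0 := 0%N) (small_cos_freq F0 hi0 jl0)) => n _.
  by rewrite mul0r subr0.
have PQ i : P i ^+ 2 + Q i ^+ 2 = \sum_(j < H) \sum_(l < H) cos ((j%:R - l%:R) * t * kap i).
  rewrite !expr2 /P /Q !big_distrlr -big_split/=; apply: eq_bigr => j _.
  rewrite -big_split/=; apply: eq_bigr => l _.
  by rewrite -cosB; congr cos; ring.
have mR : 0 < m%:R :> R by rewrite ltr0n.
(* Cauchy-Schwarz with [c^2 + s^2 = 1], then Young's inequality balanced at [m], the square root of
   [H]. *)
have B1 i : `|c i * P i + s i * Q i| <= m%:R / 2 + (P i ^+ 2 + Q i ^+ 2) / (2 * m%:R).
  set x := c i * P i + s i * Q i.
  have x2 : `|x| ^+ 2 <= P i ^+ 2 + Q i ^+ 2.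
    rewrite real_normK ?num_real//.
    have -> : P i ^+ 2 + Q i ^+ 2 = x ^+ 2 + (c i * Q i - s i * P i) ^+ 2.
      by rewrite -[P i ^+ 2 + _]mul1r -(cs i) /x; ring.
    by rewrite lerDl sqr_ge0.
  rewrite -(ler_pM2r (_ : 0 < 2 * m%:R)) ?mulr_gt0//.
  have -> : (m%:R / 2 + (P i ^+ 2 + Q i ^+ 2) / (2 * m%:R)) * (2 * m%:R) =
    m%:R ^+ 2 + (P i ^+ 2 + Q i ^+ 2) by field; rewrite gt_eqF.
  by have := sqr_ge0 (`|x| - m%:R); rewrite sqrrB; lra.
have BS n : `|\sum_(i < n) om i * (c i * P i + s i * Q i)| <= m%:R / 2 * L n +
    (\sum_(i < n) om i * (P i ^+ 2 + Q i ^+ 2)) / (2 * m%:R).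
  rewrite (le_trans (ler_norm_sum _ _ _))// mulr_suml mulr_sumr -big_split/=.
  apply: ler_sum => i _; rewrite normrM (ger0_norm (om0 i)).
  rewrite [leRHS](_ : _ = om i * (m%:R / 2 + (P i ^+ 2 + Q i ^+ 2) / (2 * m%:R))); last by ring.
  exact: ler_wpM2l.
have e4 : 0 < e / 4 by lra.
have e40 : 0 < e / 4 * H%:R by rewrite mulr_gt0// ltr0n /H expn_gt0 m0.
have [N1 HN1] := S1 _ e40.
have [N2 HN2] := S2 _ e40.
exists (maxn N1 N2) => n; rewrite geq_max => /andP[/HN1 h1 /HN2 h2].
pose B n := \sum_(i < n) om i * (c i * P i + s i * Q i).
have HE : \sum_(j < H) (A n - \sum_(i < n) om i *
    (c i * cos (j%:R * (t * kap i)) + s i * sin (j%:R * (t * kap i)))) = H%:R * A n - B n.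
  rewrite sumrB sumr_const card_ord mulr_natl; congr (_ - _).
  rewrite exchange_big/=; apply: eq_bigr => i _.
  by rewrite -mulr_sumr big_split/= -!mulr_sumr.
have H2E : \sum_(j < H) \sum_(l < H)
    (\sum_(i < n) om i * cos ((j%:R - l%:R) * t * kap i) - (j == l :> nat)%:R * L n) =
    \sum_(i < n) om i * (P i ^+ 2 + Q i ^+ 2) - H%:R * L n.
  have -> : \sum_(i < n) om i * (P i ^+ 2 + Q i ^+ 2) = \sum_(j < H) \sum_(l < H)
      \sum_(i < n) om i * cos ((j%:R - l%:R) * t * kap i).
    under eq_bigr do rewrite PQ mulr_sumr.
    rewrite exchange_big/=; apply: eq_bigr => j _.
    under eq_bigr do rewrite mulr_sumr.
    by rewrite exchange_big.
  under eq_bigr do rewrite sumrB; rewrite sumrB; congr (_ - _).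
  rewrite (eq_bigr (fun=> L n)); first by rewrite sumr_const card_ord mulr_natl.
  move=> j _; rewrite (bigD1 j)//= eqxx mul1r big1 ?addr0// => l.
  by rewrite -val_eqE /= eq_sym => /negbTE ->; rewrite mul0r.
move: h1 h2 (BS n); rewrite HE H2E -/(B n).
set G := \sum_(i < n) om i * _; set Ln := L n.
have L0 : 0 <= Ln := clock_ge0 F0 hi0 n.
have Hm : H%:R = m%:R * m%:R :> R by rewrite /H natrX expr2.
have H0 : 0 < H%:R :> R by rewrite Hm mulr_gt0.
move=> h1 h2 h3.
have GH : G / (2 * m%:R) <= m%:R / 2 * Ln + e / 8 * H%:R * Ln.
  rewrite ler_pdivrMr ?mulr_gt0//.
  have : G <= H%:R * Ln + e / 4 * H%:R * Ln by move: h2; rewrite ler_norml; lra.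
  move=> /le_trans; apply.
  have -> : (m%:R / 2 * Ln + e / 8 * H%:R * Ln) * (2 * m%:R) =
    H%:R * Ln + e / 4 * H%:R * Ln * m%:R by rewrite Hm; field.
  rewrite lerD2l ler_peMr ?ler1n// mulr_ge0//.
  by rewrite mulr_ge0 ?ltW.
have mH : m%:R * Ln <= e / 2 * H%:R * Ln.
  have em : 1 <= e / 2 * m%:R by rewrite -ler_pdivrMr// mul1r.
  by rewrite ler_wpM2r// Hm mulrA ler_peMl// ltW.
have eHL : 0 <= e * H%:R * Ln by rewrite mulr_ge0// mulr_ge0 ?(ltW e0) ?(ltW H0).
have : H%:R * `|A n| <= H%:R * (e * Ln).
  rewrite -[X in X * _](ger0_norm (ltW H0)) -normrM.
  rewrite -(subrK (B n) (H%:R * A n)) (le_trans (ler_normD _ _))//.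
  have -> : H%:R * (e * Ln) = e * H%:R * Ln by ring.
  by lra.
by rewrite ler_pM2l.
Qed.

End Oscillation.

(** * Motion between the sites: adiabatic invariant and rotation *)

Section FreeEvolution.
Context {R : realType}.
Implicit Types (x : R) (y dy : R -> R).
Variables (F E : R).
Hypothesis F0 : 0 < F.

Definition free y dy := [/\ forall x, isd y x (dy x), continuous dy &
  forall m, solves_in m (fun x => F * x + E) y dy].

Definition kx x : R := Num.sqrt (F * x + E).
Definition cx x : R := F / (2 * kx x ^+ 3).
(* The term [cx] removes the first-order oscillation of the adiabatic invariant. *)
Definition energy y dy x : R :=
  kx x * y x ^+ 2 + dy x ^+ 2 / kx x + cx x * (y x * dy x).
(** Far enough to the right that [kx >= 1] and [kx ^+ 3 >= F]. Then [cx <= 1 / 2], and the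
    correction term of the energy is dominated by the main part. *)
Definition deep x := 1 + F <= F * x + E.

Lemma deep_le x1 x2 : deep x1 -> x1 <= x2 -> deep x2.
Proof. by rewrite /deep => d1 x12; rewrite (le_trans d1)// lerD2r ler_pM2l. Qed.

Lemma kx_sqr x : deep x -> kx x ^+ 2 = F * x + E.
Proof. by rewrite /deep => dx; rewrite sqr_sqrtr//; move: F0; lra. Qed.

Lemma kx_ge1 x : deep x -> 1 <= kx x.
Proof.
rewrite /deep => dx; have dx0 : 0 <= F * x + E by move: F0; lra.
by rewrite -[leLHS]sqrtr1 ler_sqrt//; move: F0; lra.
Qed.

Lemma kx_gt0 x : deep x -> 0 < kx x.
Proof. by move=> /kx_ge1; lra. Qed.

Lemma kx_le x1 x2 : deep x1 -> x1 <= x2 -> kx x1 <= kx x2.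
Proof.
move=> d1 x12; have := deep_le d1 x12; rewrite /deep => d2.
have dx0 : 0 <= F * x2 + E by move: F0; lra.
by rewrite ler_sqrt// lerD2r ler_pM2l.
Qed.

Lemma kx3_ge x : deep x -> F <= kx x ^+ 3.
Proof.
move=> dx; have k1 := kx_ge1 dx; have k2 := kx_sqr dx.
rewrite exprS k2; have : F * x + E <= kx x * (F * x + E).
  by rewrite ler_peMl//; move: dx; rewrite /deep; move: F0; lra.
by move: dx; rewrite /deep; lra.
Qed.

Lemma cx_bound x : deep x -> 0 < cx x <= 2^-1.
Proof.
move=> dx; have k0 := kx_gt0 dx; have k3 := kx3_ge dx.
have k30 : 0 < 2 * kx x ^+ 3 by rewrite mulr_gt0// exprn_gt0.
by rewrite /cx divr_gt0//= ler_pdivrMr//; lra.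
Qed.

Lemma isd_kx x : deep x -> isd kx x (F / (2 * kx x)).
Proof.
move=> dx; apply: isd_eq; last first.
  apply: (isd_sqrt (g := fun x => F * x + E)); first by deriv.
  by move: dx; rewrite /deep; move: F0; lra.
have k0 := kx_gt0 dx; rewrite -/(kx x) /=; field; rewrite gt_eqF//.
Qed.

Definition dcx x : R := - 3 * F ^+ 2 / (4 * kx x ^+ 5).

Lemma isd_cx x : deep x -> isd cx x (dcx x).
Proof.
move=> dx; have k0 := kx_gt0 dx; have kd := isd_kx dx.
have nz : 2 * kx x ^+ 3 != 0 by rewrite mulf_neq0// expf_neq0// gt_eqF.
apply: isd_eq; last by rewrite /cx; deriv.
by rewrite /dcx /=; field; rewrite gt_eqF.
Qed.

Lemma dcx_le0 x : deep x -> dcx x <= 0.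
Proof.
move=> dx; have k0 := kx_gt0 dx; rewrite /dcx mulNr mulNr oppr_le0.
apply: divr_ge0; apply: mulr_ge0 => //; first exact: sqr_ge0.
by rewrite exprn_ge0// ltW.
Qed.

Definition size2 y dy x : R := kx x * y x ^+ 2 + dy x ^+ 2 / kx x.

Lemma prod_size2 y dy x : deep x -> `|y x * dy x| <= size2 y dy x / 2.
Proof.
move=> dx; have k0 := kx_gt0 dx.
have h (s : R) : s ^+ 2 = 1 -> s * (y x * dy x) <= size2 y dy x / 2.
  move=> s2; have := mulr_ge0 (sqr_ge0 (kx x * y x - s * dy x)) (_ : 0 <= (kx x)^-1).
  rewrite invr_ge0 ltW// => /(_ isT).
  rewrite (_ : _ * (kx x)^-1 = kx x * y x ^+ 2 + s ^+ 2 * dy x ^+ 2 / kx x - 2 * (s * (y x * dy x))).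
    by rewrite s2 /size2 mul1r; lra.
  by field; rewrite gt_eqF.
have s1 : (-1 : R) ^+ 2 = 1 by rewrite sqrrN expr1n.
have := h 1 (expr1n _ _); have := h (-1) s1.
by rewrite ler_norml mulN1r mul1r; lra.
Qed.

Lemma energy_size2 y dy x : deep x ->
  3 / 4 * size2 y dy x <= energy y dy x <= 5 / 4 * size2 y dy x.
Proof.
move=> dx; have := prod_size2 y dy dx; have /andP[c0 c1] := cx_bound dx.
have s0 : 0 <= size2 y dy x by have := le_trans (normr_ge0 _) (prod_size2 y dy dx); lra.
move=> p; have : `|cx x * (y x * dy x)| <= 2^-1 * (size2 y dy x / 2).
  by rewrite normrM (ger0_norm (ltW c0)) ler_pM// ltW.
by rewrite /energy -/(size2 y dy x) ler_norml; lra.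
Qed.

(** Since [(y y')' = y'^2 - k^2 y^2] and [cx = k' / k^2], the terms containing [k'] cancel, and only
    the derivative of [cx] remains. *)
Lemma energy_isd y dy m x : free y dy -> in_cell m x -> deep x ->
  isd (energy y dy) x (dcx x * (y x * dy x)).
Proof.
move=> [_ _ sol] xm dx; have [yd dyd] := sol m x xm.
have k0 := kx_gt0 dx; have kd := isd_kx dx; have cd := isd_cx dx.
have nz : kx x != 0 by rewrite gt_eqF.
apply: isd_eq; last by rewrite /energy; deriv.
by rewrite -(kx_sqr dx) /cx /=; field.
Qed.

Lemma energy_cont y dy x : free y dy -> deep x -> {for x, continuous (energy y dy)}.
Proof.
move=> [yd dyc _] dx; have k0 := kx_gt0 dx.
have kc : {for x, continuous kx} := isd_cont (isd_kx dx).
have cc : {for x, continuous cx} := isd_cont (isd_cx dx).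
have yc : {for x, continuous y} := isd_cont (yd x).
apply: cvgD; last by apply: cvgM => //; apply: cvgM => //; exact: dyc.
apply: cvgD; first by apply: cvgM => //; apply: (cvgM yc yc).
apply: cvgM; first by apply: (cvgM (dyc x) (dyc x)).
by apply: cvgV => //; rewrite gt_eqF.
Qed.

(** As [|y y'| <= energy] and [cx] decreases, the factors [exp (cx)] and [exp (- cx)] make the
    energy exactly monotone in opposite directions. Over many cells these factors telescope, so no
    error accumulates. *)
Lemma energy_mono y dy (m : nat) x1 x2 : free y dy -> deep m%:R ->
  m%:R <= x1 -> x1 <= x2 -> x2 <= m.+1%:R ->
  energy y dy x2 * expR (cx x2) <= energy y dy x1 * expR (cx x1) /\
  energy y dy x1 * expR (- cx x1) <= energy y dy x2 * expR (- cx x2).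
Proof.
move=> fr dm m1 x12 x2m.
have din x : x1 <= x <= x2 -> deep x.
  by move=> /andP[x1x _]; apply: deep_le dm _; exact: le_trans x1x.
have cell x : x1 < x < x2 -> in_cell m x.
  by move=> /andP[a b]; rewrite /in_cell (le_lt_trans m1 a) (lt_le_trans b x2m).
have dom x : deep x -> `|y x * dy x| <= energy y dy x.
  move=> dx; have := prod_size2 y dy dx; have /andP[] := energy_size2 y dy dx.
  by have := le_trans (normr_ge0 _) (prod_size2 y dy dx); lra.
split.
  apply: (isd_le (f := fun x => energy y dy x * expR (cx x))
    (df := fun x => dcx x * (y x * dy x + energy y dy x) * expR (cx x))) => //.
  - apply: continuous_in_subspaceT => x; rewrite inE/= in_itv/= => /din dx.
    apply: cvgM; first exact: energy_cont.
    by apply: (isd_cont (isd_exp (isd_cx dx))).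
  - move=> x xx; have dx : deep x by apply: din; move: xx; lra.
    have ed := energy_isd fr (cell _ xx) dx; have cd := isd_cx dx.
    by apply: isd_eq; last (apply: (isdM ed); exact: isd_exp cd); rewrite /=; ring.
  - move=> x xx; have dx : deep x by apply: din; move: xx; lra.
    rewrite -mulrA mulr_le0_ge0 ?dcx_le0// mulr_ge0 ?expR_ge0//.
    by have := dom _ dx; rewrite ler_norml; lra.
rewrite -lerN2.
apply: (isd_le (f := fun x => - (energy y dy x * expR (- cx x)))
  (df := fun x => - (dcx x * (y x * dy x - energy y dy x) * expR (- cx x)))) => //.
- apply: continuous_in_subspaceT => x; rewrite inE/= in_itv/= => /din dx.
  apply: cvgN; apply: cvgM; first exact: energy_cont.
  by apply: (isd_cont (isd_exp (isdN (isd_cx dx)))).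
- move=> x xx; have dx : deep x by apply: din; move: xx; lra.
  have ed := energy_isd fr (cell _ xx) dx; have cd := isd_cx dx.
  apply: isd_eq; last by apply: isdN; apply: (isdM ed); exact: isd_exp (isdN cd).
  by rewrite /=; ring.
- move=> x xx; have dx : deep x by apply: din; move: xx; lra.
  rewrite oppr_le0 mulr_ge0 ?expR_ge0// mulr_le0 ?dcx_le0//.
  by have := dom _ dx; rewrite ler_norml; lra.
Qed.

Lemma sqr_le_energy y dy (m : nat) x : free y dy -> deep m%:R ->
  m%:R <= x <= m.+1%:R ->
  `|y x| <= 2 / kx m%:R * Num.sqrt ((kx m%:R * y m%:R) ^+ 2 + dy m%:R ^+ 2).
Proof.
move=> fr dm /andP[mx xm].
have dx := deep_le dm mx.
have [h _] := energy_mono fr dm (lexx _) mx xm.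
have k0 := kx_gt0 dm; have kle := kx_le dm mx.
have /andP[l1 _] := energy_size2 y dy dx; have /andP[_ l2] := energy_size2 y dy dm.
have /andP[c0 c1] := cx_bound dm; have /andP[c0' _] := cx_bound dx.
have e1 : expR (cx m%:R) <= 2.
  apply: (@le_trans _ _ (expR 2^-1)); first by rewrite ler_expR.
  rewrite -[leLHS]invrK -expRN -[leRHS]invrK lef_pV2 ?posrE ?expR_gt0//.
  by have := expR_ge1Dx (- 2^-1 : R); lra.
have e2 : 1 <= expR (cx x) by rewrite -expR0 ler_expR ltW.
have en0 : 0 <= energy y dy x.
  have := le_trans (normr_ge0 _) (prod_size2 y dy dx); lra.
have en0' : 0 <= energy y dy m%:R.
  by have := le_trans (normr_ge0 _) (prod_size2 y dy dm); have /andP[] := energy_size2 y dy dm; lra.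
have h1 : energy y dy x <= energy y dy m%:R * 2.
  have : energy y dy x <= energy y dy x * expR (cx x) by rewrite ler_peMr.
  have : energy y dy m%:R * expR (cx m%:R) <= energy y dy m%:R * 2 by rewrite ler_wpM2l.
  lra.
set r2 := (kx m%:R * y m%:R) ^+ 2 + dy m%:R ^+ 2.
have r20 : 0 <= r2 by rewrite addr_ge0 ?sqr_ge0.
have sE : size2 y dy m%:R = r2 / kx m%:R.
  by rewrite /size2 /r2; field; rewrite gt_eqF.
have ky : kx m%:R * y x ^+ 2 <= size2 y dy x.
  rewrite /size2; have : kx m%:R * y x ^+ 2 <= kx x * y x ^+ 2 by rewrite ler_wpM2r// sqr_ge0.
  have : 0 <= dy x ^+ 2 / kx x by rewrite divr_ge0 ?sqr_ge0// ltW// kx_gt0.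
  lra.
(* The losses are [4 / 3] and [5 / 4] between energy and [size2], and [2] along the cell; their
   product is below [4]. *)
have fin : kx m%:R * y x ^+ 2 <= 4 * (r2 / kx m%:R).
  have : 0 <= r2 / kx m%:R by rewrite divr_ge0// ltW.
  by move: l1 l2 h1 ky; rewrite sE; lra.
have b0 : 0 <= 2 / kx m%:R * Num.sqrt r2 by rewrite mulr_ge0 ?sqrtr_ge0// divr_ge0// ltW.
have : `|y x| ^+ 2 <= (2 / kx m%:R * Num.sqrt r2) ^+ 2.
  rewrite real_normK ?num_real// exprMn sqr_sqrtr//.
  have -> : (2 / kx m%:R) ^+ 2 * r2 = 4 * (r2 / kx m%:R) / kx m%:R.
    by field; rewrite gt_eqF.
  by rewrite ler_pdivlMr// mulrC.
by rewrite ler_sqr ?nnegrE.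
Qed.

Lemma rotation y dy (m : nat) : free y dy -> deep m%:R ->
  let k := kx m%:R in
  let r := Num.sqrt ((k * y m%:R) ^+ 2 + dy m%:R ^+ 2) in
  `|kx m.+1%:R * y m.+1%:R - (k * y m%:R * cos k + dy m%:R * sin k)| <= 6 * F * r / k /\
  `|dy m.+1%:R - (dy m%:R * cos k - k * y m%:R * sin k)| <= 4 * F * r / k.
Proof.
move=> fr dm k r; have k0 : 0 < k := kx_gt0 dm; have k1 : 1 <= k := kx_ge1 dm.
have mm1 : m%:R <= m.+1%:R :> R by rewrite ler_nat leqnSn.
have r0 : 0 <= r by exact: sqrtr_ge0.
have k2 : k ^+ 2 = F * m%:R + E by exact: kx_sqr.
have mS : m.+1%:R = m%:R + 1 :> R by rewrite natr1.
have yb x : m%:R <= x <= m.+1%:R -> `|y x| <= 2 / k * r by exact: sqr_le_energy.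
pose ph x := k * (x - m%:R).
pose U x := k * y x * cos (ph x) - dy x * sin (ph x).
pose V x := k * y x * sin (ph x) + dy x * cos (ph x).
have [yd dyc sol] := fr.
have phc x : {for x, continuous ph} by apply: (isd_cont (a := k * (1 - 0))); rewrite /ph; apply: isd_eq; last deriv; rewrite /=; ring.
have cosc x : {for x, continuous (fun x => cos (ph x))}.
  by apply: (isd_cont); rewrite /ph; deriv.
have sinc x : {for x, continuous (fun x => sin (ph x))}.
  by apply: (isd_cont); rewrite /ph; deriv.
have yc x : {for x, continuous y} := isd_cont (yd x).
have Uc : continuous U.
  move=> x; apply: cvgB; apply: cvgM; [|exact: cosc|exact: dyc|exact: sinc].
  by apply: cvgM; [exact: cvg_cst|exact: yc].
have Vc : continuous V.
  move=> x; apply: cvgD; apply: cvgM; [|exact: sinc|exact: dyc|exact: cosc].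
  by apply: cvgM; [exact: cvg_cst|exact: yc].
have key (f : R -> R) (tr : R -> R) : continuous f ->
    (forall x, in_cell m x -> isd f x (F * (x - m%:R) * y x * tr x)) ->
    (forall x, `|tr x| <= 1) -> `|f m.+1%:R - f m%:R| <= 2 * F * r / k.
  move=> fc fd tr1.
  have := isd_lip (f := f) (df := fun x => F * (x - m%:R) * y x * tr x) (M := 2 * F * r / k) mm1.
  rewrite mS addrAC subrr add0r mulr1 -mS; apply.
  - exact: continuous_subspaceT.
  - exact: fd.
  - move=> x /andP[mx xm]; rewrite normrM -[leRHS]mulr1 ler_pM// normrM.
    have -> : 2 * F * r / k = F * (2 / k * r) by ring.
    have xm0 : 0 <= x - m%:R by rewrite subr_ge0 ltW.
    have fx : `|F * (x - m%:R)| <= F.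
      rewrite ger0_norm ?mulr_ge0 ?(ltW F0)// ler_piMr ?(ltW F0)//.
      by move: xm; rewrite mS; lra.
    by rewrite ler_pM// yb// (ltW mx) (ltW xm).
have dU : `|U m.+1%:R - U m%:R| <= 2 * F * r / k.
  apply: (key U (fun x => sin (ph x))) => // [x xm|x]; last exact: norm_sin_le1.
  have [y1 y2] := sol m x xm.
  apply: isd_eq; last by rewrite /U /ph; deriv.
  rewrite /ph /=; have -> : F * x + E = k ^+ 2 + F * (x - m%:R) by rewrite k2; ring.
  ring.
have dV : `|V m.+1%:R - V m%:R| <= 2 * F * r / k.
  apply: (key V (fun x => - cos (ph x))) => // [x xm|x]; last by rewrite normrN norm_cos_le1.
  have [y1 y2] := sol m x xm.
  apply: isd_eq; last by rewrite /V /ph; deriv.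
  rewrite /ph /=; have -> : F * x + E = k ^+ 2 + F * (x - m%:R) by rewrite k2; ring.
  ring.
have Um : U m%:R = k * y m%:R by rewrite /U /ph subrr mulr0 cos0 sin0; ring.
have Vm : V m%:R = dy m%:R by rewrite /V /ph subrr mulr0 cos0 sin0; ring.
have ph1 : ph m.+1%:R = k by rewrite /ph mS; ring.
have cs : cos k ^+ 2 + sin k ^+ 2 = 1 by exact: cos2Dsin2.
have c1 := norm_cos_le1 k; have s1 := norm_sin_le1 k.
pose M := 2 * F * r / k.
have M0 : 0 <= M by rewrite divr_ge0 ?mulr_ge0 ?(ltW F0)// ltW.
have E1 : `|k * y m.+1%:R - (k * y m%:R * cos k + dy m%:R * sin k)| <= 2 * M.
  have -> : k * y m.+1%:R - (k * y m%:R * cos k + dy m%:R * sin k) =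
      (U m.+1%:R - U m%:R) * cos k + (V m.+1%:R - V m%:R) * sin k.
    rewrite Um Vm /U /V ph1; apply/subr0_eq.
    transitivity (k * y m.+1%:R * (1 - (cos k ^+ 2 + sin k ^+ 2))); first ring.
    by rewrite cs subrr mulr0.
  rewrite (le_trans (ler_normD _ _))// !normrM mulr_natl mulr2n lerD//.
    by rewrite -[leRHS]mulr1 ler_pM.
  by rewrite -[leRHS]mulr1 ler_pM.
have E2 : `|dy m.+1%:R - (dy m%:R * cos k - k * y m%:R * sin k)| <= 2 * M.
  have -> : dy m.+1%:R - (dy m%:R * cos k - k * y m%:R * sin k) =
      (V m.+1%:R - V m%:R) * cos k - (U m.+1%:R - U m%:R) * sin k.
    rewrite Um Vm /U /V ph1; apply/subr0_eq.
    transitivity (dy m.+1%:R * (1 - (cos k ^+ 2 + sin k ^+ 2))); first ring.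
    by rewrite cs subrr mulr0.
  rewrite (le_trans (ler_normB _ _))// !normrM mulr_natl mulr2n lerD//.
    by rewrite -[leRHS]mulr1 ler_pM.
  by rewrite -[leRHS]mulr1 ler_pM.
have M2 : 2 * M = 4 * F * r / k by rewrite /M; ring.
split; last by rewrite -M2.
have d1 := deep_le dm mm1; have kk := kx_le dm mm1.
have kS : (kx m.+1%:R - k) * (kx m.+1%:R + k) = F.
  by rewrite -subr_sqr k2 (kx_sqr d1) mS; ring.
have kd : `|kx m.+1%:R - k| <= F.
  rewrite ger0_norm ?subr_ge0// -[leRHS]kS ler_peMr ?subr_ge0//.
  by have := kx_ge1 d1; lra.
have E3 : `|(kx m.+1%:R - k) * y m.+1%:R| <= M.
  rewrite normrM /M (_ : 2 * F * r / k = F * (2 / k * r)); last by ring.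
  by rewrite ler_pM// yb// mm1 lexx.
have -> : 6 * F * r / k = M + 2 * M by rewrite /M; ring.
rewrite (_ : _ - _ = (kx m.+1%:R - k) * y m.+1%:R +
  (k * y m.+1%:R - (k * y m%:R * cos k + dy m%:R * sin k))); last by ring.
by rewrite (le_trans (ler_normD _ _))// lerD.
Qed.

End FreeEvolution.

(** * Pathwise growth of the energy *)

Section Growth.
Context {R : realType}.
Variables (F E : R) (i0 : nat).
Hypothesis F0 : 0 < F.
Hypothesis hi0 : forall i, (i0 <= i)%N -> 1 + F <= freq2 F E i.

Local Notation kap := (freq F E).
Local Notation om := (wgt F E i0).
Local Notation L := (clock F E i0).

Lemma norm2_lip (x y u v : R) :
  `|Num.sqrt (x ^+ 2 + y ^+ 2) - Num.sqrt (u ^+ 2 + v ^+ 2)| <= `|x - u| + `|y - v|.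
Proof.
have key : forall x y u v : R, Num.sqrt (x ^+ 2 + y ^+ 2) <=
    Num.sqrt (u ^+ 2 + v ^+ 2) + (`|x - u| + `|y - v|).
  move=> {}x {}y {}u {}v.
  set s := Num.sqrt (u ^+ 2 + v ^+ 2).
  have s0 : 0 <= s by exact: sqrtr_ge0.
  have s2 : s ^+ 2 = u ^+ 2 + v ^+ 2 by rewrite sqr_sqrtr// addr_ge0 ?sqr_ge0.
  have us : `|u| <= s by rewrite -[`|u|]sqrtr_sqr ler_sqrt ?addr_ge0 ?sqr_ge0// lerDl sqr_ge0.
  have vs : `|v| <= s by rewrite -[`|v|]sqrtr_sqr ler_sqrt ?addr_ge0 ?sqr_ge0// lerDr sqr_ge0.
  set e := x - u; set f := y - v.
  have ef0 : 0 <= s + (`|e| + `|f|) by rewrite !addr_ge0.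
  rewrite -[leRHS](ger0_norm ef0) -sqrtr_sqr ler_sqrt ?sqr_ge0//.
  have -> : x ^+ 2 + y ^+ 2 = s ^+ 2 + 2 * (u * e) + 2 * (v * f) + (`|e| ^+ 2 + `|f| ^+ 2).
    by rewrite !real_normK ?num_real// s2 /e /f; ring.
  have : u * e <= s * `|e| by rewrite (le_trans (ler_norm _))// normrM ler_wpM2r.
  have : v * f <= s * `|f| by rewrite (le_trans (ler_norm _))// normrM ler_wpM2r.
  have : 0 <= `|e| * `|f| by rewrite mulr_ge0.
  by rewrite sqrrD sqrrD; lra.
rewrite ler_norml lerBlDl key andbT lerNl opprB lerBlDl.
by rewrite [`|x - u|]distrC [`|y - v|]distrC key.
Qed.

Variables (a b c gam : nat -> R) (lam : R).

(** Here [a], [b] and [c] stand for [k psi], [psi'] and [cx] just before the jump at the site, so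
    [rel * a] is the jump of [psi'] and [en] the energy before it. *)
Definition rad i := Num.sqrt (a i ^+ 2 + b i ^+ 2).
Definition rel i := gam i / kap i.
(* At each site [en] is multiplied by [1 + rel * sig + rel ^ 2 * frac] exactly; [hgt] is the
   coefficient of [rel ^ 2] in the logarithm of this factor, and its phase average is [1 / 4]. *)
Definition form i := a i ^+ 2 + b i ^+ 2 + c i * (a i * b i).
Definition sig i := (2 * (a i * b i) + c i * a i ^+ 2) / form i.
Definition frac i := a i ^+ 2 / form i.
Definition hgt i := frac i - sig i ^+ 2 / 2.
Definition en i := form i / kap i.

Hypothesis cb : forall i, (i0 <= i)%N -> 0 < c i <= 2^-1.
Hypothesis cF : forall i, (i0 <= i)%N -> c i <= F / kap i.
Hypothesis r0 : forall i, (i0 <= i)%N -> 0 < a i ^+ 2 + b i ^+ 2.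
Hypothesis rot : forall i, (i0 <= i)%N ->
  let r := Num.sqrt (a i ^+ 2 + (b i + rel i * a i) ^+ 2) in
  `|a i.+1 - (a i * cos (kap i) + (b i + rel i * a i) * sin (kap i))| <= 6 * F * r / kap i /\
  `|b i.+1 - ((b i + rel i * a i) * cos (kap i) - a i * sin (kap i))| <= 4 * F * r / kap i.
Hypothesis step : forall i, (i0 <= i)%N ->
  en i * (1 + rel i * sig i + rel i ^+ 2 * frac i) * expR (- c i) <= en i.+1 * expR (- c i.+1).
Hypothesis rel0 : to0 rel.

Lemma form_ge i : (i0 <= i)%N -> 3 / 4 * (a i ^+ 2 + b i ^+ 2) <= form i.
Proof.
move=> ii; have /andP[c0 c1] := cb ii; have s0 := r0 ii.
have : `|c i * (a i * b i)| <= 2^-1 * ((a i ^+ 2 + b i ^+ 2) / 2).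
  rewrite normrM (ger0_norm (ltW c0)) ler_pM ?(ltW c0)//.
  by have := sqr_ge0 (a i - b i); have := sqr_ge0 (a i + b i);
    rewrite sqrrB sqrrD ler_norml; lra.
by rewrite /form ler_norml; lra.
Qed.

Lemma form_gt0 i : (i0 <= i)%N -> 0 < form i.
Proof. by move=> ii; have := form_ge ii; have := r0 ii; lra. Qed.

Lemma en_gt0 i : (i0 <= i)%N -> 0 < en i.
Proof. by move=> ii; rewrite divr_gt0 ?form_gt0// (freq_gt0 F0 hi0 ii). Qed.

Lemma frac_bound i : (i0 <= i)%N -> 0 <= frac i <= 2.
Proof.
move=> ii; have f0 := form_gt0 ii; have := form_ge ii.
rewrite /frac divr_ge0 ?sqr_ge0 ?(ltW f0)//= ler_pdivrMr//.
by have := sqr_ge0 (a i); have := sqr_ge0 (b i); lra.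
Qed.

Lemma sig_bound i : (i0 <= i)%N -> `|sig i| <= 2.
Proof.
move=> ii; have f0 := form_gt0 ii; have fg := form_ge ii; have /andP[c0 c1] := cb ii.
rewrite /sig normrM normfV (gtr0_norm f0) ler_pdivrMr//.
have : 0 <= c i * a i ^+ 2 <= 2^-1 * a i ^+ 2.
  by rewrite mulr_ge0 ?sqr_ge0 ?(ltW c0)//= ler_wpM2r ?sqr_ge0.
have := sqr_ge0 (a i - b i); have := sqr_ge0 (a i + b i); have := sqr_ge0 (b i).
by rewrite sqrrB sqrrD ler_norml; lra.
Qed.

(** The default [(1, 0)] below [i0] keeps the pair [(ucos, usin)] on the unit circle at every
    index. *)
Definition ucos i := if (i < i0)%N then 1 else a i / rad i.
Definition usin i := if (i < i0)%N then 0 else b i / rad i.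

Lemma rad_gt0 i : (i0 <= i)%N -> 0 < rad i.
Proof. by move=> ii; rewrite sqrtr_gt0 r0. Qed.

Lemma rad_sqr i : (i0 <= i)%N -> rad i ^+ 2 = a i ^+ 2 + b i ^+ 2.
Proof. by move=> ii; rewrite sqr_sqrtr// ltW// r0. Qed.

(** Relative to [rad], the jump moves [(a, b)] by at most [|rel|], and the free motion is a rotation
    by [kap] up to [12 F / kap]. Both errors vanish, and normalising at most triples them. *)
Lemma phase_follows : follows F E 1 ucos usin.
Proof.
have unit i : ucos i ^+ 2 + usin i ^+ 2 = 1.
  rewrite /ucos /usin; case: ltnP => ii; first by rewrite expr1n expr0n addr0.
  rewrite !expr_div_n -mulrDl -rad_sqr// divff// expf_neq0// gt_eqF// rad_gt0//.
have [N1 HN1] := rel0 ltr01.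
pose dl i := `|rel i| + 12 * F * `|(kap i)^-1|.
have dl0 : to0 dl.
  have h0 : to0 (fun i => 12 * F * (kap i)^-1).
    by apply: (to0_le (N0 := 0%N) (K := `|12 * F|) (freqV_to0 F0 hi0)) => i _; rewrite normrM.
  apply: (to0_ext (N0 := 0%N) (to0D rel0 h0)) => i _.
  by rewrite /dl [X in _ = _ + X]normrM (ger0_norm (_ : 0 <= 12 * F))// mulr_ge0// ltW.
have main i : (maxn i0 N1 <= i)%N ->
    `|ucos i.+1 - (ucos i * cos (1 * kap i) + usin i * sin (1 * kap i))| <= 3 * `|dl i| /\
    `|usin i.+1 - (usin i * cos (1 * kap i) - ucos i * sin (1 * kap i))| <= 3 * `|dl i|.
  rewrite geq_max => /andP[ii /HN1 X1].
  have iS : (i0 <= i.+1)%N by rewrite (leq_trans ii).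
  rewrite /ucos /usin !ltnNge ii iS /= mul1r.
  have q0 := rad_gt0 ii; have q1 := rad_gt0 iS; have k0 := freq_gt0 F0 hi0 ii.
  have ar : `|a i| <= rad i.
    rewrite -[`|a i|]sqrtr_sqr ler_sqrt ?(ltW (r0 ii))//.
    by rewrite lerDl sqr_ge0.
  have aS : `|a i.+1| <= rad i.+1.
    rewrite -[`|a i.+1|]sqrtr_sqr ler_sqrt ?(ltW (r0 iS))//.
    by rewrite lerDl sqr_ge0.
  have bS : `|b i.+1| <= rad i.+1.
    rewrite -[`|b i.+1|]sqrtr_sqr ler_sqrt ?(ltW (r0 iS))//.
    by rewrite lerDr sqr_ge0.
  set A := a i * cos (kap i) + b i * sin (kap i).
  set B := b i * cos (kap i) - a i * sin (kap i).
  have [] := rot ii; set rp := Num.sqrt _ => ra rb.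
  have rp2 : rp <= 2 * rad i.
    have := norm2_lip (a i) (b i + rel i * a i) (a i) (b i).
    rewrite -/rp -/(rad i) subrr normr0 add0r addrAC subrr add0r normrM.
    have : `|rel i| * `|a i| <= rad i by rewrite -[leRHS]mul1r ler_pM.
    by rewrite ler_norml; lra.
  have rk : 6 * F * rp / kap i <= 12 * F * `|(kap i)^-1| * rad i.
    rewrite (ger0_norm (_ : 0 <= (kap i)^-1)); last by rewrite invr_ge0 ltW.
    have -> : 12 * F * (kap i)^-1 * rad i = 6 * F * (kap i)^-1 * (2 * rad i) by ring.
    by rewrite mulrAC ler_wpM2l// mulr_ge0 ?invr_ge0 ?(ltW k0)// mulr_ge0// ltW.
  have rk' : 4 * F * rp / kap i <= 6 * F * rp / kap i.
    rewrite ler_wpM2r ?invr_ge0 ?(ltW k0)// ler_wpM2r ?sqrtr_ge0// ler_wpM2r ?(ltW F0)//.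
    lra.
  have Xa : `|rel i * a i| <= `|rel i| * rad i by rewrite normrM ler_wpM2l.
  have dA : `|a i.+1 - A| <= dl i * rad i.
    rewrite (_ : a i.+1 - A = (a i.+1 - (a i * cos (kap i) + (b i + rel i * a i) * sin (kap i)))
      + rel i * a i * sin (kap i)); last by rewrite /A; ring.
    rewrite (le_trans (ler_normD _ _))// /dl [leRHS]mulrDl.
    have : `|rel i * a i * sin (kap i)| <= `|rel i| * rad i.
      by rewrite normrM (le_trans _ Xa)// ler_piMr// norm_sin_le1.
    by have := le_trans ra rk; lra.
  have dB : `|b i.+1 - B| <= dl i * rad i.
    rewrite (_ : b i.+1 - B = (b i.+1 - ((b i + rel i * a i) * cos (kap i) - a i * sin (kap i)))
      + rel i * a i * cos (kap i)); last by rewrite /B; ring.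
    rewrite (le_trans (ler_normD _ _))// /dl [leRHS]mulrDl.
    have : `|rel i * a i * cos (kap i)| <= `|rel i| * rad i.
      by rewrite normrM (le_trans _ Xa)// ler_piMr// norm_cos_le1.
    by have := le_trans rb (le_trans rk' rk); lra.
  have rAB : Num.sqrt (A ^+ 2 + B ^+ 2) = rad i.
    congr Num.sqrt; have := cos2Dsin2 (kap i) => cs.
    transitivity ((a i ^+ 2 + b i ^+ 2) * (cos (kap i) ^+ 2 + sin (kap i) ^+ 2)).
      by rewrite /A /B; ring.
    by rewrite cs mulr1.
  have dr : `|rad i.+1 - rad i| <= 2 * dl i * rad i.
    by have := norm2_lip (a i.+1) (b i.+1) A B; rewrite -/(rad i.+1) rAB; lra.
  have dl_ge0 : 0 <= dl i by rewrite addr_ge0// mulr_ge0// mulr_ge0// ltW.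
  have fin (t t' : R) : `|t'| <= rad i.+1 -> `|t' - t| <= dl i * rad i ->
      `|t' / rad i.+1 - t / rad i| <= 3 * dl i.
    move=> t'r tt; rewrite (_ : _ - _ = (t' - t) / rad i - t' / rad i.+1 * ((rad i.+1 - rad i) / rad i)); last first.
      by field; rewrite !gt_eqF.
    rewrite (le_trans (ler_normB _ _))// !normrM !normfV (gtr0_norm q0) (gtr0_norm q1).
    have h1 : `|t' - t| / rad i <= dl i by rewrite ler_pdivrMr.
    have h2 : `|rad i.+1 - rad i| / rad i <= 2 * dl i by rewrite ler_pdivrMr.
    have h3 : `|t'| / rad i.+1 <= 1 by rewrite ler_pdivrMr// mul1r.
    have : `|t'| / rad i.+1 * (`|rad i.+1 - rad i| / rad i) <= 1 * (2 * dl i).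
      by rewrite ler_pM// divr_ge0// ltW.
    lra.
  rewrite (ger0_norm dl_ge0); split.
    have -> : a i / rad i * cos (kap i) + b i / rad i * sin (kap i) = A / rad i.
      by rewrite /A; ring.
    exact: fin.
  have -> : b i / rad i * cos (kap i) - a i / rad i * sin (kap i) = B / rad i.
    by rewrite /B; ring.
  exact: fin.
split=> //.
  by apply: (to0_le (N0 := maxn i0 N1) (K := 3) dl0) => i /main[].
by apply: (to0_le (N0 := maxn i0 N1) (K := 3) dl0) => i /main[].
Qed.

(** At [c = 0] one has [frac = u^2] and [sig = 2 u v], and the trigonometric expression is exact.
    The correction is linear in [c], which is at most [F / kap]. *)
Lemma hgt_phase i : (i0 <= i)%N ->
  `|hgt i - (ucos i ^+ 2 - 2 * ucos i ^+ 2 * usin i ^+ 2)| <= 10 * F * `|(kap i)^-1|.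
Proof.
move=> ii; have q0 := rad_gt0 ii; have k0 := freq_gt0 F0 hi0 ii.
have /andP[c0 c1] := cb ii; have f0 := form_gt0 ii; have r2 := rad_sqr ii.
have [fu _ _] := phase_follows; have [u1 v1] := unit_le1 (fu i); have := fu i.
rewrite /ucos /usin ltnNge ii /= in u1 v1 *.
set u := a i / rad i in u1 *; set v := b i / rad i in v1 *; move=> uv.
have aE : a i = u * rad i by rewrite /u divfK// gt_eqF.
have bE : b i = v * rad i by rewrite /v divfK// gt_eqF.
pose g := 1 + c i * (u * v).
have fE : form i = rad i ^+ 2 * g.
  by rewrite /form -r2 aE bE /g; ring.
have g0 : 3 / 4 <= g.
  by have := form_ge ii; rewrite fE -r2 mulrC ler_pM2l// exprn_gt0.
have gn0 : g != 0 by rewrite gt_eqF//; lra.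
have rn0 : rad i != 0 by rewrite gt_eqF.
have uv1 : `|u * v| <= 1 by rewrite normrM -[leRHS]mulr1 ler_pM.
have u21 : 0 <= u ^+ 2 <= 1 by have := sqr_ge0 u; have := sqr_ge0 v; lra.
have gle (t : R) : `|t| <= 3 * c i -> `|t / g| <= 4 * c i.
  move=> tc; rewrite normrM normfV (ger0_norm (_ : 0 <= g)); last lra.
  rewrite ler_pdivrMr; last lra.
  have : 4 * c i * (3 / 4) <= 4 * c i * g by rewrite ler_wpM2l// mulr_ge0// ltW.
  lra.
have cuv : `|c i * (u * v)| <= c i.
  by rewrite normrM (ger0_norm (ltW c0)) ler_piMr// ltW.
have pE : frac i = u ^+ 2 - u ^+ 2 * (c i * (u * v)) / g.
  by rewrite /frac fE aE /g; rewrite /g in gn0; field; rewrite gn0 rn0.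
have sE : sig i = 2 * (u * v) + (c i * u ^+ 2 - 2 * (u * v) * (c i * (u * v))) / g.
  by rewrite /sig fE aE bE /g; rewrite /g in gn0; field; rewrite gn0 rn0.
have ds : `|sig i - 2 * (u * v)| <= 4 * c i.
  rewrite sE addrAC subrr add0r; apply: gle.
  rewrite (le_trans (ler_normB _ _))//.
  have : `|c i * u ^+ 2| <= c i.
    case/andP: u21 => u20 u21; rewrite normrM (ger0_norm (ltW c0)) (ger0_norm u20).
    by rewrite ler_piMr// ltW.
  have : `|2 * (u * v) * (c i * (u * v))| <= 2 * c i.
    rewrite normrM ler_pM//.
    by rewrite normrM ger0_norm//; lra.
  lra.
have d2 : `|sig i ^+ 2 / 2 - 2 * u ^+ 2 * v ^+ 2| <= 8 * c i.
  have -> : sig i ^+ 2 / 2 - 2 * u ^+ 2 * v ^+ 2 =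
      (sig i - 2 * (u * v)) * ((sig i + 2 * (u * v)) / 2) by field.
  have : `|(sig i + 2 * (u * v)) / 2| <= 2.
    rewrite normrM (ger0_norm (_ : 0 <= 2^-1))// ler_pdivrMr//.
    rewrite (le_trans (ler_normD _ _))// [`|2 * _|]normrM (ger0_norm (_ : 0 <= 2))//.
    by have := sig_bound ii; lra.
  move=> h; rewrite normrM; have -> : 8 * c i = 4 * c i * 2 by ring.
  by rewrite ler_pM.
have cFk : 10 * c i <= 10 * F * `|(kap i)^-1|.
  rewrite -mulrA ler_wpM2l// ger0_norm ?invr_ge0 ?(ltW k0)//.
  exact: cF.
apply: le_trans cFk; rewrite /hgt (_ : _ - _ = frac i - u ^+ 2 - (sig i ^+ 2 / 2 - 2 * u ^+ 2 * v ^+ 2)); last by ring.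
rewrite (le_trans (ler_normB _ _))//.
have : `|frac i - u ^+ 2| <= 2 * c i.
  rewrite pE addrAC subrr add0r normrN normrM normfV (ger0_norm (_ : 0 <= g)); last lra.
  rewrite ler_pdivrMr; last lra.
  have : 2 * c i * (3 / 4) <= 2 * c i * g by rewrite ler_wpM2l// mulr_ge0// ltW.
  have : `|u ^+ 2 * (c i * (u * v))| <= 1 * c i.
    by rewrite normrM (ger0_norm (sqr_ge0 u)); case/andP: u21 => ? ?; rewrite ler_pM.
  move: c0; lra.
lra.
Qed.

(** In terms of the phase, [cos^2 - 2 cos^2 sin^2] equals [1 / 4 + cos (2 theta) / 2 + cos (4 theta)
    / 4]; the two harmonics follow [2] and [4] times the frequency and average out. *)
Lemma hgt_avg : small L (fun n => \sum_(i < n) om i * (hgt i - 4^-1)).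
Proof.
have fo := phase_follows; have fo2 := follows_double fo; have fo4 := follows_double fo2.
have n2 : (2 * 1 : R) != 0 by rewrite gt_eqF//; lra.
have n4 : (2 * (2 * 1) : R) != 0 by rewrite gt_eqF//; lra.
have s2 := smallZ 2^-1 (small_follows F0 hi0 n2 fo2).
have s4 := smallZ 4^-1 (small_follows F0 hi0 n4 fo4).
pose err i := hgt i - (ucos i ^+ 2 - 2 * ucos i ^+ 2 * usin i ^+ 2).
have se : small L (fun n => \sum_(i < n) om i * err i).
  apply: (@small_wgt R F E i0 F0 hi0 (fun i => 10 * F * `|(kap i)^-1|) (fun i => om i * err i) i0).
    apply: (to0_le (N0 := 0%N) (K := `|10 * F|) (freqV_to0 F0 hi0)) => i _.
    by rewrite normrM normr_id.
  move=> i ii; rewrite normrM (ger0_norm (wgt_ge0 F0 hi0 i)) ler_wpM2l ?wgt_ge0//.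
  by rewrite (le_trans (hgt_phase ii)) ?ler_norm.
apply: (small_le (N0 := 0%N) (smallD se (smallD s2 s4))) => n _.
rewrite !mulr_sumr -!big_split/= [X in _ <= `|X|](eq_bigr (fun i : 'I_n => om i * (hgt i - 4^-1)))// => i _.
have [fu _ _] := fo; rewrite /err.
have uv : usin i ^+ 2 = 1 - ucos i ^+ 2 by have := fu i; lra.
have -> : (2 * ucos i * usin i) ^+ 2 = 4 * ucos i ^+ 2 * usin i ^+ 2 by ring.
by rewrite uv; field.
Qed.

(* The power [3 / 4] of the clock is [o(L)], while [om / damp ^ 2] is still summable. *)
Definition damp i := Num.sqrt (1 + L i.+1) * Num.sqrt (Num.sqrt (1 + L i.+1)).

Variables (B1 B2 B3 : R).
Hypothesis M1 : forall n, `|\sum_(i < n) (if (i < i0)%N then 0 else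
   sig i / (kap i * damp i) * gam i)| <= B1.
Hypothesis M2 : forall n, `|\sum_(i < n) om i * hgt i * (gam i ^+ 2 - lam ^+ 2)| <= B2.
Hypothesis M3 : forall n, `|\sum_(i < n) om i * (gam i ^+ 2 - lam ^+ 2)| <= B3.

Lemma damp_small : small L damp.
Proof.
move=> e e0; pose A := ((2 / e) ^+ 2) ^+ 2 + 2.
have [N HN] := clock_unbounded F0 hi0 A.
exists N => n /HN An; rewrite /damp; set s := Num.sqrt (1 + L n.+1).
have q0 : 0 <= 1 + L n.+1 by rewrite addr_ge0// clock_ge0.
have s2 : s ^+ 2 = 1 + L n.+1 by rewrite sqr_sqrtr.
have s0 : 0 <= s by exact: sqrtr_ge0.
have t0 : 0 <= Num.sqrt s by exact: sqrtr_ge0.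
have t2 : Num.sqrt s ^+ 2 = s by rewrite sqr_sqrtr.
set t := Num.sqrt s in t0 t2 *.
have LL : L n.+1 <= L n + 1 by rewrite clockS lerD2l wgt_le1.
have LL' : L n <= L n.+1 by rewrite clock_le.
have e2 : 0 <= 2 / e by rewrite divr_ge0// ltW.
have et : 2 / e <= t.
  rewrite -(@ler_sqr _ (2 / e)) ?nnegrE// t2 -ler_sqr ?nnegrE ?sqr_ge0// s2.
  by move: An; rewrite /A; lra.
rewrite ger0_norm ?mulr_ge0//.
have h2 : s * t * (2 / e) <= s ^+ 2.
  have -> : s ^+ 2 = s * t * t by rewrite -mulrA -expr2 t2 expr2.
  by rewrite ler_wpM2l// mulr_ge0.
have h3 : s ^+ 2 <= 2 * L n.
  rewrite s2; move: An; rewrite /A; have := sqr_ge0 ((2 / e) ^+ 2); lra.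
have : s * t * (2 / e) <= 2 * L n by lra.
rewrite mulrA ler_pdivrMr//; lra.
Qed.

Lemma damp_gt0 i : 0 < damp i.
Proof. by rewrite mulr_gt0// !sqrtr_gt0 ?sqrtr_gt0 ltr_wpDr// clock_ge0. Qed.

Lemma damp_le i : damp i <= damp i.+1.
Proof.
have LL : L i.+1 <= L i.+2 by rewrite clock_le.
have p : 0 <= 1 + L i.+2 by rewrite addr_ge0// clock_ge0.
by rewrite ler_pM ?sqrtr_ge0// ?ler_sqrt ?sqrtr_ge0// ?ler_sqrt// lerD2l.
Qed.

(** The martingale part: its damped version is bounded, so undoing the damping by Abel summation
    costs [O(damp) = o(L)]. *)
Lemma drift_small : small L (fun n => \sum_(i < n) (if (i < i0)%N then 0 else rel i * sig i)).
Proof.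
pose T n := \sum_(i < n) (if (i < i0)%N then 0 else sig i / (kap i * damp i) * gam i).
apply: (small_le (N0 := 0%N) (smallZ (2 * B1) damp_small)) => n _.
have h := abel_ndecr n (p := damp) (T := T) M1 (fun i => ltW (damp_gt0 i)) damp_le.
rewrite (_ : \sum_(i < n) _ = \sum_(i < n) damp i * (T i.+1 - T i)).
  by rewrite (le_trans h) ?ler_norm.
apply: eq_bigr => i _; rewrite /T.
rewrite big_ord_recr/= addrAC subrr add0r; case: ltnP => ii; first by rewrite mulr0.
have k0 := freq_gt0 F0 hi0 ii; have d0 := damp_gt0 i.
by rewrite /rel; field; rewrite !gt_eqF.
Qed.

Lemma curv_small : small L (fun n => \sum_(i < n) om i * gam i ^+ 2 * hgt i - lam ^+ 2 / 4 * L n).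
Proof.
have h1 := small_bnd F0 hi0 M2; have h2 := smallZ (lam ^+ 2) hgt_avg.
apply: (small_le (N0 := 0%N) (smallD h1 h2)) => n _.
rewrite [L n]/clock !mulr_sumr -sumrB -big_split/=.
rewrite [X in _ <= `|X|](eq_bigr (fun i : 'I_n => om i * gam i ^+ 2 * hgt i - lam ^+ 2 / 4 * om i))// => i _ /=.
by field.
Qed.

(** [gam ^+ 2] is not bounded pointwise, so the Cesàro argument runs with the weights
    [om * (gam ^+ 2 + 1)], whose sum is comparable with [L] by [M3]. *)
Lemma cube_small : small L (fun n => \sum_(i < n) om i * gam i ^+ 2 * `|rel i|).
Proof.
pose om' i := om i * (gam i ^+ 2 + 1).
pose L' n := \sum_(i < n) om' i.
have om0 := wgt_ge0 F0 hi0.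
have om'0 i : 0 <= om' i by rewrite mulr_ge0// addr_ge0// sqr_ge0.
have LL' m : L m <= L' m.
  apply: ler_sum => i _; rewrite /om' mulrDr mulr1 lerDr.
  by rewrite mulr_ge0 ?sqr_ge0 ?om0.
have L'L m : L' m <= (lam ^+ 2 + 1) * L m + B3.
  have -> : L' m = \sum_(i < m) om i * (gam i ^+ 2 - lam ^+ 2) + (lam ^+ 2 + 1) * L m.
    by rewrite mulr_sumr -big_split/=; apply: eq_bigr => i _; rewrite /om'; ring.
  by have := M3 m; rewrite ler_norml; lra.
have uL' : unbounded L'.
  move=> A; have [N HN] := clock_unbounded F0 hi0 A; exists N => m /HN h.
  exact: le_trans (LL' m).
have sm : small L' (fun n => \sum_(i < n) om i * gam i ^+ 2 * `|rel i|).
  apply: (@small_cesaro R om' rel (fun i => om i * gam i ^+ 2 * `|rel i|) L' 0%N) => // i _.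
  rewrite normrM normr_id ler_wpM2r// (ger0_norm (mulr_ge0 (om0 i) (sqr_ge0 (gam i)))).
  by rewrite ler_wpM2l// lerDl.
move=> e e0; have l2 : 0 < lam ^+ 2 + 2 by rewrite ltr_wpDl ?sqr_ge0.
have [N HN] := sm _ (divr_gt0 e0 l2); have [M HM] := clock_unbounded F0 hi0 B3.
exists (maxn N M) => n; rewrite geq_max => /andP[/HN h /HM h'].
rewrite (le_trans h)// mulrAC ler_pdivrMr// -[leRHS]mulrA ler_pM2l// [leRHS]mulrC.
by rewrite (le_trans (L'L n))//; lra.
Qed.

(** The second Taylor term of the logarithm contributes [- rel^2 sig^2 / 2], which turns [frac] into
    [hgt]. The rest is cubic in [rel] with coefficient at most [27 + 5], well below [100]. *)
Lemma log_increment i : (i0 <= i)%N -> `|rel i| <= 16^-1 ->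
  ln (en i) - c i + (rel i * sig i + rel i ^+ 2 * hgt i - 100 * (rel i ^+ 2 * `|rel i|))
    <= ln (en i.+1) - c i.+1.
Proof.
move=> ii X16; have iS : (i0 <= i.+1)%N by rewrite (leq_trans ii).
have sb := sig_bound ii; have /andP[p0 p2] := frac_bound ii.
set X := rel i in X16 *; set s := sig i in sb *; set p := frac i in p0 p2 *.
set x := `|X| in X16 *; have x0 : 0 <= x by exact: normr_ge0.
have X2 : X ^+ 2 = x ^+ 2 by rewrite real_normK ?num_real.
pose u := X * s + X ^+ 2 * p.
have x2x : x ^+ 2 <= x / 16 by rewrite expr2 ler_wpM2l.
have Xs : `|X * s| <= 2 * x by rewrite normrM mulrC ler_wpM2r.
have X2p : 0 <= X ^+ 2 * p <= 2 * x ^+ 2.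
  by rewrite mulr_ge0 ?sqr_ge0//= X2 mulrC ler_wpM2r ?sqr_ge0.
have u4 : `|u| <= 3 * x.
  by move: Xs; rewrite /u !ler_norml; lra.
have u2 : `|u| <= 2^-1 by lra.
have u_gt : 0 < 1 + u by move: u2; rewrite ler_norml; lra.
have lnu := ln1D_ge u2.
have u3 : `|u| ^+ 3 <= 27 * x ^+ 3.
  have -> : 27 * x ^+ 3 = (3 * x) ^+ 3 by ring.
  by rewrite lerXn2r// nnegrE mulr_ge0.
have usq : u ^+ 2 / 2 <= X ^+ 2 * s ^+ 2 / 2 + 5 * x ^+ 3.
  have -> : u ^+ 2 / 2 = X ^+ 2 * s ^+ 2 / 2 + (X * s) * (X ^+ 2 * p) + (X ^+ 2 * p) ^+ 2 / 2.
    by rewrite /u; field.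
  have : (X * s) * (X ^+ 2 * p) <= 2 * x * (2 * x ^+ 2).
    rewrite (le_trans (ler_norm _))// normrM ler_pM//.
    by case/andP: X2p => h1 h2; rewrite ger0_norm.
  have : (X ^+ 2 * p) ^+ 2 <= (2 * x ^+ 2) ^+ 2.
    by case/andP: X2p => h1 h2; rewrite ler_sqr ?nnegrE// mulr_ge0 ?sqr_ge0.
  have : x ^+ 2 * x ^+ 2 <= x ^+ 2 * (x / 16) by rewrite ler_wpM2l ?sqr_ge0.
  have : 0 <= x ^+ 3 by rewrite exprn_ge0.
  have -> : 2 * x * (2 * x ^+ 2) = 4 * x ^+ 3 by ring.
  have -> : (2 * x ^+ 2) ^+ 2 = 4 * (x ^+ 2 * x ^+ 2) by ring.
  have -> : x ^+ 2 * (x / 16) = x ^+ 3 / 16 by ring.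
  lra.
have main : X * s + X ^+ 2 * hgt i - 100 * (X ^+ 2 * x) <= ln (1 + u).
  apply: le_trans lnu; rewrite /hgt -/s -/p mulrBr.
  have -> : X ^+ 2 * x = x ^+ 3 by rewrite X2; ring.
  have : 0 <= x ^+ 3 by rewrite exprn_ge0.
  by move: u3 usq; rewrite /u mulrA; lra.
have e0 := en_gt0 ii; have e1 := en_gt0 iS.
have := step ii; rewrite -/X -/s -/p -[1 + _ + _]addrA -/u.
have p1 : 0 < en i * (1 + u) by rewrite mulr_gt0.
rewrite -ler_ln ?posrE ?(mulr_gt0 _ (expR_gt0 _))//.
rewrite [ln (_ * expR _)]lnM ?posrE ?expR_gt0// [ln (en i * _)]lnM ?posrE//.
by rewrite [ln (en i.+1 * _)]lnM ?posrE ?expR_gt0// !expRK; lra.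
Qed.

Lemma energy_growth e : 0 < e -> exists N, forall n, (N <= n)%N ->
  (lam ^+ 2 / 4 - e) * L n <= ln (en n).
Proof.
move=> e0; have X16 : 0 < (16^-1 : R) by lra.
have [N1 HN1] := rel0 X16; pose N0 := maxn i0 N1.
pose D i := (if (i < i0)%N then 0 else rel i * sig i) + om i * gam i ^+ 2 * hgt i
   - 100 * (om i * gam i ^+ 2 * `|rel i|).
(* Accounts for the finitely many indices below [N0], so that all sums may start at [0]. *)
pose C := ln (en N0) - c N0 - \sum_(i < N0) D i.
have key k : C + \sum_(i < N0 + k) D i <= ln (en (N0 + k)%N) - c (N0 + k)%N.
  elim: k => [|k IH]; first by rewrite addn0 /C subrK.
  have ii : (i0 <= N0 + k)%N by rewrite (leq_trans (leq_maxl i0 N1))// leq_addr.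
  have iN : (N1 <= N0 + k)%N by rewrite (leq_trans (leq_maxr i0 N1))// leq_addr.
  rewrite addnS big_ord_recr/= addrA (le_trans _ (log_increment ii (HN1 _ iN)))//.
  rewrite lerD// /D ltnNge ii /= (wgtE F0 hi0 ii).
  have -> : (kap (N0 + k)%N ^+ 2)^-1 * gam (N0 + k)%N ^+ 2 = rel (N0 + k)%N ^+ 2.
    by rewrite /rel exprMn exprVn mulrC.
  exact: lexx.
have sD : small L (fun n => \sum_(i < n) D i - lam ^+ 2 / 4 * L n + C).
  have h := smallD (smallD drift_small curv_small) (smallZ (-100) cube_small).
  have h' := smallD h (small_bnd F0 hi0 (s := fun=> C) (fun=> lexx `|C|)).
  apply: (small_le (N0 := 0%N) h') => n _ /=.
  rewrite (_ : \sum_(i < n) D i = \sum_(i < n) (if (i < i0)%N then 0 else rel i * sig i) +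
    \sum_(i < n) om i * gam i ^+ 2 * hgt i - 100 * \sum_(i < n) om i * gam i ^+ 2 * `|rel i|).
    by rewrite le_eqVlt; apply/orP; left; apply/eqP; congr `|_|; ring.
  by rewrite mulr_sumr -sumrN -!big_split; apply: eq_bigr.
have [N2 HN2] := sD _ e0; exists (maxn N0 N2) => n; rewrite geq_max => /andP[n0 /HN2].
have := key (n - N0)%N; rewrite subnKC//.
have /andP[cn0 _] : 0 < c n <= 2^-1 by apply: cb; rewrite (leq_trans _ n0)// leq_maxl.
by rewrite ler_norml mulrBl; lra.
Qed.

End Growth.

(** * Pathwise convergence of the ratio *)

Section RatioConvergence.
Context {R : realType}.

Lemma prefix_bound (f : nat -> R) N : exists2 K, 0 <= K & forall i, (i < N)%N -> `|f i| <= K.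
Proof.
exists (\sum_(i < N) `|f i|); first exact: sumr_ge0.
move=> i iN; rewrite (bigD1 (Ordinal iN))//= lerDl; exact: sumr_ge0.
Qed.

Lemma sum_bounded_eventually (f r : nat -> R) N B : (forall i, 0 <= r i) ->
  (forall i, (N <= i)%N -> `|f i| <= r i) -> (forall n, \sum_(i < n) r i <= B) ->
  exists2 B', 0 <= B' & forall n, `|\sum_(i < n) f i| <= B'.
Proof.
move=> r0 fr rB; have B0 : 0 <= B by have := rB 0%N; rewrite big_ord0.
exists (\sum_(i < N) `|f i| + B); first by rewrite addr_ge0 ?sumr_ge0.
move=> n; rewrite (le_trans (ler_norm_sum _ _ _))//.
have key m : \sum_(i < m) `|f i| <= \sum_(i < minn m N) `|f i| + \sum_(i < m) r i.
  elim: m => [|m IH]; first by rewrite min0n !big_ord0 addr0.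
  rewrite !big_ord_recr/=; have [mN|Nm] := ltnP m N.
    rewrite (minn_idPl mN) big_ord_recr/=; move: IH; rewrite (minn_idPl (ltnW mN)).
    by have := r0 m; lra.
  rewrite (minn_idPr (leqW Nm)); move: IH; rewrite (minn_idPr Nm).
  by have := fr _ Nm; lra.
apply: (le_trans (key n)); rewrite lerD//.
have mono m : (m <= N)%N -> \sum_(i < m) `|f i| <= \sum_(i < N) `|f i|.
  move=> mN; rewrite -(subnKC mN); elim: (N - m)%N => [|k IH]; first by rewrite addn0.
  by rewrite addnS big_ord_recr/= (le_trans IH)// lerDl.
by apply: mono; exact: geq_minr.
Qed.

Lemma cauchy_rate (x p : nat -> R) : to0 p ->
  (forall n m, (n <= m)%N -> `|x m - x n| <= p n) ->
  exists2 l, x @ \oo --> l & forall n, `|l - x n| <= p n.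
Proof.
move=> p0 xp; have cv : cvg (x @ \oo).
  apply/cauchy_cvgP/cauchy_exP => e e0.
  have e20 : 0 < e / 2 by lra.
  have [N HN] := p0 _ e20; exists (x N); exists N => // m /= Nm.
  rewrite /ball/= distrC (le_lt_trans (xp _ _ Nm))//.
  by have := HN N (leqnn N); rewrite ler_norml; lra.
exists (lim (x @ \oo)) => // n.
have cvd : (fun m => `|x m - x n|) @ \oo --> `|lim (x @ \oo) - x n|.
  by apply: cvg_norm; apply: cvgB => //; exact: cvg_cst.
apply: (cvgr_to_le cvd); exists n => // m /= nm; exact: xp.
Qed.

Variables (F E : R) (i0 : nat).
Hypothesis F0 : 0 < F.
Hypothesis hi0 : forall i, (i0 <= i)%N -> 1 + F <= freq2 F E i.

Local Notation kap := (freq F E).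
Local Notation om := (wgt F E i0).
Local Notation L := (clock F E i0).

(** The discrete form of the integral of [exp (- d s)], equal to [1 / d]; the factor [1 + d] pays
    for clock steps of length up to [1]. *)
Lemma expclock_sum (d : R) n : 0 < d ->
  \sum_(i < n) expR (- d * L i) * om i <= (1 + d) / d.
Proof.
move=> d0; have key m : \sum_(i < m) expR (- d * L i) * om i <=
    (1 + d) / d * (1 - expR (- d * L m)).
  elim: m => [|m IH].
    by rewrite big_ord0 /clock big_ord0 mulr0 expR0 subrr mulr0.
  rewrite big_ord_recr/= (le_trans (lerD IH (lexx _)))//.
  rewrite clockS [- d * (_ + _)]mulrDr expRD.
  set x := expR (- d * L m); have x0 : 0 < x by exact: expR_gt0.
  have o0 := wgt_ge0 F0 hi0 m; have o1 := wgt_le1 F0 hi0 m.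
  have do0 : 0 <= d * om m by rewrite mulr_ge0// ltW.
  have e1 : expR (- d * om m) <= (1 + d * om m)^-1.
    rewrite mulNr expRN lef_pV2 ?posrE ?expR_gt0// ?expR_ge1Dx//.
    by rewrite ltr_wpDr.
  have e2 : om m <= (1 + d) / d * (1 - (1 + d * om m)^-1).
    have -> : (1 + d) / d * (1 - (1 + d * om m)^-1) = (1 + d) * om m / (1 + d * om m).
      by field; rewrite !gt_eqF// ltr_wpDr.
    rewrite ler_pdivlMr ?ltr_wpDr// mulrC ler_wpM2r//.
    by rewrite lerD2l ler_piMr// ltW.
  have c0 : 0 <= (1 + d) / d by rewrite divr_ge0 ?addr_ge0// ltW.
  have : x * om m <= x * ((1 + d) / d * (1 - expR (- d * om m))).
    rewrite ler_pM2l// (le_trans e2)// ler_wpM2l// lerD2l lerN2//.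
  lra.
apply: (le_trans (key n)); rewrite ler_piMr// ?divr_ge0 ?addr_ge0 ?(ltW d0)//.
Qed.

Lemma expclock_to0 (d K : R) : 0 < d -> to0 (fun i => K * expR (- d * L i)).
Proof.
move=> d0; suff h : to0 (fun i => expR (- d * L i)).
  by apply: (to0_le (N0 := 0%N) (K := `|K|) h) => i _; rewrite normrM.
move=> e e0; have [N HN] := clock_unbounded F0 hi0 (- ln e / d).
exists N => i /HN; rewrite ler_pdivrMr// => h.
rewrite ger0_norm ?expR_ge0// -[leRHS]lnK ?posrE// ler_expR; lra.
Qed.

Variables (w Kz lam : R) (p q gam : nat -> R) (C D : nat -> R * R).
Hypothesis w0 : w != 0.
Hypothesis zK : forall i, (i0 <= i)%N -> p i ^+ 2 + q i ^+ 2 <= Kz / kap i.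
Definition kickv i (X : R * R) : R * R :=
  (X.1 - gam i * (X.1 * p i + X.2 * q i) / w * q i,
   X.2 + gam i * (X.1 * p i + X.2 * q i) / w * p i).
Hypothesis CS : forall i, C i.+1 = kickv i (C i).
Hypothesis DS : forall i, D i.+1 = kickv i (D i).
Hypothesis rel0 : to0 (rel F E gam).

Definition nrm i := (D i).1 ^+ 2 + (D i).2 ^+ 2.
Definition det i := (D i).1 * (C i).2 - (D i).2 * (C i).1.
(* [C = rat * D + (det / nrm) * D^perp] with [det] constant, so the convergence of [|C| / |D|] is governed by [rat]. *)
Definition rat i := ((C i).1 * (D i).1 + (C i).2 * (D i).2) / nrm i.
(** [zs] and [w * vs] are the components of [D] along and across [(p, q)], scaled by its length;
    [zs] is the value of the solution at the site. [lin] and [quad] are the coefficients of [gam]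
    and [gam^2] in the increment of [rat]. *)
Definition zs i := (D i).1 * p i + (D i).2 * q i.
Definition vs i := ((D i).2 * p i - (D i).1 * q i) / w.
Definition lin i := zs i ^+ 2 / w - w * vs i ^+ 2.
Definition quad i := - w * vs i * zs i * ((p i ^+ 2 + q i ^+ 2) / w ^+ 2).

Hypothesis nrm_gt0 : forall i, 0 < nrm i.

Lemma det_const i : det i = det 0%N.
Proof.
elim: i => //= i <-; rewrite /det CS DS /kickv /=; ring.
Qed.

Lemma nrmS i : nrm i.+1 = nrm i + 2 * gam i * (zs i * vs i) +
  gam i ^+ 2 * (zs i ^+ 2 * ((p i ^+ 2 + q i ^+ 2) / w ^+ 2)).
Proof. by rewrite /nrm DS /kickv /zs /vs /=; field. Qed.

(** The kick is linear: the component of [C] along [D] reproduces [rat i], and only the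
    perpendicular component, of size [det / nrm], changes it. *)
Lemma rat_increment i : rat i.+1 - rat i =
  det 0%N * (gam i * lin i + gam i ^+ 2 * quad i) / (nrm i * nrm i.+1).
Proof.
have n0 : nrm i != 0 by rewrite gt_eqF. have n1 : nrm i.+1 != 0 by rewrite gt_eqF.
have cE : (C i).1 * nrm i = (rat i * nrm i) * (D i).1 - det 0%N * (D i).2.
  by rewrite /rat divfK// -(det_const i) /det /nrm; ring.
have cE2 : (C i).2 * nrm i = (rat i * nrm i) * (D i).2 + det 0%N * (D i).1.
  by rewrite /rat divfK// -(det_const i) /det /nrm; ring.
apply: (mulIf (mulf_neq0 n0 n1)); rewrite divfK ?mulf_neq0//.
have -> : (rat i.+1 - rat i) * (nrm i * nrm i.+1) =
    ((C i.+1).1 * (D i.+1).1 + (C i.+1).2 * (D i.+1).2) * nrm i - rat i * nrm i * nrm i.+1.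
  by rewrite [rat i.+1]/rat; field.
pose f P Q := (P - gam i * (P * p i + Q * q i) / w * q i) * (D i.+1).1 +
  (Q + gam i * (P * p i + Q * q i) / w * p i) * (D i.+1).2.
have -> : ((C i.+1).1 * (D i.+1).1 + (C i.+1).2 * (D i.+1).2) * nrm i =
    f ((C i).1 * nrm i) ((C i).2 * nrm i) by rewrite CS /kickv /f /=; ring.
by rewrite cE cE2 /f nrmS DS /kickv /nrm /lin /quad /zs /vs /=; field.
Qed.

Definition kick_size i := `|gam i| * (p i ^+ 2 + q i ^+ 2) / `|w|.

Lemma zs_sqr i : zs i ^+ 2 <= nrm i * (p i ^+ 2 + q i ^+ 2).
Proof.
rewrite -subr_ge0 (_ : _ - _ = ((D i).1 * q i - (D i).2 * p i) ^+ 2) ?sqr_ge0//.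
by rewrite /zs /nrm; ring.
Qed.

Lemma vs_sqr i : (w * vs i) ^+ 2 <= nrm i * (p i ^+ 2 + q i ^+ 2).
Proof.
rewrite -subr_ge0 (_ : _ - _ = ((D i).1 * p i + (D i).2 * q i) ^+ 2) ?sqr_ge0//.
by rewrite /vs /nrm; field.
Qed.

Lemma zsvs i : `|zs i * (w * vs i)| <= nrm i * (p i ^+ 2 + q i ^+ 2).
Proof.
have := zs_sqr i; have := vs_sqr i.
have := sqr_ge0 (zs i - w * vs i); have := sqr_ge0 (zs i + w * vs i).
by rewrite sqrrB sqrrD ler_norml; lra.
Qed.

Lemma lin_bound i : `|lin i| <= 2 * nrm i * (p i ^+ 2 + q i ^+ 2) / `|w|.
Proof.
have aw : 0 < `|w| by rewrite normr_gt0.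
have -> : lin i = (zs i ^+ 2 - (w * vs i) ^+ 2) / w by rewrite /lin; field.
rewrite normrM normfV ler_wpM2r ?invr_ge0 ?(ltW aw)//.
have := zs_sqr i; have := vs_sqr i; have := sqr_ge0 (zs i); have := sqr_ge0 (w * vs i).
by rewrite ler_norml; lra.
Qed.

Lemma gam_lin i : `|gam i * lin i| <= 2 * nrm i * kick_size i.
Proof.
rewrite normrM /kick_size; have -> : 2 * nrm i * (`|gam i| * (p i ^+ 2 + q i ^+ 2) / `|w|) =
  `|gam i| * (2 * nrm i * (p i ^+ 2 + q i ^+ 2) / `|w|) by ring.
by rewrite ler_wpM2l// lin_bound.
Qed.

Lemma kick_size_sqr i : kick_size i ^+ 2 = gam i ^+ 2 * (p i ^+ 2 + q i ^+ 2) ^+ 2 / w ^+ 2.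
Proof. by rewrite /kick_size expr_div_n exprMn !real_normK ?num_real. Qed.

Lemma gam_quad i : `|gam i ^+ 2 * quad i| <= nrm i * kick_size i ^+ 2.
Proof.
have -> : gam i ^+ 2 * quad i =
   - (gam i ^+ 2 * ((p i ^+ 2 + q i ^+ 2) / w ^+ 2)) * (zs i * (w * vs i)).
  by rewrite /quad; ring.
have z0 : 0 <= p i ^+ 2 + q i ^+ 2 by rewrite addr_ge0 ?sqr_ge0.
have c0 : 0 <= gam i ^+ 2 * ((p i ^+ 2 + q i ^+ 2) / w ^+ 2).
  by rewrite mulr_ge0 ?sqr_ge0// divr_ge0 ?sqr_ge0.
rewrite normrM normrN (ger0_norm c0) kick_size_sqr.
apply: (le_trans (ler_wpM2l c0 (zsvs i))).
by rewrite le_eqVlt; apply/orP; left; apply/eqP; field.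
Qed.

Lemma nrm_ratio i : kick_size i <= 8^-1 ->
  `|nrm i.+1 - nrm i| <= 3 * nrm i * kick_size i /\ nrm i / 2 <= nrm i.+1.
Proof.
move=> k8; have n0 := nrm_gt0 i.
have z0 : 0 <= p i ^+ 2 + q i ^+ 2 by rewrite addr_ge0 ?sqr_ge0.
have k0 : 0 <= kick_size i by rewrite /kick_size divr_ge0// mulr_ge0.
have h1 : `|2 * gam i * (zs i * vs i)| <= 2 * nrm i * kick_size i.
  have -> : 2 * gam i * (zs i * vs i) = 2 * (gam i * (zs i * (w * vs i)) / w) by field.
  rewrite normrM ger0_norm// -[leRHS]mulrA ler_wpM2l// normrM normfV normrM.
  rewrite /kick_size [leRHS](_ : _ = `|gam i| * (nrm i * (p i ^+ 2 + q i ^+ 2)) / `|w|); last by ring.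
  by rewrite ler_wpM2r ?invr_ge0// ler_wpM2l// zsvs.
have h2 : 0 <= gam i ^+ 2 * (zs i ^+ 2 * ((p i ^+ 2 + q i ^+ 2) / w ^+ 2)) <= nrm i * kick_size i ^+ 2.
  have c0 : 0 <= gam i ^+ 2 * ((p i ^+ 2 + q i ^+ 2) / w ^+ 2).
    by rewrite mulr_ge0 ?sqr_ge0// divr_ge0 ?sqr_ge0.
  rewrite (_ : gam i ^+ 2 * _ = gam i ^+ 2 * ((p i ^+ 2 + q i ^+ 2) / w ^+ 2) * zs i ^+ 2); last by ring.
  rewrite mulr_ge0 ?sqr_ge0//= (le_trans (ler_wpM2l c0 (zs_sqr i)))//.
  by rewrite kick_size_sqr le_eqVlt; apply/orP; left; apply/eqP; field.
have h3 : nrm i * kick_size i ^+ 2 <= nrm i * kick_size i / 8.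
  by rewrite expr2 mulrA ler_wpM2l// mulr_ge0// ltW.
have h4 : 0 <= nrm i * kick_size i by rewrite mulr_ge0// ltW.
have h5 : nrm i * kick_size i <= nrm i / 8 by rewrite ler_pM2l.
have d3 : `|nrm i.+1 - nrm i| <= 3 * nrm i * kick_size i.
  by rewrite nrmS; move: h1; rewrite !ler_norml; lra.
split=> //; move: d3; rewrite ler_norml; lra.
Qed.

(** Replacing [nrm i.+1] by [nrm i] in the denominator makes the coefficient of [gam i] depend on
    the past only, at a cost of second order. The numerator gives [1 + 6 = 7], and
    [nrm i.+1 >= nrm i / 2] doubles it. *)
Lemma rat_remainder i : kick_size i <= 8^-1 ->
  `|rat i.+1 - rat i - det 0%N * lin i / nrm i ^+ 2 * gam i| <=
    14 * `|det 0%N| * kick_size i ^+ 2 / nrm i.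
Proof.
move=> k8; have [d1 d2] := nrm_ratio k8; have n0 := nrm_gt0 i; have n1 := nrm_gt0 i.+1.
have z0 : 0 <= p i ^+ 2 + q i ^+ 2 by rewrite addr_ge0 ?sqr_ge0.
have k0 : 0 <= kick_size i by rewrite /kick_size divr_ge0// mulr_ge0.
rewrite rat_increment.
have -> : det 0%N * (gam i * lin i + gam i ^+ 2 * quad i) / (nrm i * nrm i.+1) -
    det 0%N * lin i / nrm i ^+ 2 * gam i =
    det 0%N * ((nrm i * (gam i ^+ 2 * quad i) - gam i * lin i * (nrm i.+1 - nrm i)) / (nrm i ^+ 2 * nrm i.+1)).
  by field; rewrite !gt_eqF.
rewrite normrM (_ : 14 * _ * _ / _ = `|det 0%N| * (14 * kick_size i ^+ 2 / nrm i)); last by ring.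
rewrite ler_wpM2l// normrM normfV (gtr0_norm (_ : 0 < nrm i ^+ 2 * nrm i.+1)); last by rewrite mulr_gt0// exprn_gt0.
rewrite ler_pdivrMr ?mulr_gt0 ?exprn_gt0//.
have -> : 14 * kick_size i ^+ 2 / nrm i * (nrm i ^+ 2 * nrm i.+1) =
    14 * kick_size i ^+ 2 * nrm i * nrm i.+1 by field; rewrite gt_eqF.
rewrite (le_trans (ler_normB _ _))//.
have b1 : `|nrm i * (gam i ^+ 2 * quad i)| <= nrm i * (nrm i * kick_size i ^+ 2).
  by rewrite normrM (gtr0_norm n0) ler_wpM2l ?gam_quad// ltW.
have b2 : `|gam i * lin i * (nrm i.+1 - nrm i)| <= 2 * nrm i * kick_size i * (3 * nrm i * kick_size i).
  by rewrite normrM ler_pM// gam_lin.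
have : 7 * (kick_size i ^+ 2 * nrm i) * nrm i <= 7 * (kick_size i ^+ 2 * nrm i) * (2 * nrm i.+1).
  by rewrite ler_wpM2l ?mulr_ge0 ?sqr_ge0 ?(ltW n0)//; lra.
move: b1 b2; rewrite !expr2; lra.
Qed.

Variables (tau del K2 B3 B4 : R).
Hypothesis tau0 : 0 < tau.
Hypothesis del0 : 0 < del.
Hypothesis K20 : 0 <= K2.
Hypothesis growth : forall i, (i0 <= i)%N -> expR (tau * L i) / nrm i <= K2 * expR (- del * L i).
Hypothesis M3 : forall n, `|\sum_(i < n) om i * (gam i ^+ 2 - lam ^+ 2)| <= B3.
Hypothesis M4 : forall n, `|\sum_(i < n) (if (i < i0)%N then 0 else
   expR (tau * L i) * (det 0%N * lin i / nrm i ^+ 2)) * gam i| <= B4.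

(** Replacing [gam^2] by [lam^2] changes the weighted sums by a bounded amount, and Abel summation
    preserves this under the decreasing factor. *)
Lemma expclock_gam : exists B, forall n, \sum_(i < n) expR (- del * L i) * (om i * gam i ^+ 2) <= B.
Proof.
have ed_le i : expR (- del * L i.+1) <= expR (- del * L i).
  by rewrite ler_expR ler_nM2l ?oppr_lt0// clock_le.
pose T n := \sum_(i < n) om i * (gam i ^+ 2 - lam ^+ 2).
pose x n := \sum_(i < n) expR (- del * L i) * (om i * (gam i ^+ 2 - lam ^+ 2)).
exists (2 * B3 + lam ^+ 2 * ((1 + del) / del)) => n.
have := abel_decr (p := fun i => expR (- del * L i)) (T := T) (x := x) (n0 := 0%N) M3
  (fun i => expR_ge0 _) ed_le _ (leqnn 0%N) (leq0n n).
have x0 : x 0%N = 0 by rewrite /x big_ord0.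
have L0 : L 0%N = 0 by rewrite /clock big_ord0.
rewrite x0 subr0 L0 mulr0 expR0 mulr1 => H.
have {}H : `|\sum_(i < n) expR (- del * L i) * (om i * (gam i ^+ 2 - lam ^+ 2))| <= 2 * B3.
  by apply: H => i _; rewrite /T /x !big_ord_recr/=; ring.
have -> : \sum_(i < n) expR (- del * L i) * (om i * gam i ^+ 2) =
   \sum_(i < n) expR (- del * L i) * (om i * (gam i ^+ 2 - lam ^+ 2)) +
   lam ^+ 2 * \sum_(i < n) expR (- del * L i) * om i.
  by rewrite mulr_sumr -big_split/=; apply: eq_bigr => i _; ring.
rewrite lerD ?(le_trans (ler_norm _) H)// ler_wpM2l ?sqr_ge0//.
exact: expclock_sum.
Qed.

(** Multiplied by [exp (tau L)], the increments of [rat] still have bounded partial sums: the linear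
    part by [M4], and the remainder because the growth of [nrm] leaves the summable factor
    [exp (- del L)]. Abel summation then trades the multiplier for the rate. *)
Lemma rat_rate : exists2 K, 0 <= K & forall n m, (n <= m)%N ->
  `|rat m - rat n| <= K * expR (- tau * L n).
Proof.
have aw : 0 < `|w| by rewrite normr_gt0.
have Kz0 : 0 <= Kz.
  have := zK (leqnn i0); rewrite ler_pdivlMr ?(freq_gt0 F0 hi0 (leqnn i0))//.
  by apply: le_trans; rewrite mulr_ge0 ?(ltW (freq_gt0 F0 hi0 (leqnn i0)))// addr_ge0 ?sqr_ge0.
have ksz i : (i0 <= i)%N -> kick_size i <= Kz / `|w| * `|rel F E gam i|.
  move=> ii; have k0 := freq_gt0 F0 hi0 ii.
  rewrite /kick_size /rel normrM normfV (gtr0_norm k0).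
  rewrite [leRHS](_ : _ = `|gam i| * (Kz / kap i) / `|w|); last by ring.
  by rewrite ler_wpM2r ?invr_ge0// ler_wpM2l// zK.
have [N1 HN1] : exists N1, forall i, (N1 <= i)%N -> Kz / `|w| * `|rel F E gam i| <= 8^-1.
  have h : to0 (fun i => Kz / `|w| * `|rel F E gam i|).
    apply: (to0_le (N0 := 0%N) (K := Kz / `|w|) rel0) => i _.
    by rewrite ger0_norm// mulr_ge0// divr_ge0.
  have e8 : 0 < (8^-1 : R) by lra.
  have [N HN] := h _ e8; exists N => i /HN; exact: le_trans (ler_norm _).
pose Z i := if (i < i0)%N then 0 else expR (tau * L i) * (det 0%N * lin i / nrm i ^+ 2).
pose rest i := expR (tau * L i) * (rat i.+1 - rat i) - Z i * gam i.
have [B5 HB5] := expclock_gam.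
pose K3 := 14 * `|det 0%N| * (Kz / `|w|) ^+ 2 * K2.
have K30 : 0 <= K3 by rewrite !mulr_ge0// sqr_ge0.
have om0 := wgt_ge0 F0 hi0.
have [B6 B60 HB6] : exists2 B6, 0 <= B6 & forall n, `|\sum_(i < n) rest i| <= B6.
  apply: (@sum_bounded_eventually rest (fun i => K3 * (expR (- del * L i) * (om i * gam i ^+ 2)))
     (maxn i0 N1) (K3 * B5)).
  - by move=> i; rewrite mulr_ge0// mulr_ge0 ?expR_ge0// mulr_ge0 ?sqr_ge0.
  - move=> i; rewrite geq_max => /andP[ii /HN1 kN].
    have ks := ksz i ii; have k0 := freq_gt0 F0 hi0 ii.
    have z0 : 0 <= p i ^+ 2 + q i ^+ 2 by rewrite addr_ge0 ?sqr_ge0.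
    have ks0 : 0 <= kick_size i by rewrite /kick_size divr_ge0// mulr_ge0.
    have := rat_remainder (le_trans ks kN).
    rewrite /rest /Z ltnNge ii /= => h.
    rewrite -mulrA -mulrBr normrM (ger0_norm (expR_ge0 _)).
    apply: (le_trans (ler_wpM2l (expR_ge0 _) h)).
    rewrite (wgtE F0 hi0 ii).
    have ks2 : kick_size i ^+ 2 <= (Kz / `|w|) ^+ 2 * ((kap i ^+ 2)^-1 * gam i ^+ 2).
      have -> : (Kz / `|w|) ^+ 2 * ((kap i ^+ 2)^-1 * gam i ^+ 2) = (Kz / `|w| * `|rel F E gam i|) ^+ 2.
        by rewrite [RHS]exprMn real_normK ?num_real// /rel [(gam i / _) ^+ 2]expr_div_n; ring.
      by rewrite ler_sqr ?nnegrE// mulr_ge0// divr_ge0.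
    rewrite (_ : expR _ * (14 * _ * _ / _) = 14 * `|det 0%N| * (kick_size i ^+ 2 * (expR (tau * L i) / nrm i))); last by ring.
    have -> : K3 * (expR (- del * L i) * ((kap i ^+ 2)^-1 * gam i ^+ 2)) =
       14 * `|det 0%N| * (((Kz / `|w|) ^+ 2 * ((kap i ^+ 2)^-1 * gam i ^+ 2)) * (K2 * expR (- del * L i))).
      by rewrite /K3; ring.
    rewrite ler_wpM2l ?mulr_ge0// ler_pM ?sqr_ge0 ?growth//.
    by rewrite divr_ge0 ?expR_ge0// ltW.
  - by move=> n; rewrite -mulr_sumr ler_wpM2l.
pose T n := \sum_(i < n) expR (tau * L i) * (rat i.+1 - rat i).
have TB n : `|T n| <= B4 + B6.
  have -> : T n = \sum_(i < n) Z i * gam i + \sum_(i < n) rest i.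
    by rewrite -big_split/=; apply: eq_bigr => i _; rewrite /rest addrC subrK.
  by rewrite (le_trans (ler_normD _ _))// lerD.
have et_le i : expR (- tau * L i.+1) <= expR (- tau * L i).
  by rewrite ler_expR ler_nM2l ?oppr_lt0// clock_le.
exists (2 * (B4 + B6)); first by rewrite mulr_ge0// (le_trans _ (TB 0%N)).
move=> n m nm.
apply: (abel_decr (p := fun i => expR (- tau * L i)) (T := T) (n0 := 0%N) TB
  (fun i => expR_ge0 _) et_le _ (leq0n n) nm) => i _.
rewrite /T big_ord_recr/= [X in _ * X]addrAC subrr add0r mulrA -expRD mulNr addNr expR0 mul1r//.
Qed.

End RatioConvergence.

(** * The abstract growth hypotheses hold at the sites *)

Section Sites.
Context {R : realType}.
Implicit Types (x : R) (A : R * R).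
Variables (F E : R) (i0 : nat).
Hypothesis F0 : 0 < F.
Hypothesis hi0 : forall i, (i0 <= i)%N -> 1 + F <= freq2 F E i.
Variables z1 z2 dz1 dz2 : R -> R.
Hypothesis z1d : forall x, isd z1 x (dz1 x).
Hypothesis z2d : forall x, isd z2 x (dz2 x).
Hypothesis dz1c : continuous dz1.
Hypothesis dz2c : continuous dz2.
Let W := wz z1 z2 dz1 dz2 0.
Hypothesis W0 : W != 0.
Hypothesis WE : forall m x, m%:R <= x <= m.+1%:R -> wz z1 z2 dz1 dz2 x = W.
Hypothesis zsol : forall m, solves_in m (fun x => F * x + E) z1 dz1 /\
  solves_in m (fun x => F * x + E) z2 dz2.

Local Notation kap := (freq F E).
Local Notation cmb := (comb z1 z2).
Local Notation dcmb := (comb dz1 dz2).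

Lemma kxE i : kx F E i.+1%:R = kap i.
Proof. by []. Qed.

Lemma size2_ge0 y dy x : 0 <= size2 F E y dy x.
Proof.
apply: addr_ge0; first by apply: mulr_ge0; [exact: sqrtr_ge0|exact: sqr_ge0].
by apply: divr_ge0; [exact: sqr_ge0|exact: sqrtr_ge0].
Qed.

Lemma W_site m : wz z1 z2 dz1 dz2 m%:R = W.
Proof. by apply: (WE (m := m)); rewrite lexx ler_nat leqnSn. Qed.

Lemma comb_free A : free F E (cmb A) (dcmb A).
Proof.
split.
- by move=> x; exact: comb_isd.
- exact: dcomb_cont.
- move=> m x xm; split; first exact: comb_isd.
  have [s1 s2] := zsol m; have [_ d1] := s1 x xm; have [_ d2] := s2 x xm.
  by apply: isd_eq; last (rewrite /comb; deriv); rewrite /comb/=; ring.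
Qed.

Lemma deep_site i : (i0 <= i)%N -> deep F E i.+1%:R.
Proof. exact: hi0. Qed.

Lemma comb_eq0 A m : cmb A m%:R = 0 -> dcmb A m%:R = 0 -> A = (0, 0).
Proof.
move=> e1 e2; have w0 : wz z1 z2 dz1 dz2 m%:R != 0 by rewrite W_site.
by rewrite (solve2 w0 e1 e2) !mul0r !mulr0 subrr !mul0r.
Qed.

Lemma kick_comb m g A : cmb (kick z1 z2 W m g A) m%:R = cmb A m%:R.
Proof. by rewrite /kick /comb /=; ring. Qed.

Lemma kick_dcomb m g A :
  dcmb (kick z1 z2 W m g A) m%:R = dcmb A m%:R + g * cmb A m%:R.
Proof.
have := W0; rewrite -(W_site m) /kick /comb /wz /wronsk /= => w0.
by field.
Qed.

(** The components of the reference solution feel no jumps, so [energy * exp (cx)] never increases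
    along the sites from [i0 + 1] on. *)
Lemma size2_z : exists2 K, 0 <= K & forall i, (i0 <= i)%N ->
  size2 F E z1 dz1 i.+1%:R <= K /\ size2 F E z2 dz2 i.+1%:R <= K.
Proof.
have bnd y dy : free F E y dy -> exists2 K, 0 <= K &
    forall i, (i0 <= i)%N -> size2 F E y dy i.+1%:R <= K.
  move=> fr; pose K := energy F E y dy i0.+1%:R * expR (cx F E i0.+1%:R).
  have s0 i : (i0 <= i)%N -> 0 <= size2 F E y dy i.+1%:R.
    move=> ii; have := prod_size2 F0 y dy (deep_site ii).
    by have := normr_ge0 (y i.+1%:R * dy i.+1%:R); lra.
  have key k : energy F E y dy (i0 + k).+1%:R * expR (cx F E (i0 + k).+1%:R) <= K.
    elim: k => [|k IH]; first by rewrite addn0.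
    have ii : (i0 <= i0 + k)%N by rewrite leq_addr.
    have le1 : (i0 + k).+1%:R <= (i0 + k).+2%:R :> R by rewrite ler_nat.
    have [h _] := energy_mono F0 fr (deep_site ii) (lexx _) le1 (lexx _).
    by rewrite addnS (le_trans h).
  exists (4 / 3 * `|K|); first by rewrite mulr_ge0.
  move=> i ii; have := key (i - i0)%N; rewrite subnKC// => h.
  have dx := deep_site ii; have /andP[l1 _] := energy_size2 F0 y dy dx.
  have /andP[c0 _] := cx_bound F0 dx.
  have e1 : 1 <= expR (cx F E i.+1%:R) by have := expR_ge1Dx (cx F E i.+1%:R); lra.
  have en0 : 0 <= energy F E y dy i.+1%:R by have := s0 _ ii; lra.
  have : energy F E y dy i.+1%:R <= energy F E y dy i.+1%:R * expR (cx F E i.+1%:R).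
    by rewrite ler_peMr.
  by have := ler_norm K; lra.
have f1 : free F E z1 dz1 by split => // m; have [] := zsol m.
have f2 : free F E z2 dz2 by split => // m; have [] := zsol m.
have [K1 K10 h1] := bnd _ _ f1; have [K2 K20 h2] := bnd _ _ f2.
exists (K1 + K2); first exact: addr_ge0.
by move=> i ii; have := h1 _ ii; have := h2 _ ii; lra.
Qed.

Variables (Kz : R) (gam : nat -> R) (C : nat -> R * R).
Hypothesis Kz0 : 0 <= Kz.
Hypothesis size2K : forall i, (i0 <= i)%N ->
  size2 F E z1 dz1 i.+1%:R <= Kz /\ size2 F E z2 dz2 i.+1%:R <= Kz.
Hypothesis CS : forall i, C i.+1 = kick z1 z2 W i.+1 (gam i) (C i).
Hypothesis C0 : forall i, C i != (0, 0).

Lemma z_bound i : (i0 <= i)%N ->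
  z1 i.+1%:R ^+ 2 + z2 i.+1%:R ^+ 2 <= 2 * Kz / kap i.
Proof.
move=> ii; have k0 := freq_gt0 F0 hi0 ii; have [] := size2K ii.
rewrite /size2 kxE => h1 h2; rewrite ler_pdivlMr// mulrC.
have p1 : 0 <= dz1 i.+1%:R ^+ 2 / kap i by rewrite divr_ge0 ?sqr_ge0// ltW.
have p2 : 0 <= dz2 i.+1%:R ^+ 2 / kap i by rewrite divr_ge0 ?sqr_ge0// ltW.
lra.
Qed.

Definition site_a (B : nat -> R * R) i : R := kap i * cmb (B i) i.+1%:R.
Definition site_b (B : nat -> R * R) i : R := dcmb (B i) i.+1%:R.
Definition site_c i : R := cx F E i.+1%:R.

Lemma site_c_bound i : (i0 <= i)%N -> 0 < site_c i <= 2^-1.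
Proof. by move=> ii; exact: (cx_bound F0 (deep_site ii)). Qed.

Lemma site_c_freq i : (i0 <= i)%N -> site_c i <= F / kap i.
Proof.
move=> ii; have k0 := freq_gt0 F0 hi0 ii; have k1 := freq_ge1 F0 hi0 ii.
rewrite /site_c /cx ler_wpM2l ?(ltW F0)// lef_pV2 ?posrE ?mulr_gt0 ?exprn_gt0//.
rewrite kxE; have k2 : kap i <= kap i ^+ 3.
  by rewrite exprS ler_peMr ?(ltW k0)// exprn_ege1.
lra.
Qed.

Lemma site_rad i : (i0 <= i)%N -> 0 < site_a C i ^+ 2 + site_b C i ^+ 2.
Proof.
move=> ii; have k0 := freq_gt0 F0 hi0 ii.
rewrite lt_def addr_ge0 ?sqr_ge0// andbT paddr_eq0 ?sqr_ge0// !sqrf_eq0.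
rewrite /site_a mulf_eq0 (gt_eqF k0)/=; apply/negP => /andP[/eqP e1 /eqP e2].
by have := C0 i; rewrite (comb_eq0 e1 e2) eqxx.
Qed.

Lemma site_after i : (i0 <= i)%N ->
  kap i * cmb (C i.+1) i.+1%:R = site_a C i /\
  dcmb (C i.+1) i.+1%:R = site_b C i + rel F E gam i * site_a C i.
Proof.
move=> ii; have k0 := freq_gt0 F0 hi0 ii.
rewrite CS kick_comb kick_dcomb; split=> //.
by rewrite /site_b /site_a /rel mulrA divfK// gt_eqF.
Qed.

Lemma site_rot i : (i0 <= i)%N ->
  let r := Num.sqrt (site_a C i ^+ 2 + (site_b C i + rel F E gam i * site_a C i) ^+ 2) in
  `|site_a C i.+1 - (site_a C i * cos (kap i) + (site_b C i + rel F E gam i * site_a C i) * sin (kap i))|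
     <= 6 * F * r / kap i /\
  `|site_b C i.+1 - ((site_b C i + rel F E gam i * site_a C i) * cos (kap i) - site_a C i * sin (kap i))|
     <= 4 * F * r / kap i.
Proof.
move=> ii; have [e1 e2] := site_after ii.
by have := rotation F0 (comb_free (C i.+1)) (deep_site ii); rewrite kxE /= e1 e2.
Qed.

Lemma energy_site y dy i : (i0 <= i)%N -> energy F E y dy i.+1%:R =
  ((kap i * y i.+1%:R) ^+ 2 + dy i.+1%:R ^+ 2 +
     site_c i * (kap i * y i.+1%:R * dy i.+1%:R)) / kap i.
Proof.
move=> ii; have k0 := freq_gt0 F0 hi0 ii.
by rewrite /energy /site_c kxE; field; rewrite gt_eqF.
Qed.

Local Notation en := (en F E (site_a C) (site_b C) site_c).
Local Notation sig := (sig (site_a C) (site_b C) site_c).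
Local Notation frac := (frac (site_a C) (site_b C) site_c).

(** The jump replaces [b] by [b + rel * a], and expanding the quadratic form gives the bracket
    exactly; the next cell then costs only the telescoping factor of [energy_mono]. *)
Lemma site_step i : (i0 <= i)%N ->
  en i * (1 + rel F E gam i * sig i + rel F E gam i ^+ 2 * frac i) * expR (- site_c i) <=
  en i.+1 * expR (- site_c i.+1).
Proof.
move=> ii; have iS : (i0 <= i.+1)%N by rewrite (leq_trans ii).
have [e1 e2] := site_after ii.
have le1 : i.+1%:R <= i.+2%:R :> R by rewrite ler_nat.
have [_] := energy_mono F0 (comb_free (C i.+1)) (deep_site ii) (lexx _) le1 (lexx _).
rewrite !energy_site// e1 e2 -/(site_c i) -/(site_c i.+1) -/(site_a C i.+1) -/(site_b C i.+1).
congr (_ * _ <= _).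
have f0 : form (site_a C) (site_b C) site_c i != 0.
  by rewrite gt_eqF// (form_gt0 (i0 := i0) site_c_bound site_rad ii).
have k0 := freq_gt0 F0 hi0 ii.
move: f0; rewrite /en /sig /frac /form => f0; field.
by rewrite f0 gt_eqF.
Qed.

Lemma en_le_nrm i : (i0 <= i)%N ->
  en i <= 5 * Kz * ((C i).1 ^+ 2 + (C i).2 ^+ 2).
Proof.
move=> ii; have k0 := freq_gt0 F0 hi0 ii.
have -> : en i = energy F E (cmb (C i)) (dcmb (C i)) i.+1%:R.
  by rewrite energy_site.
have /andP[_ h] := energy_size2 F0 (cmb (C i)) (dcmb (C i)) (deep_site ii).
have [s1 s2] := size2K ii.
have s1' : 0 <= size2 F E z1 dz1 i.+1%:R.
  exact: size2_ge0.
have sq : size2 F E (cmb (C i)) (dcmb (C i)) i.+1%:R <=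
    2 * ((C i).1 ^+ 2 * size2 F E z1 dz1 i.+1%:R + (C i).2 ^+ 2 * size2 F E z2 dz2 i.+1%:R).
  (* Parallelogram identity: the defect is [size2] of the combination with the opposite sign. *)
  rewrite -subr_ge0 (_ : _ - _ = size2 F E (fun x => (C i).1 * z1 x - (C i).2 * z2 x)
    (fun x => (C i).1 * dz1 x - (C i).2 * dz2 x) i.+1%:R); last by rewrite /size2 /comb; ring.
  by rewrite size2_ge0.
have b1 : (C i).1 ^+ 2 * size2 F E z1 dz1 i.+1%:R <= (C i).1 ^+ 2 * Kz by rewrite ler_wpM2l ?sqr_ge0.
have b2 : (C i).2 ^+ 2 * size2 F E z2 dz2 i.+1%:R <= (C i).2 ^+ 2 * Kz by rewrite ler_wpM2l ?sqr_ge0.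
have : 0 <= (C i).1 ^+ 2 * Kz by rewrite mulr_ge0 ?sqr_ge0.
have : 0 <= (C i).2 ^+ 2 * Kz by rewrite mulr_ge0 ?sqr_ge0.
lra.
Qed.

End Sites.

(** * Moments of the couplings *)

Section Moments.
Context d (T : measurableType d) (R : realType) (P : probability T R).
Variables (lam : R) (g : nat -> T -> R).
Hypothesis mg : forall n, (1 <= n)%N -> measurable_fun setT (g n).
Hypothesis g_mean : forall n, (1 <= n)%N ->
  P.-integrable setT (EFin \o g n) /\ ('E_P[g n] = 0)%E.
Hypothesis g_var : forall n, (1 <= n)%N ->
  ('E_P[fun w => (g n w ^+ 2)%R] = (lam ^+ 2)%:E)%E.
Hypothesis g_four : (\sum_(1 <= n <oo) ('E_P[fun w => (g n w ^+ 4)%R] * (n%:R ^- 2)%:E) < +oo)%E.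

Lemma measurable_invr : measurable_fun setT (fun x : R => x^-1).
Proof.
rewrite -(setUv [set 0 : R]); apply/measurable_funU => //; first exact: measurableC.
split.
  apply/measurable_restrictT => //.
  rewrite [X in measurable_fun _ X](_ : _ = cst 0)//.
  by apply/funext => x; rewrite patchE/=; case: ifPn => //; rewrite inE/= => ->; rewrite invr0.
apply: open_continuous_measurable_fun.
  by rewrite openC; exact: closed_eq.
move=> x; rewrite inE => /eqP x0; exact: inv_continuous.
Qed.

Lemma mg_pow i k : measurable_fun setT (fun w => (g i.+1 w ^+ k)%:E).
Proof. by apply/measurable_EFinP; apply: measurable_funX; exact: mg. Qed.

Lemma mean0 i : P.-integrable setT (fun w => (g i.+1 w)%:E) /\ (\int[P]_w (g i.+1 w)%:E = 0)%E.
Proof. by have [h1 h2] := g_mean (ltn0Sn i); split=> //; rewrite -h2 unlock. Qed.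

Lemma var2 i : (\int[P]_w (g i.+1 w ^+ 2)%:E = (lam ^+ 2)%:E)%E.
Proof. by rewrite -(g_var (ltn0Sn i)) unlock. Qed.

Lemma int_cst (x : R) : (\int[P]_w x%:E = x%:E)%E.
Proof.
have := integral_cst P measurableT x%:E; rewrite /cst => ->.
by have PT : (P setT = 1)%E := probability_setT P; rewrite [X in (_ * X)%E](_ : _ = 1%E) ?mule1.
Qed.

Lemma four_moments : exists m4 : nat -> R, exists V : R,
  (forall i, (\int[P]_w (g i.+1 w ^+ 4)%:E = (m4 i)%:E)%E) /\
  (forall N, \sum_(i < N) m4 i / i.+1%:R ^+ 2 <= V).
Proof.
pose a n := ('E_P[fun w => (g n w ^+ 4)%R] * (n%:R ^- 2)%:E)%E.
have E0 n : (0 <= \int[P]_w (g n w ^+ 4)%:E)%E.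
  apply: integral_ge0 => w _; rewrite lee_fin (_ : 4%N = (2 * 2)%N)// exprM sqr_ge0//.
have a0 n : (0 <= a n)%E.
  rewrite /a unlock mule_ge0// lee_fin invr_ge0 sqr_ge0//.
have aS N : (\sum_(1 <= n < N) a n <= \sum_(1 <= n <oo) a n)%E.
  by apply: nneseries_lim_ge.
have [V VE] : exists V, (\sum_(1 <= n <oo) a n = V%:E)%E.
  exists (fine (\sum_(1 <= n <oo) a n)%E); rewrite fineK// ge0_fin_numE//.
  by apply: nneseries_ge0.
have afin i : a i.+1 \is a fin_num.
  rewrite ge0_fin_numE// (@le_lt_trans _ _ V%:E) ?ltry// -VE.
  apply: le_trans (aS i.+2); rewrite big_nat_recr//= leeDr// sume_ge0//.
have Efin i : (\int[P]_w (g i.+1 w ^+ 4)%:E)%E \is a fin_num.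
  rewrite ge0_fin_numE// ltNge leye_eq; apply/negP => /eqP EE.
  have := afin i; rewrite /a unlock EE gt0_mulye// lte_fin invr_gt0 exprn_gt0// ltr0n//.
exists (fun i => fine (\int[P]_w (g i.+1 w ^+ 4)%:E)%E), V; split.
  by move=> i; rewrite fineK.
move=> N; rewrite -lee_fin -VE; apply: le_trans (aS N.+1).
rewrite -sumEFin big_add1/= big_mkord le_eqVlt; apply/orP; left; apply/eqP.
apply: eq_bigr => i _; rewrite /a unlock EFinM fineK//.
Qed.

Lemma centered_sqr (m4 : nat -> R) i : (\int[P]_w (g i.+1 w ^+ 4)%:E = (m4 i)%:E)%E ->
  [/\ P.-integrable setT (fun w => (g i.+1 w ^+ 2 - lam ^+ 2)%:E),
      (\int[P]_w (g i.+1 w ^+ 2 - lam ^+ 2)%:E = 0)%E &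
      (\int[P]_w ((g i.+1 w ^+ 2 - lam ^+ 2) ^+ 2)%:E <= (m4 i)%:E)%E].
Proof.
move=> m4E.
have i2 : P.-integrable setT (fun w => (g i.+1 w ^+ 2)%:E).
  apply/integrableP; split; first exact: mg_pow.
  under eq_integral do rewrite gee0_abs ?lee_fin ?sqr_ge0//.
  by rewrite var2 ltry.
have ic : P.-integrable setT (fun=> (lam ^+ 2)%:E).
  exact: finite_measure_integrable_cst.
have mD : measurable_fun setT (fun w => ((g i.+1 w ^+ 2 - lam ^+ 2) ^+ 2)%:E).
  apply/measurable_EFinP; apply: measurable_funX; apply: measurable_funB => //.
  by apply: measurable_funX; exact: mg.
have cE := int_cst (lam ^+ 2).
split.
- by under eq_fun do rewrite EFinB; apply: integrableB.
- under eq_integral do rewrite EFinB.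
  by rewrite integralB// var2 cE subee.
(* Moving the cross term to the left makes every integrand nonnegative, so the integrals can be
   added before the square is known to be integrable. *)
- have H : (\int[P]_w (((g i.+1 w ^+ 2 - lam ^+ 2) ^+ 2)%:E + (2 * lam ^+ 2)%:E * (g i.+1 w ^+ 2)%:E) =
     \int[P]_w ((g i.+1 w ^+ 4)%:E + (lam ^+ 4)%:E))%E.
    by apply: eq_integral => w _; rewrite -EFinM -!EFinD; congr (_%:E); ring.
  have l20 : 0 <= 2 * lam ^+ 2 by rewrite mulr_ge0 ?sqr_ge0.
  move: H; rewrite ge0_integralD//; first last.
  - by apply: measurable_funeM; exact: mg_pow.
  - by move=> w _; rewrite -EFinM lee_fin mulr_ge0 ?sqr_ge0.
  - by move=> w _; rewrite lee_fin sqr_ge0.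
  rewrite ge0_integralD//; first last.
  - by move=> w _; rewrite lee_fin (_ : 4%N = (2 * 2)%N)// exprM sqr_ge0.
  - exact: mg_pow.
  - by move=> w _; rewrite lee_fin (_ : 4%N = (2 * 2)%N)// exprM sqr_ge0.
  rewrite ge0_integralZl//; first last.
  - by move=> w _; rewrite lee_fin sqr_ge0.
  - exact: mg_pow.
  have l4E : (\int[P]_w (lam ^+ 4)%:E = (lam ^+ 4)%:E)%E by exact: int_cst.
  rewrite var2 m4E l4E -EFinM -EFinD.
  case: (\int[P]_w _)%E => [r| |]//=; rewrite -?EFinD => -[].
  rewrite lee_fin => rE; have : 0 <= lam ^+ 4 by rewrite (_ : 4%N = (2 * 2)%N)// exprM sqr_ge0.
  move: rE; have -> : 2 * lam ^+ 2 * lam ^+ 2 = 2 * lam ^+ 4 by ring.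
  lra.
Qed.

End Moments.

(** * Closure properties of adapted variables *)

Section AdaptedAlgebra.
Context d (T : measurableType d) (R : realType).
Variables (g : nat -> T -> R) (n : nat).
Implicit Types X Y : T -> R.

Lemma adapted_cst (x : R) : adapted g n (fun=> x).
Proof. exact: measurable_cst. Qed.

Lemma adaptedD X Y : adapted g n X -> adapted g n Y -> adapted g n (fun w => X w + Y w).
Proof. by move=> aX aY; exact: measurable_funD. Qed.

Lemma adaptedB X Y : adapted g n X -> adapted g n Y -> adapted g n (fun w => X w - Y w).
Proof. by move=> aX aY; exact: measurable_funB. Qed.

Lemma adaptedM X Y : adapted g n X -> adapted g n Y -> adapted g n (fun w => X w * Y w).
Proof. by move=> aX aY; exact: measurable_funM. Qed.

Lemma adaptedX X k : adapted g n X -> adapted g n (fun w => X w ^+ k).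
Proof. by move=> aX; exact: measurable_funX. Qed.

Lemma adaptedV X : adapted g n X -> adapted g n (fun w => (X w)^-1).
Proof. by move=> aX; apply: (measurableT_comp (@measurable_invr R) aX). Qed.

Lemma adapted_max X Y : adapted g n X -> adapted g n Y -> adapted g n (fun w => Num.max (X w) (Y w)).
Proof. by move=> aX aY; exact: measurable_maxr. Qed.

Lemma adapted_min X Y : adapted g n X -> adapted g n Y -> adapted g n (fun w => Num.min (X w) (Y w)).
Proof. by move=> aX aY; exact: measurable_minr. Qed.

End AdaptedAlgebra.

Ltac adapt := rewrite /=; repeat first
  [ assumption | exact: adapted_cst | apply: adaptedB | apply: adaptedD | apply: adaptedM
  | apply: adaptedX | apply: adaptedV ].

(** * The coefficient vectors do not vanish *)

Section Coefficients.
Context {R : realType}.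
Variables z1 z2 dz1 dz2 : R -> R.
Let W := wz z1 z2 dz1 dz2 0.
Hypothesis W0 : W != 0.

Lemma cross_prop0 g theta theta' m :
  cross (prop z1 z2 dz1 dz2 W g theta m) (prop z1 z2 dz1 dz2 W g theta' m) =
  (sin theta * cos theta' - cos theta * sin theta') / W.
Proof.
rewrite cross_prop /cross /=.
have := W0; rewrite /W /wz /wronsk => w0; field.
by move: w0; rewrite -?mulNr.
Qed.

(** The cross product with the solution of angle [theta + pi / 2] is [- 1 / W] in every cell. *)
Lemma prop_neq0 g theta m : prop z1 z2 dz1 dz2 W g theta m != (0, 0).
Proof.
apply/eqP => e; have := cross_prop0 g theta (theta + pi / 2) m.
rewrite e /cross /= !mul0r subrr => /eqP; rewrite eq_sym mulf_eq0 invr_eq0 (negPf W0) orbF.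
rewrite sinDpihalf cosDpihalf mulrN -opprD oppr_eq0 -!expr2 addrC cos2Dsin2.
by rewrite oner_eq0.
Qed.

End Coefficients.

(** * Truncation *)

Section Clamp.
Context {R : realType}.

Definition clamp (c x : R) : R := Num.max (- c) (Num.min c x).

Lemma clamp_bound c x : 0 <= c -> `|clamp c x| <= c.
Proof.
move=> c0; rewrite /clamp ler_norml le_max lexx/= ge_max ge_min lexx/= andbT.
lra.
Qed.

Lemma clamp_id c x : `|x| <= c -> clamp c x = x.
Proof. by rewrite ler_norml /clamp => /andP[h1 h2]; rewrite min_r// max_r. Qed.

End Clamp.

(** * Almost sure boundedness for general coefficients *)

Section Events.
Context d (T : measurableType d) (R : realType) (P : probability T R).
Variables (lam : R) (g : nat -> T -> R).
Hypothesis mg : forall n, (1 <= n)%N -> measurable_fun setT (g n).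
Hypothesis ind : mutually_independent P [set n | (1 <= n)%N] g.
Hypothesis g_mean : forall n, (1 <= n)%N ->
  P.-integrable setT (EFin \o g n) /\ ('E_P[g n] = 0)%E.
Hypothesis g_var : forall n, (1 <= n)%N ->
  ('E_P[fun w => (g n w ^+ 2)%R] = (lam ^+ 2)%:E)%E.
Hypothesis g_four : (\sum_(1 <= n <oo) ('E_P[fun w => (g n w ^+ 4)%R] * (n%:R ^- 2)%:E) < +oo)%E.

Variables (F E : R) (i0 : nat).
Hypothesis F0 : 0 < F.
Hypothesis hi0 : forall i, (i0 <= i)%N -> 1 + F <= freq2 F E i.
Local Notation kap := (freq F E).
Local Notation om := (wgt F E i0).
Local Notation L := (clock F E i0).

(** From [F (i + 1) = freq2 i - E] and [freq2 i >= 1]. It matches the weights with the factor [n^-2]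
    of the fourth-moment series. *)
Lemma wgt_le_harmonic i : om i <= (1 + `|E|) / F / i.+1%:R.
Proof.
have i1 : 0 < i.+1%:R :> R by rewrite ltr0n.
have K0 : 0 <= (1 + `|E|) / F by rewrite divr_ge0 ?addr_ge0// ltW.
rewrite /wgt; case: ltnP => ii; first by rewrite divr_ge0// ltW.
have h : 1 <= freq2 F E i by apply: le_trans (hi0 ii); rewrite lerDl ltW.
have q0 : 0 < freq2 F E i := freq2_gt0 F0 hi0 ii.
rewrite -[leLHS]mul1r ler_pdivrMr// mulrAC ler_pdivlMr// mul1r mulrAC ler_pdivlMr// mulrC.
have : `|E| <= `|E| * freq2 F E i by rewrite ler_peMr.
have := ler_norm (- E); rewrite normrN mulrDl mul1r {2}/freq2; lra.
Qed.

Lemma freq_ge_sqrt i : (i0 <= i)%N -> i.+1%:R <= (1 + `|E|) / F * kap i ^+ 2.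
Proof.
move=> ii; have := wgt_le_harmonic i; rewrite (wgtE F0 hi0 ii).
have k0 : 0 < kap i ^+ 2 by rewrite exprn_gt0// (freq_gt0 F0 hi0 ii).
have i1 : 0 < i.+1%:R :> R by rewrite ltr0n.
by rewrite ler_pdivlMr// mulrC ler_pdivrMr.
Qed.

(** The discrete form of the integral of [(1 + s)^(- 3 / 2)], equal to [2]: with [s = sqrt (1 + L)]
    the sum is dominated by the telescoping sum of [2 / s]. *)
Lemma damp_sum n : \sum_(i < n) om i / damp F E i0 i ^+ 2 <= 2.
Proof.
pose s i := Num.sqrt (1 + L i).
have L0 i : 0 <= L i by exact: clock_ge0.
have s2 i : s i ^+ 2 = 1 + L i by rewrite sqr_sqrtr// addr_ge0.
have s0 i : 0 < s i by rewrite sqrtr_gt0 ltr_wpDr.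
have key m : \sum_(i < m) om i / damp F E i0 i ^+ 2 <= 2 * ((s 0%N)^-1 - (s m)^-1).
  elim: m => [|m IH]; first by rewrite big_ord0 subrr mulr0.
  rewrite big_ord_recr/= (le_trans (lerD IH (lexx _)))//.
  have sm : s m <= s m.+1.
    by rewrite ler_sqrt ?addr_ge0// lerD2l clock_le.
  have -> : om m / damp F E i0 m ^+ 2 = (s m.+1 - s m) * (s m.+1 + s m) / s m.+1 ^+ 3.
    have -> : damp F E i0 m ^+ 2 = s m.+1 ^+ 3.
      rewrite /damp exprMn -/(s m.+1) [Num.sqrt (s _) ^+ 2]sqr_sqrtr ?(ltW (s0 _))//.
      by rewrite [RHS]exprSr.
    rewrite -[X in X / _](_ : s m.+1 ^+ 2 - s m ^+ 2 = _); last by rewrite !s2 clockS; ring.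
    by congr (_ / _); ring.
  rewrite -[leRHS](_ : 2 * ((s 0%N)^-1 - (s m)^-1) + 2 * ((s m)^-1 - (s m.+1)^-1) = _); last by ring.
  rewrite lerD2l.
  have := s0 m; have := s0 m.+1; move: (s m) (s m.+1) sm => u t ut t0 u0.
  have -> : 2 * (u^-1 - t^-1) = (t - u) * (2 / (u * t)) by field; rewrite !gt_eqF.
  rewrite -mulrA ler_wpM2l ?subr_ge0// ler_pdivrMr ?exprn_gt0//.
  have -> : 2 / (u * t) * t ^+ 3 = 2 * t ^+ 2 / u by field; rewrite !gt_eqF.
  rewrite ler_pdivlMr//; have : u * u <= t * t by rewrite ler_pM// ltW.
  have : t * u <= t * t by rewrite ler_wpM2l// ltW.
  by rewrite expr2; lra.
apply: (le_trans (key n)).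
have : s 0%N = 1 by rewrite /s /clock big_ord0 addr0 sqrtr1.
move=> ->; rewrite invr1; have : 0 <= (s n)^-1 by rewrite invr_ge0 ltW.
lra.
Qed.

Lemma msum_id_bounded (Z : nat -> T -> R) (z : nat -> R) V :
  (forall i, adapted g i.+1 (Z i)) -> (forall i w, `|Z i w| <= z i) ->
  (forall n, \sum_(i < n) z i ^+ 2 <= V) ->
  {ae P, forall w, exists B, forall n, `|\sum_(i < n) Z i w * g i.+1 w| <= B}.
Proof.
move=> aZ Zz zV.
apply: (@msum_bounded _ _ _ P g mg ind Z (fun=> id) z (fun=> lam ^+ 2) aZ Zz _ _ _ _ (V * lam ^+ 2)).
- by move=> i; exact: measurable_id.
- by move=> i; have [] := mean0 g_mean i.
- by move=> i; have [] := mean0 g_mean i.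
- by move=> i; rewrite (var2 g_var).
- by move=> n; rewrite -mulr_suml ler_wpM2r ?sqr_ge0.
Qed.

(** The term of index [i] has second moment at most [(K om)^2] times the fourth moment of [g i.+1],
    and [om = O(1 / n)]: the total is the fourth-moment series. *)
Lemma square_sum_bounded (H : nat -> T -> R) (K : R) :
  (forall i, adapted g i.+1 (fun w => om i * H i w)) ->
  (forall i w, `|om i * H i w| <= K * om i) ->
  {ae P, forall w, exists B, forall n,
     `|\sum_(i < n) om i * H i w * (g i.+1 w ^+ 2 - lam ^+ 2)| <= B}.
Proof.
move=> aH Hb; have [m4 [V [m4E m4V]]] := four_moments g_four.
have om0 i : 0 <= om i := wgt_ge0 F0 hi0 i.
pose K2 := (1 + `|E|) / F.
have m40 i : 0 <= m4 i.
  by rewrite -lee_fin -m4E integral_ge0// => w _; rewrite lee_fin (exprM _ 2 2) sqr_ge0.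
apply: (@msum_bounded _ _ _ P g mg ind (fun i w => om i * H i w) (fun=> fun x => x ^+ 2 - lam ^+ 2)
   (fun i => K * om i) m4 aH Hb _ _ _ _ ((K * K2) ^+ 2 * V)).
- move=> i; apply: measurable_funB => //; exact: measurable_funX.
- by move=> i; have [] := centered_sqr mg g_var (m4E i).
- by move=> i; have [] := centered_sqr mg g_var (m4E i).
- by move=> i; have [] := centered_sqr mg g_var (m4E i).
- move=> n; apply: (@le_trans _ _ ((K * K2) ^+ 2 * \sum_(i < n) m4 i / i.+1%:R ^+ 2)); last first.
    by rewrite ler_wpM2l ?sqr_ge0.
  rewrite mulr_sumr; apply: ler_sum => i _.
  have -> : (K * K2) ^+ 2 * (m4 i / i.+1%:R ^+ 2) = (K ^+ 2 * (K2 / i.+1%:R) ^+ 2) * m4 i.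
    by rewrite expr_div_n; ring.
  rewrite ler_wpM2r// exprMn ler_wpM2l ?sqr_ge0// ler_sqr ?nnegrE//; first exact: wgt_le_harmonic.
  by rewrite divr_ge0// divr_ge0 ?addr_ge0// ltW.
Qed.

End Events.

(** * Almost sure boundedness of the sums attached to the coefficients *)

Section CoefficientEvents.
Context d (T : measurableType d) (R : realType) (P : probability T R).
Variables (lam : R) (g : nat -> T -> R).
Hypothesis mg : forall n, (1 <= n)%N -> measurable_fun setT (g n).
Hypothesis ind : mutually_independent P [set n | (1 <= n)%N] g.
Hypothesis g_mean : forall n, (1 <= n)%N ->
  P.-integrable setT (EFin \o g n) /\ ('E_P[g n] = 0)%E.
Hypothesis g_var : forall n, (1 <= n)%N ->
  ('E_P[fun w => (g n w ^+ 2)%R] = (lam ^+ 2)%:E)%E.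
Hypothesis g_four : (\sum_(1 <= n <oo) ('E_P[fun w => (g n w ^+ 4)%R] * (n%:R ^- 2)%:E) < +oo)%E.
Variables (F E : R) (i0 : nat).
Hypothesis F0 : 0 < F.
Hypothesis hi0 : forall i, (i0 <= i)%N -> 1 + F <= freq2 F E i.
Local Notation kap := (freq F E).
Local Notation om := (wgt F E i0).
Local Notation L := (clock F E i0).

Variables z1 z2 dz1 dz2 : R -> R.
Let W := wz z1 z2 dz1 dz2 0.

Definition coef theta w : nat -> R * R := prop z1 z2 dz1 dz2 W (fun n => g n w) theta.

Lemma coef_adapted theta m :
  adapted g m.+1 (fun w => (coef theta w m).1) /\ adapted g m.+1 (fun w => (coef theta w m).2).
Proof.
elim: m => [|m [IH1 IH2]]; first by split; adapt.
have ag : adapted g m.+2 (g m.+1) by apply: adapted_g; rewrite ltnSn.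
have {}IH1 := adapted_le (leqnSn m.+1) IH1; have {}IH2 := adapted_le (leqnSn m.+1) IH2.
by rewrite /coef /= /kick /comb; split; adapt.
Qed.

Definition coef_sig theta w := sig (site_a F E z1 z2 (coef theta w))
  (site_b dz1 dz2 (coef theta w)) (site_c F E).
Definition coef_hgt theta w := hgt (site_a F E z1 z2 (coef theta w))
  (site_b dz1 dz2 (coef theta w)) (site_c F E).

Lemma coef_sig_adapted theta i : adapted g i.+1 (fun w => coef_sig theta w i).
Proof.
have [h1 h2] := coef_adapted theta i.
by rewrite /coef_sig /sig /form /site_a /site_b /comb; adapt.
Qed.

Lemma coef_hgt_adapted theta i : adapted g i.+1 (fun w => coef_hgt theta w i).
Proof.
have [h1 h2] := coef_adapted theta i.
by rewrite /coef_hgt /hgt /frac /sig /form /site_a /site_b /comb; adapt.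
Qed.

Hypothesis W0 : W != 0.

Hypothesis WE : forall m x, m%:R <= x <= m.+1%:R -> wz z1 z2 dz1 dz2 x = W.

Lemma coef_neq0 theta w i : coef theta w i != (0, 0).
Proof. exact: prop_neq0. Qed.

Lemma coef_rad theta w i : (i0 <= i)%N ->
  0 < site_a F E z1 z2 (coef theta w) i ^+ 2 + site_b dz1 dz2 (coef theta w) i ^+ 2.
Proof. exact: (site_rad F0 hi0 W0 WE (coef_neq0 theta w)). Qed.

Lemma coef_sig_bound theta w i : (i0 <= i)%N -> `|coef_sig theta w i| <= 2.
Proof. exact: (sig_bound (site_c_bound F0 hi0) (coef_rad theta w)). Qed.

Lemma coef_hgt_bound theta w i : (i0 <= i)%N -> `|coef_hgt theta w i| <= 4.
Proof.
move=> ii; have s2 := coef_sig_bound theta w ii.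
have /andP[f0 f2] := frac_bound (site_c_bound F0 hi0) (coef_rad theta w) ii.
have ss : coef_sig theta w i ^+ 2 <= 2 ^+ 2 by rewrite -real_normK ?num_real// ler_sqr ?nnegrE.
have := sqr_ge0 (coef_sig theta w i).
by rewrite /coef_hgt /hgt -/(coef_sig theta w) ler_norml; move: ss; rewrite [2 ^+ 2]expr2; lra.
Qed.

Lemma sig_sum_bounded theta :
  {ae P, forall w, exists B, forall n,
   `|\sum_(i < n) (if (i < i0)%N then 0 else
       coef_sig theta w i / (kap i * damp F E i0 i) * g i.+1 w)| <= B}.
Proof.
pose Z i w := if (i < i0)%N then 0 else coef_sig theta w i / (kap i * damp F E i0 i).
pose z i := if (i < i0)%N then 0 else 2 / (kap i * damp F E i0 i).
have aZ i : adapted g i.+1 (Z i).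
  rewrite /Z; case: (ltnP i i0) => _; first by adapt.
  by have h := @coef_sig_adapted theta i; adapt.
have Zz i w : `|Z i w| <= z i.
  rewrite /Z /z; case: ltnP => ii; first by rewrite normr0.
  have k0 : 0 < kap i * damp F E i0 i by rewrite mulr_gt0 ?(freq_gt0 F0 hi0 ii) ?(damp_gt0 F0 hi0).
  by rewrite normrM normfV (gtr0_norm k0) ler_pM2r ?invr_gt0// coef_sig_bound.
have zV n : \sum_(i < n) z i ^+ 2 <= 4 * 2.
  apply: (@le_trans _ _ (4 * \sum_(i < n) om i / damp F E i0 i ^+ 2)); last first.
    by rewrite ler_wpM2l// damp_sum.
  rewrite mulr_sumr; apply: ler_sum => i _; rewrite /z; case: ltnP => ii.
    by rewrite /wgt ii !mul0r expr2 !mulr0.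
  by rewrite (wgtE F0 hi0 ii) expr_div_n exprMn invfM le_eqVlt; apply/orP; left; apply/eqP; ring.
apply: filterS (msum_id_bounded mg ind g_mean g_var aZ Zz zV) => w [B HB].
exists B => n; have := HB n; congr (`|_| <= _); apply: eq_bigr => i _.
by rewrite /Z; case: ifP => _ //; rewrite mul0r.
Qed.

Lemma wgt_sum_bounded :
  {ae P, forall w, exists B, forall n, `|\sum_(i < n) om i * (g i.+1 w ^+ 2 - lam ^+ 2)| <= B}.
Proof.
have aH i : adapted g i.+1 (fun w => om i * (fun (j : nat) (_ : T) => 1) i w) by adapt.
have Hb i w : `|om i * (fun (j : nat) (_ : T) => 1) i w| <= 1 * om i.
  by rewrite mulr1 mul1r ger0_norm// (wgt_ge0 F0 hi0).
apply: filterS (square_sum_bounded mg ind g_var g_four F0 hi0 aH Hb) => w [B HB].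
exists B => n; have := HB n; congr (`|_| <= _); apply: eq_bigr => i _.
by rewrite mulr1.
Qed.

Lemma hgt_sum_bounded theta :
  {ae P, forall w, exists B, forall n,
   `|\sum_(i < n) om i * coef_hgt theta w i * (g i.+1 w ^+ 2 - lam ^+ 2)| <= B}.
Proof.
apply: (@square_sum_bounded _ _ _ P lam g mg ind g_var g_four F E i0 F0 hi0
  (fun i w => coef_hgt theta w i) 4) => [i|i w].
  by have h := @coef_hgt_adapted theta i; adapt.
have o0 : 0 <= om i := wgt_ge0 F0 hi0 i.
have [ii|ii] := ltnP i i0; first by rewrite /wgt ii mul0r mulr0 normr0.
by rewrite normrM (ger0_norm o0) mulrC ler_wpM2r// coef_hgt_bound.
Qed.

Let p i := z1 i.+1%:R.
Let q i := z2 i.+1%:R.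

Definition rat_step theta theta' tau w i :=
  if (i < i0)%N then 0 else expR (tau * L i) *
    (det (coef theta w) (coef theta' w) 0%N * lin W p q (coef theta' w) i / nrm (coef theta' w) i ^+ 2).

(* Cutting the coefficient [rat_step] at [M * rat_cut] makes the martingale square-integrable;
   almost surely [nrm] grows so fast that the cut is inactive for some [M]. *)
Definition rat_cut del i := if (i < i0)%N then 0 else expR (- del * L i) / kap i.

Lemma det_coef theta theta' w i :
  det (coef theta w) (coef theta' w) i = (sin theta' * cos theta - cos theta' * sin theta) / W.
Proof. by rewrite -(cross_prop0 W0 (fun n => g n w) theta' theta i). Qed.

Lemma rat_step_adapted theta theta' tau i : adapted g i.+1 (fun w => rat_step theta theta' tau w i).
Proof.
rewrite /rat_step; case: (ltnP i i0) => _; first by adapt.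
under eq_fun do rewrite det_coef.
have [h1 h2] := coef_adapted theta' i.
by rewrite /lin /nrm /zs /vs; adapt.
Qed.

Lemma rat_cut_ge0 del i : 0 <= rat_cut del i.
Proof.
rewrite /rat_cut; case: ltnP => // ii.
by rewrite divr_ge0 ?expR_ge0// ltW// (freq_gt0 F0 hi0).
Qed.

(** The squared cut is [M^2 exp (- 2 del L) om], which [expclock_sum] sums. An integer [M] keeps the
    number of exceptional sets countable. *)
Lemma rat_sum_bounded theta theta' tau del (M : nat) : 0 < del ->
  {ae P, forall w, exists B, forall n,
   `|\sum_(i < n) clamp (M%:R * rat_cut del i) (rat_step theta theta' tau w i) * g i.+1 w| <= B}.
Proof.
move=> del0.
have aZ i : adapted g i.+1 (fun w => clamp (M%:R * rat_cut del i) (rat_step theta theta' tau w i)).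
  apply: adapted_max; first by adapt.
  by apply: adapted_min; [adapt|exact: rat_step_adapted].
have Zz i w : `|clamp (M%:R * rat_cut del i) (rat_step theta theta' tau w i)| <= M%:R * rat_cut del i.
  by rewrite clamp_bound// mulr_ge0 ?rat_cut_ge0.
apply: (msum_id_bounded mg ind g_mean g_var aZ Zz (V := M%:R ^+ 2 * ((1 + 2 * del) / (2 * del)))) => n.
have d0 : 0 < 2 * del by lra.
apply: (@le_trans _ _ (M%:R ^+ 2 * \sum_(i < n) expR (- (2 * del) * L i) * om i)); last first.
  by rewrite ler_wpM2l ?sqr_ge0// expclock_sum.
rewrite mulr_sumr; apply: ler_sum => i _; rewrite exprMn ler_wpM2l ?sqr_ge0//.
rewrite /rat_cut; case: ltnP => ii; first by rewrite /wgt ii expr2 !mulr0.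
rewrite (wgtE F0 hi0 ii) expr_div_n -expRM_natl.
by rewrite [- (2 * del) * L i](_ : _ = 2 * (- del * L i))//; ring.
Qed.

End CoefficientEvents.

(** * The ratio of the Prüfer radii on one path *)

Section PrueferRatio.
Context {R : realType}.
Variables (F E : R) (i0 : nat).
Hypothesis F0 : 0 < F.
Hypothesis hi0 : forall i, (i0 <= i)%N -> 1 + F <= freq2 F E i.
Variables z1 z2 dz1 dz2 : R -> R.
Hypothesis z1d : forall x, isd z1 x (dz1 x).
Hypothesis z2d : forall x, isd z2 x (dz2 x).
Hypothesis dz1c : continuous dz1.
Hypothesis dz2c : continuous dz2.
Let W := wz z1 z2 dz1 dz2 0.
Hypothesis W0 : W != 0.
Hypothesis WE : forall m x, m%:R <= x <= m.+1%:R -> wz z1 z2 dz1 dz2 x = W.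
Hypothesis zsol : forall m, solves_in m (fun x => F * x + E) z1 dz1 /\
  solves_in m (fun x => F * x + E) z2 dz2.
Variables (lam : R) (g : nat -> R).
Hypothesis rel0 : to0 (rel F E (fun i => g i.+1)).

Local Notation kap := (freq F E).
Local Notation om := (wgt F E i0).
Local Notation L := (clock F E i0).
Local Notation cf := (prop z1 z2 dz1 dz2 W g).
Local Notation csig theta := (sig (site_a F E z1 z2 (cf theta)) (site_b dz1 dz2 (cf theta)) (site_c F E)).
Local Notation chgt theta := (hgt (site_a F E z1 z2 (cf theta)) (site_b dz1 dz2 (cf theta)) (site_c F E)).
Let p i := z1 i.+1%:R.
Let q i := z2 i.+1%:R.

Lemma nrm_prop_gt0 theta i : 0 < nrm (cf theta) i.
Proof.
rewrite /nrm lt_def addr_ge0 ?sqr_ge0// andbT paddr_eq0 ?sqr_ge0// !sqrf_eq0.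
by have := prop_neq0 W0 g theta i; rewrite -/W; case: (cf theta i).
Qed.

Lemma nrm_growth theta (B1 B2 B3 e : R) :
  (forall n, `|\sum_(i < n) (if (i < i0)%N then 0 else
     csig theta i / (kap i * damp F E i0 i) * g i.+1)| <= B1) ->
  (forall n, `|\sum_(i < n) om i * chgt theta i * (g i.+1 ^+ 2 - lam ^+ 2)| <= B2) ->
  (forall n, `|\sum_(i < n) om i * (g i.+1 ^+ 2 - lam ^+ 2)| <= B3) ->
  0 < e -> exists2 K, 0 <= K &
    forall i, expR ((lam ^+ 2 / 4 - e) * L i) / nrm (cf theta) i <= K.
Proof.
move=> M1 M2 M3 e0.
have CS i : cf theta i.+1 = kick z1 z2 W i.+1 (g i.+1) (cf theta i) by [].
have C0 i : cf theta i != (0, 0) by exact: prop_neq0.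
have [Kz Kz0 zK] := size2_z F0 hi0 z1d z2d dz1c dz2c zsol.
have rad := site_rad F0 hi0 W0 WE C0.
have [N HN] := energy_growth F0 hi0 (site_c_bound F0 hi0) (site_c_freq F0 hi0) rad
  (site_rot F0 hi0 z1d z2d dz1c dz2c W0 WE zsol (gam := fun i => g i.+1) CS)
  (site_step F0 hi0 z1d z2d dz1c dz2c W0 WE zsol (gam := fun i => g i.+1) CS C0) rel0 M1 M2 M3 e0.
have [K K0 HK] := prefix_bound (fun i => expR ((lam ^+ 2 / 4 - e) * L i) / nrm (cf theta) i) (maxn N i0).
exists (K + 5 * Kz) => [|i]; first by rewrite addr_ge0 ?mulr_ge0.
have n0 := nrm_prop_gt0 theta i.
have [ii|] := ltnP i (maxn N i0).
  apply: le_trans (ler_norm _) _; apply: (le_trans (HK _ ii)).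
  by rewrite lerDl mulr_ge0.
rewrite geq_max => /andP[/HN h ii].
have en0 := en_gt0 F0 hi0 (site_c_bound F0 hi0) rad ii.
rewrite (@le_trans _ _ (5 * Kz)) ?lerDr// ler_pdivrMr//.
apply: le_trans (en_le_nrm F0 hi0 (cf theta) Kz0 zK ii).
by rewrite -[leRHS]lnK// ler_expR.
Qed.

Section OnePair.
Variables (theta theta' tau del K2 B3 : R).
Hypothesis tau0 : 0 < tau.
Hypothesis del0 : 0 < del.
Hypothesis K20 : 0 <= K2.
Hypothesis growth : forall i, expR ((tau + del) * L i) / nrm (cf theta') i <= K2.
Hypothesis M3 : forall n, `|\sum_(i < n) om i * (g i.+1 ^+ 2 - lam ^+ 2)| <= B3.
Hypothesis M4 : forall M : nat, exists B, forall n, `|\sum_(i < n)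
   clamp (M%:R * (if (i < i0)%N then 0 else expR (- del * L i) / kap i))
     (if (i < i0)%N then 0 else expR (tau * L i) *
       (det (cf theta) (cf theta') 0%N * lin W p q (cf theta') i / nrm (cf theta') i ^+ 2)) * g i.+1| <= B.

Lemma rat_prop_rate : exists2 K, 0 <= K & forall n m, (n <= m)%N ->
  `|rat (cf theta) (cf theta') m - rat (cf theta) (cf theta') n| <= K * expR (- tau * L n).
Proof.
have [Kz Kz0 zK] := size2_z F0 hi0 z1d z2d dz1c dz2c zsol.
have pq i : (i0 <= i)%N -> p i ^+ 2 + q i ^+ 2 <= 2 * Kz / kap i := @z_bound _ _ _ _ F0 hi0 _ _ _ _ _ zK i.
have aw : 0 < `|W| by rewrite normr_gt0.
have gr i : expR (tau * L i) / nrm (cf theta') i <= K2 * expR (- del * L i).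
  have -> : tau * L i = (tau + del) * L i + - del * L i by ring.
  by rewrite expRD mulrAC ler_wpM2r ?expR_ge0.
have CS th i : cf th i.+1 = kickv W p q (fun i => g i.+1) i (cf th i) by [].
set x := fun i => if (i < i0)%N then 0 else expR (tau * L i) *
       (det (cf theta) (cf theta') 0%N * lin W p q (cf theta') i / nrm (cf theta') i ^+ 2).
pose c i := if (i < i0)%N then 0 else expR (- del * L i) / kap i.
(* [4 * Kz] comes from [lin_bound] with [p^2 + q^2 <= 2 * Kz / kap], and [K2] from the growth of
   [nrm]. An integer cut [M >= M0] leaves every coefficient unchanged. *)
pose M0 := `|det (cf theta) (cf theta') 0%N| * (4 * Kz / `|W|) * K2.
have [M HM] : exists M : nat, M0 <= M%:R.
  exists (Num.bound `|M0|); apply/ltW/(le_lt_trans (ler_norm _)).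
  exact: archi_boundP (normr_ge0 _).
have xc i : `|x i| <= M%:R * c i.
  rewrite /x /c; case: ltnP => ii; first by rewrite normr0 mulr0.
  have k0 := freq_gt0 F0 hi0 ii; have n0 := nrm_prop_gt0 theta' i.
  have lb := lin_bound p q (cf theta') W0 i.
  have lb' : `|lin W p q (cf theta') i| <= nrm (cf theta') i * (4 * Kz / `|W| / kap i).
    apply: (le_trans lb).
    have -> : nrm (cf theta') i * (4 * Kz / `|W| / kap i) =
      2 * nrm (cf theta') i * (2 * Kz / kap i) / `|W| by ring.
    by rewrite ler_pM2r ?invr_gt0// ler_pM2l ?pq// mulr_gt0.
  rewrite !normrM normfV normrX (gtr0_norm n0) (ger0_norm (expR_ge0 _)).
  apply: (@le_trans _ _ (M0 * (expR (- del * L i) / kap i))); last first.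
    by rewrite ler_wpM2r ?divr_ge0 ?expR_ge0// ltW.
  have -> : M0 * (expR (- del * L i) / kap i) = `|det (cf theta) (cf theta') 0%N| *
    ((4 * Kz / `|W| / kap i) * (K2 * expR (- del * L i))) by rewrite /M0; ring.
  have -> : forall a b d' n : R, a * (d' * b / n ^+ 2) = d' * (b * (a / n ^+ 2)) by move=> *; ring.
  rewrite ler_wpM2l//.
  apply: (@le_trans _ _ ((nrm (cf theta') i * (4 * Kz / `|W| / kap i)) *
     (expR (tau * L i) / nrm (cf theta') i ^+ 2))).
    by rewrite ler_wpM2r// divr_ge0 ?expR_ge0 ?sqr_ge0.
  have -> : nrm (cf theta') i * (4 * Kz / `|W| / kap i) * (expR (tau * L i) / nrm (cf theta') i ^+ 2) =
     (4 * Kz / `|W| / kap i) * (expR (tau * L i) / nrm (cf theta') i).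
    by field; rewrite !gt_eqF.
  by rewrite ler_wpM2l// divr_ge0 ?(ltW k0)// divr_ge0 ?mulr_ge0 ?(ltW aw).
have [B4 HB4] := M4 M.
apply: (rat_rate F0 hi0 W0 pq (CS theta) (CS theta') rel0 (nrm_prop_gt0 theta') tau0 del0 K20
  (fun i _ => gr i) M3 (B4 := B4)) => n.
by have := HB4 n; congr (`|_| <= _); apply: eq_bigr => i _; rewrite clamp_id ?xc.
Qed.

End OnePair.

Definition pruefer_ratio theta theta' n :=
  Num.sqrt (nrm (cf theta) n) / Num.sqrt (nrm (cf theta') n).

Lemma pruefer_ratioE theta theta' n : pruefer_ratio theta theta' n =
  Num.sqrt (rat (cf theta) (cf theta') n ^+ 2 + (det (cf theta) (cf theta') n / nrm (cf theta') n) ^+ 2).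
Proof.
have n0 := nrm_prop_gt0 theta n; have n0' := nrm_prop_gt0 theta' n.
rewrite /pruefer_ratio -sqrtrV ?(ltW n0')// -sqrtrM ?(ltW n0)//; congr Num.sqrt.
by move: n0'; rewrite /rat /det /nrm => n0'; field; rewrite gt_eqF.
Qed.

(** The boundedness facts specific to the pair of angles that the pathwise argument takes from
    probability. The first two concern [theta'] alone, whose solution stands in the denominator and
    has to grow. *)
Definition ratio_events theta theta' (tau del : nat -> R) :=
  [/\ exists B, forall n, `|\sum_(i < n) (if (i < i0)%N then 0 else
        csig theta' i / (kap i * damp F E i0 i) * g i.+1)| <= B,
      exists B, forall n, `|\sum_(i < n) om i * chgt theta' i * (g i.+1 ^+ 2 - lam ^+ 2)| <= B &
      forall j (M : nat), exists B, forall n, `|\sum_(i < n)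
        clamp (M%:R * (if (i < i0)%N then 0 else expR (- del j * L i) / kap i))
          (if (i < i0)%N then 0 else expR (tau j * L i) *
             (det (cf theta) (cf theta') 0%N * lin W p q (cf theta') i / nrm (cf theta') i ^+ 2)) *
        g i.+1| <= B].

Variables (tau del : nat -> R) (B3 : R).
Hypothesis tau0 : forall j, 0 < tau j.
Hypothesis del0 : forall j, 0 < del j.
Hypothesis tau_del : forall j, tau j + del j < lam ^+ 2 / 4.
Hypothesis M3 : forall n, `|\sum_(i < n) om i * (g i.+1 ^+ 2 - lam ^+ 2)| <= B3.

Lemma pruefer_ratio_cvg theta theta' : ratio_events theta theta' tau del ->
  exists l, forall j, exists K, forall n,
    `|pruefer_ratio theta theta' n - l| <= K * expR (- tau j * L n).
Proof.
move=> [[B1 M1] [B2 M2] M4].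
have L0 n : 0 <= L n := clock_ge0 F0 hi0 n.
pose x := rat (cf theta) (cf theta').
have lim_at j : exists2 l, x @ \oo --> l & exists K, forall n,
    `|x n - l| <= K * expR (- tau j * L n) /\ (nrm (cf theta') n)^-1 <= K * expR (- tau j * L n).
  have e0 : 0 < lam ^+ 2 / 4 - (tau j + del j) by rewrite subr_gt0.
  have [K2 K20 gr] := nrm_growth M1 M2 M3 e0.
  have {}gr i : expR ((tau j + del j) * L i) / nrm (cf theta') i <= K2.
    by have := gr i; rewrite subKr.
  have [K K0 HK] := rat_prop_rate (tau0 j) (del0 j) K20 gr M3 (M4 j).
  have [l cvl Hl] := cauchy_rate (expclock_to0 F0 hi0 K (tau0 j)) (fun n m nm => HK n m nm).
  exists l => //; exists (K + K2) => n; have e1 := expR_ge0 (- tau j * L n); split.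
    rewrite distrC (le_trans (Hl n))// ler_wpM2r// lerDl//.
  apply: (@le_trans _ _ (K2 * expR (- tau j * L n))); last by rewrite ler_wpM2r// lerDr.
  rewrite mulNr expRN ler_pdivlMr ?expR_gt0// mulrC (le_trans _ (gr n))//.
  rewrite ler_wpM2r ?invr_ge0 ?(ltW (nrm_prop_gt0 _ _))// ler_expR ler_wpM2r// lerDl ltW//.
(* Each rate [tau j] produces its own limit; uniqueness of limits identifies them all with the one
   obtained for [j = 0]. *)
have [l cvl _] := lim_at 0%N.
exists `|l| => j; have [l' cvl' [K HK]] := lim_at j.
have -> : l = l' by exact: (cvg_unique (@norm_hausdorff _ _) cvl cvl').
exists (K + `|det (cf theta) (cf theta') 0%N| * K) => n.
have [h1 h2] := HK n.
have d0 : det (cf theta) (cf theta') n = det (cf theta) (cf theta') 0%N.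
  by rewrite /det; have := cross_prop z1 z2 dz1 dz2 W g theta' theta n; rewrite /cross.
(* The ratio is the length of the vector [(rat, det / nrm)] and its limit that of [(l', 0)];
   comparing lengths avoids dividing by [l']. *)
have -> : `|l'| = Num.sqrt (l' ^+ 2 + 0 ^+ 2) by rewrite expr0n addr0 sqrtr_sqr.
rewrite pruefer_ratioE; apply: (le_trans (norm2_lip _ _ _ _)).
rewrite [leRHS]mulrDl lerD// subr0 d0.
rewrite normrM normfV (gtr0_norm (nrm_prop_gt0 _ _)) -mulrA ler_wpM2l//.
Qed.

Lemma pruefer_ratio_rate theta theta' :
  ratio_events theta theta' tau del -> ratio_events theta' theta tau del ->
  exists2 rho, 0 < rho & forall j, exists K, forall n,
    `|pruefer_ratio theta theta' n - rho| <= K * expR (- tau j * L n).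
Proof.
move=> /pruefer_ratio_cvg[l Hl] /pruefer_ratio_cvg[l' Hl'].
have cv t t' u : (forall j, exists K, forall n,
    `|pruefer_ratio t t' n - u| <= K * expR (- tau j * L n)) -> pruefer_ratio t t' @ \oo --> u.
  move=> /(_ 0%N)[K HK]; apply/cvgrPdist_le => e e0.
  have [N HN] := expclock_to0 F0 hi0 K (tau0 0%N) e0.
  exists N => // n /= /HN h; rewrite distrC (le_trans (HK n))//.
  exact: le_trans (ler_norm _) h.
have r0 t t' n : 0 < pruefer_ratio t t' n by rewrite divr_gt0// sqrtr_gt0 nrm_prop_gt0.
exists l => //; rewrite lt_def; apply/andP; split; last first.
  by apply: (cvgr_to_ge (cv _ _ _ Hl)); near=> n; exact/ltW.
(* The two ratios are reciprocal, so their limits have product [1]. *)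
apply/eqP => l0; have := cvgM (cv _ _ _ Hl) (cv _ _ _ Hl').
rewrite l0 mul0r => /(_ _) c0.
have c1 : (pruefer_ratio theta theta' \* pruefer_ratio theta' theta) @ \oo --> (1 : R).
  rewrite (_ : _ \* _ = cst 1); first exact: cvg_cst.
  apply/funext => n /=; rewrite /pruefer_ratio.
  by field; rewrite !gt_eqF ?sqrtr_gt0 ?nrm_prop_gt0.
have e10 : (1 : R) = 0 := cvg_unique (@norm_hausdorff _ _) c1 c0.
by have := oner_neq0 R; rewrite e10 eqxx.
Unshelve. all: by end_near. Qed.

End PrueferRatio.

(** * From the clock to powers of [n] *)

Section Limsup.
Context {R : realType}.

Lemma limn_esup_le (u : nat -> \bar R) (M : \bar R) (N : nat) :
  (forall n, (N <= n)%N -> (u n <= M)%E) -> (limn_esup u <= M)%E.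
Proof.
move=> uM; rewrite /limn_esup /limf_esup.
apply: (@le_trans _ _ (ereal_sup (u @` [set n | (N <= n)%N]))).
  apply: ereal_inf_lbound; exists [set n | (N <= n)%N] => //.
  by exists N.
by apply: ge_ereal_sup => _ [n Nn <-]; exact: uM.
Qed.

Variables (F E : R) (i0 : nat).
Hypothesis F0 : 0 < F.
Hypothesis hi0 : forall i, (i0 <= i)%N -> 1 + F <= freq2 F E i.
Local Notation kap := (freq F E).
Local Notation L := (clock F E i0).

Lemma limsup_rate (s : nat -> R) (tau K : R) : 0 < tau -> (forall n, 0 <= s n) ->
  (forall n, s n.+1 <= K * expR (- tau * L n)) -> forall e, 0 < e ->
  (limn_esup (fun n => elog (s n) * ((ln (n%:R : R))^-1)%:E) <= (- (tau / F) + e)%:E)%E.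
Proof.
move=> tau0 s_ge0 sK e e0; have [K0 [N0 lnL]] := ln_clock F0 hi0.
(* The part of the bound on [ln (s n.+1)] that does not grow: the constant [K], the offset of the
   clock against [ln n], and one clock step, because [s n.+1] is bounded at clock time [L n]. *)
pose C := ln (`|K| + 1) + tau * (K0 / F + 1).
have [N1 HN1] := ln_unbounded (`|C| / e + 1).
apply: (@limn_esup_le _ _ (maxn N0 N1.+1)) => n; rewrite geq_max => /andP[n0 n1].
have l1 : `|C| / e + 1 <= ln n%:R by apply: HN1; exact: ltnW.
have l0 : 0 < ln (n%:R : R).
  by apply: lt_le_trans l1; rewrite ltr_wpDl// divr_ge0// ltW.
rewrite /elog; case: ifPn => [_|s0]; first by rewrite mulNyr ?gtr0_sg ?invr_gt0// mul1e leNye.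
case: n n0 n1 l1 l0 s0 => [//|n] n0 n1 l1 l0 s0.
rewrite -EFinM lee_fin ler_pdivrMr//.
have := lnL _ n0; have := clockS F E i0 n; have := wgt_le1 F0 hi0 n => o1 LS lnl.
have Ln : (ln n.+1%:R - K0) / F - 1 <= L n.
  suff : (ln n.+1%:R - K0) / F <= L n.+1 by lra.
  by rewrite ler_pdivrMr// mulrC; lra.
have Cl : C <= e * ln n.+1%:R.
  rewrite (le_trans (ler_norm _))// mulrC -ler_pdivrMr//; lra.
have sp : 0 < s n.+1 by rewrite lt_def s0 s_ge0.
have K10 : 0 < `|K| + 1 by rewrite ltr_wpDl.
have ls : ln (s n.+1) <= ln (`|K| + 1) - tau * L n.
  rewrite -[leRHS]expRK expRD lnK ?posrE//.
  rewrite ler_ln ?posrE ?mulr_gt0 ?expR_gt0//.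
  rewrite -mulNr (le_trans (sK n))// ler_wpM2r ?expR_ge0// (le_trans (ler_norm _))// lerDl//.
apply: (le_trans ls).
have : tau * ((ln n.+1%:R - K0) / F - 1) <= tau * L n by rewrite ler_pM2l.
have -> : tau * ((ln n.+1%:R - K0) / F - 1) = tau / F * ln n.+1%:R - tau * (K0 / F + 1) by ring.
move: Cl; rewrite /C; lra.
Qed.

(** Compares [n^(1/4) <= n^(1/2) <= K * kap]. *)
Lemma rel_to0 (g : nat -> R) :
  (fun n : nat => g n / n%:R `^ (4^-1)) @ \oo --> (0 : R) -> to0 (rel F E (fun i => g i.+1)).
Proof.
move=> g0; pose K := Num.sqrt ((1 + `|E|) / F).
have K20 : 0 <= (1 + `|E|) / F by rewrite divr_ge0 ?addr_ge0// ltW.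
have h0 : to0 (fun n => g n.+1 / n.+1%:R `^ (4^-1)).
  move=> e e0; move/cvgr0Pnorm_le: g0 => /(_ e e0)[N _ HN].
  by exists N => i Ni; apply: HN => /=; rewrite (leq_trans Ni).
apply: (@to0_le _ _ _ K i0 h0) => i ii.
have k0 := freq_gt0 F0 hi0 ii; have i1 : 1 <= i.+1%:R :> R by rewrite ler1n.
have i10 : 0 < i.+1%:R :> R by rewrite ltr0n.
have w0 : 0 < i.+1%:R `^ (4^-1) :> R by rewrite powR_gt0.
have le1 : i.+1%:R `^ (4^-1) <= Num.sqrt (i.+1%:R : R).
  by rewrite -powR12_sqrt ?(ltW i10)// ler_powR// lef_pV2 ?posrE//; lra.
have le2 : Num.sqrt (i.+1%:R : R) <= K * kap i.
  rewrite -[kap i](ger0_norm (ltW k0)) -sqrtr_sqr -sqrtrM// ler_sqrt.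
    exact: freq_ge_sqrt F0 hi0 _ ii.
  by rewrite mulr_ge0 ?sqr_ge0.
rewrite /rel !normrM !normfV (gtr0_norm k0) (gtr0_norm w0) mulrCA ler_wpM2l//.
by rewrite ler_pdivlMr// mulrC ler_pdivrMr// (le_trans le1).
Qed.

End Limsup.

(** * Real form of the reference solution and of the Prüfer radius *)

Section ReferenceSolution.
Context {R : realType}.
Variables (F E : R).

Definition zeta_re (x : R) : R :=
  Num.sqrt (pi / F `^ (3^-1)) * Airy_Bi (- (F `^ (3^-1)) * (x + E / F)).
Definition zeta_im (x : R) : R :=
  Num.sqrt (pi / F `^ (3^-1)) * Airy_Ai (- (F `^ (3^-1)) * (x + E / F)).

Lemma C1_affine (f : R -> R) (c k a : R) : C1 f -> C1 (fun x => c * f (k * (x + a))).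
Proof.
move=> [f' fd fc]; exists (fun x => c * (k * f' (k * (x + a)))) => [x|].
  have h : isd (fun x => k * (x + a)) x k.
    by apply: isd_eq; last deriv; rewrite /=; ring.
  have h2 := @isd_comp _ f (fun x => k * (x + a)) x _ _ (fd _) h.
  apply: isd_eq (isdM (isd_cst c x) h2); ring.
move=> x; apply: cvgM; first exact: cvg_cst.
apply: cvgM; first exact: cvg_cst.
apply: (@continuous_comp _ _ _ (fun x => k * (x + a)) f'); last exact: fc.
apply: cvgM; first exact: cvg_cst.
by apply: cvgD; [exact: cvg_id|exact: cvg_cst].
Qed.

(** For [alpha = a + i b] the real combination is [2 a Re zeta - 2 b Im zeta], so the coefficient
    vector has length [2 |alpha|]. *)
Lemma pruefer_coeff psi m r : pruefer_radius F E psi m.+1 r ->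
  exists2 C, coeff_on zeta_re zeta_im psi m C & r = Num.sqrt (C.1 ^+ 2 + C.2 ^+ 2).
Proof.
move=> [[a b] [psiE ->]]; exists (2 * a, - (2 * b)) => /=.
  move=> x xm; have /psiE : m.+1%:R - 1 < x < m.+1%:R.
    by move: xm; rewrite /in_cell -[m.+1%:R]natr1 addrK.
  rewrite /zeta_ref /=; case=> + _; rewrite /comb /= -/(zeta_re x) -/(zeta_im x) => ->.
  by ring.
rewrite (_ : (2 * a) ^+ 2 + (- (2 * b)) ^+ 2 = 2 ^+ 2 * (a ^+ 2 + b ^+ 2)); last by ring.
by rewrite sqrtrM ?sqr_ge0// sqrtr_sqr ger0_norm.
Qed.

End ReferenceSolution.

(** * Collecting the almost sure events *)

Section AlmostSureRate.
Context d (T : measurableType d) (R : realType) (P : probability T R).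
Variables (lam : R) (g : nat -> T -> R).
Hypothesis mg : forall n, (1 <= n)%N -> measurable_fun setT (g n).
Hypothesis ind : mutually_independent P [set n | (1 <= n)%N] g.
Hypothesis g_mean : forall n, (1 <= n)%N ->
  P.-integrable setT (EFin \o g n) /\ ('E_P[g n] = 0)%E.
Hypothesis g_var : forall n, (1 <= n)%N ->
  ('E_P[fun w => (g n w ^+ 2)%R] = (lam ^+ 2)%:E)%E.
Hypothesis g_four : (\sum_(1 <= n <oo) ('E_P[fun w => (g n w ^+ 4)%R] * (n%:R ^- 2)%:E) < +oo)%E.
Hypothesis g_small : {ae P, forall w, (fun n : nat => g n w / n%:R `^ (4^-1)) @ \oo --> (0 : R)}.
Variables (F E : R) (i0 : nat).
Hypothesis F0 : 0 < F.
Hypothesis hi0 : forall i, (i0 <= i)%N -> 1 + F <= freq2 F E i.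
Variables z1 z2 dz1 dz2 : R -> R.
Hypothesis z1d : forall x, isd z1 x (dz1 x).
Hypothesis z2d : forall x, isd z2 x (dz2 x).
Hypothesis dz1c : continuous dz1.
Hypothesis dz2c : continuous dz2.
Let W := wz z1 z2 dz1 dz2 0.
Hypothesis W0 : W != 0.
Hypothesis WE : forall m x, m%:R <= x <= m.+1%:R -> wz z1 z2 dz1 dz2 x = W.
Hypothesis zsol : forall m, solves_in m (fun x => F * x + E) z1 dz1 /\
  solves_in m (fun x => F * x + E) z2 dz2.
Variables tau del : nat -> R.
Hypothesis tau0 : forall j, 0 < tau j.
Hypothesis del0 : forall j, 0 < del j.
Hypothesis tau_del : forall j, tau j + del j < lam ^+ 2 / 4.

Lemma ratio_events_ae theta theta' : {ae P, forall w,
  ratio_events F E i0 z1 z2 dz1 dz2 lam (fun n => g n w) theta theta' tau del}.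
Proof.
have h1 := sig_sum_bounded mg ind g_mean g_var F0 hi0 W0 WE theta'.
have h2 := hgt_sum_bounded mg ind g_var g_four F0 hi0 W0 WE theta'.
have h3 : {ae P, forall w, forall j (M : nat), exists B, forall n,
   `|\sum_(i < n) clamp (M%:R * rat_cut F E i0 (del j) i)
      (rat_step g F E i0 z1 z2 dz1 dz2 theta theta' (tau j) w i) * g i.+1 w| <= B}.
  apply: ae_foralln => j; apply: ae_foralln => M.
  exact: (rat_sum_bounded mg ind g_mean g_var F0 hi0 W0 theta theta' (tau j) M (del0 j)).
have FF : Filter (nbhs (almost_everywhere P)) := ae_filter_ringOfSetsType P.
apply: filterS (filterI h1 (filterI h2 h3)) => w [e1 [e2 e3]]; split.
- exact: e1.
- exact: e2.
- exact: e3.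
Qed.

Lemma almost_sure_rate theta theta' : {ae P, forall w, exists2 rho, 0 < rho & forall j,
  exists K, forall n, `|pruefer_ratio z1 z2 dz1 dz2 (fun n => g n w) theta theta' n - rho|
    <= K * expR (- tau j * clock F E i0 n)}.
Proof.
have h := wgt_sum_bounded mg ind g_var g_four F0 hi0.
have FF : Filter (nbhs (almost_everywhere P)) := ae_filter_ringOfSetsType P.
have e := @filterI _ _ FF _ _ (ratio_events_ae theta theta') (ratio_events_ae theta' theta).
apply: filterS (filterI g_small (filterI h e)) => w [/(rel_to0 F0 hi0) rel0 [[B3 M3] [e1 e2]]].
exact: (pruefer_ratio_rate F0 hi0 z1d z2d dz1c dz2c W0 WE zsol rel0 tau0 del0 tau_del M3 e1 e2).
Qed.

End AlmostSureRate.

(** * The almost sure rate for the ratio of the Prüfer radii *)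

Theorem theorem4p5 (R : realType) (d : measure_display) (T : measurableType d)
    (P : probability T R) (lambda : R) (g : nat -> T -> R)
    (F E theta_p theta_m : R)
    (psi_p psi_m : T -> R -> R) (R_p R_m : T -> nat -> R) :
  lambda != 0 ->
  (* the g_n are real random variables, independent for n >= 1 *)
  (forall n : nat, (1 <= n)%N -> measurable_fun setT (g n)) ->
  mutually_independent P [set n | (1 <= n)%N] g ->
  (* E[g_n] = 0 *)
  (forall n : nat, (1 <= n)%N ->
     P.-integrable setT (EFin \o g n) /\ ('E_P[g n] = 0)%E) ->
  (* E[g_n^2] = lambda^2 *)
  (forall n : nat, (1 <= n)%N ->
     ('E_P[fun w => (g n w ^+ 2)%R] = (lambda ^+ 2)%:E)%E) ->
  (* sum_{n>=1} E[g_n^4] n^{-2} < oo *)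
  (\sum_(1 <= n <oo) ('E_P[fun w => (g n w ^+ 4)%R] * (n%:R ^- 2)%:E) < +oo)%E ->
  (* P[ g_n n^{-1/4} -> 0 ] = 1 *)
  {ae P, forall w, (fun n : nat => g n w / n%:R `^ (4^-1)) @ \oo --> (0 : R)} ->
  0 < F ->
  0 <= theta_p < pi -> 0 <= theta_m < pi -> theta_p != theta_m ->
  (forall w, gen_eig_solution F E (fun n => g n w) theta_p (psi_p w)) ->
  (forall w, gen_eig_solution F E (fun n => g n w) theta_m (psi_m w)) ->
  (forall w (n : nat), (1 <= n)%N -> pruefer_radius F E (psi_p w) n (R_p w n)) ->
  (forall w (n : nat), (1 <= n)%N -> pruefer_radius F E (psi_m w) n (R_m w n)) ->
  {ae P, forall w, exists rho_inf : R, 0 < rho_inf /\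
     (limn_esup (fun n : nat =>
        elog `|R_p w n / R_m w n - rho_inf|%R * ((ln (n%:R : R))^-1)%:E)
      <= (- (lambda ^+ 2 / (4 * F)))%:E)%E}.
Proof.
move=> lam0 mg ind g_mean g_var g_four g_small F0 /andP[p0 ppi] /andP[m0 mpi] pm solp solm radp radm.
have indep : sin theta_p * cos theta_m - cos theta_p * sin theta_m != 0.
  rewrite -sinB; have [lt|lt|eq] := ltgtP theta_p theta_m; last by rewrite eq eqxx in pm.
    rewrite -opprB sinN oppr_eq0 gt_eqF// sin_gt0_pi//; apply/andP; split; lra.
  rewrite gt_eqF// sin_gt0_pi//; apply/andP; split; lra.
have [dz1 z1d dz1c] : C1 (zeta_re F E) := C1_affine _ _ _ Airy_Bi_C1.
have [dz2 z2d dz2c] : C1 (zeta_im F E) := C1_affine _ _ _ Airy_Ai_C1.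
have coeffs (psi : T -> R -> R) r : (forall w n, (1 <= n)%N -> pruefer_radius F E (psi w) n (r w n)) -> forall w,
    exists C : nat -> R * R, forall m, coeff_on (zeta_re F E) (zeta_im F E) (psi w) m (C m) /\
      r w m.+1 = Num.sqrt ((C m).1 ^+ 2 + (C m).2 ^+ 2).
  move=> hr w.
  have /choice[C HC] m : exists C : R * R, coeff_on (zeta_re F E) (zeta_im F E) (psi w) m C /\
      r w m.+1 = Num.sqrt (C.1 ^+ 2 + C.2 ^+ 2).
    by have [C] := pruefer_coeff (hr w m.+1 isT); exists C.
  by exists C.
pose W := wz (zeta_re F E) (zeta_im F E) dz1 dz2 0.
have {}coeffs w : exists Cp Cm : nat -> R * R,
    [/\ forall m, coeff_on (zeta_re F E) (zeta_im F E) (psi_p w) m (Cp m),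
        forall m, coeff_on (zeta_re F E) (zeta_im F E) (psi_m w) m (Cm m),
        forall m, R_p w m.+1 = Num.sqrt (nrm Cp m) & forall m, R_m w m.+1 = Num.sqrt (nrm Cm m)].
  have [Cp hp] := coeffs _ _ radp w; have [Cm hm] := coeffs _ _ radm w.
  by exists Cp, Cm; split=> m; [have [] := hp m|have [] := hm m|have [] := hp m|have [] := hm m].
have [W0 WE zsol] : [/\ W != 0,
    forall m x, m%:R <= x <= m.+1%:R -> wz (zeta_re F E) (zeta_im F E) dz1 dz2 x = W &
    forall m, solves_in m (fun x => F * x + E) (zeta_re F E) dz1 /\
      solves_in m (fun x => F * x + E) (zeta_im F E) dz2].
  (* The reference solution is deterministic, so the solutions at a single sample determine its
     Wronskian and its equation. *)
  have [Cp [Cm [hp hm _ _]]] := coeffs point.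
  split.
  - exact: (wz0_neq0 z1d z2d dz1c dz2c (solp point) (solm point) hp hm indep).
  - exact: (wz_const z1d z2d dz1c dz2c (solp point) (solm point) hp hm indep).
  - exact: (z_solves z1d z2d dz1c dz2c (solp point) (solm point) hp hm indep).
have [i0 hi0] : exists i0, forall i, (i0 <= i)%N -> 1 + F <= freq2 F E i.
  exists (Num.bound `|(1 + F - E) / F|) => i; rewrite -(ler_nat R) => ii.
  have := archi_boundP (normr_ge0 ((1 + F - E) / F)) => h.
  have : (1 + F - E) / F <= i.+1%:R.
    rewrite (le_trans (ler_norm _))// (le_trans (ltW h))// (le_trans ii)// ler_nat//.
  by rewrite ler_pdivrMr// /freq2; lra.
have l20 : 0 < lambda ^+ 2 by rewrite exprn_even_gt0.
(* With [tau j = lambda^2 / 4 - 2 del j] one has [tau j >= lambda^2 / 8], a gap [del j] below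
   [lambda^2 / 4] after adding [del j], and convergence of [tau j] to [lambda^2 / 4]. *)
pose del (j : nat) := lambda ^+ 2 / 16 / j.+1%:R.
pose tau j := lambda ^+ 2 / 4 - 2 * del j.
have del0 j : 0 < del j by rewrite /del !divr_gt0.
have tau0 j : 0 < tau j.
  have : del j <= lambda ^+ 2 / 16 by rewrite /del ler_piMr ?invf_le1 ?ler1n// ltW// divr_gt0.
  rewrite /tau; lra.
have tau_del j : tau j + del j < lambda ^+ 2 / 4 by have := del0 j; rewrite /tau; lra.
have := almost_sure_rate mg ind g_mean g_var g_four g_small F0 hi0 z1d z2d dz1c dz2c W0 WE zsol
  tau0 del0 tau_del theta_p theta_m.
apply: filterS => w [rho rho0 Hrho]; exists rho; split=> //.
have [Cp [Cm [hp hm rp rm]]] := coeffs w.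
have EP := coeff_prop z1d z2d dz1c dz2c W0 WE (solp w) hp.
have EM := coeff_prop z1d z2d dz1c dz2c W0 WE (solm w) hm.
(* The radius with index [n + 1] belongs to the cell [(n, n + 1)], whose coefficients carry the
   index [n]. *)
have ratioE n : R_p w n.+1 / R_m w n.+1 =
    pruefer_ratio (zeta_re F E) (zeta_im F E) dz1 dz2 (fun n => g n w) theta_p theta_m n.
  by rewrite rp rm /pruefer_ratio /nrm EP EM.
apply/lee_addgt0Pr => e e0.
(* Half of [e] pays for the gap between [tau j] and [lambda^2 / 4], the other half for the slack in
   [limsup_rate]. *)
have [j Hj] : exists j, 2 * del j / F <= e / 2.
  exists (Num.bound `|lambda ^+ 2 / 16 * 4 / F / e|).
  have := archi_boundP (normr_ge0 (lambda ^+ 2 / 16 * 4 / F / e)).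
  set N := Num.bound _ => h.
  have : lambda ^+ 2 / 16 * 4 / F / e <= N.+1%:R.
    by rewrite (le_trans (ler_norm _))// (le_trans (ltW h))// ler_nat.
  have : 0 < N.+1%:R :> R by rewrite ltr0n.
  rewrite ler_pdivrMr// /del; move: N.+1%:R => M M0 hh.
  have -> : 2 * (lambda ^+ 2 / 16 / M) / F = (lambda ^+ 2 / 16 * 4 / F) / M / 2.
    by field; rewrite !gt_eqF.
  by rewrite ler_pM2r ?invr_gt0// ler_pdivrMr// [leRHS]mulrC.
have [K HK] := Hrho j; have e20 : 0 < e / 2 by rewrite divr_gt0.
have := @limsup_rate _ F E i0 F0 hi0 (fun n => `|R_p w n / R_m w n - rho|) (tau j) K (tau0 j)
  (fun n => normr_ge0 _) _ _ e20.
move=> /(_ _)/le_trans; apply; first by move=> n; rewrite ratioE.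
rewrite -EFinD lee_fin /tau.
have -> : (lambda ^+ 2 / 4 - 2 * del j) / F = lambda ^+ 2 / (4 * F) - 2 * del j / F.
  by field; rewrite gt_eqF.
lra.
Qed.
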